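(* There exists a universal constant $C>0$ such that the following holds. Let $G$ be a centered Gaussian vector with values in a separable Banach space $E$ and let $\Sigma:E^*\to E$, $\Sigma u=\mathbb{E}\langle G,u\rangle G$, be its covariance operator, with $\Sigma\neq0$. Let $n\ge1$, let $G_1,\ldots,G_n$ be i.i.d. copies of $G$ and define $\hat\Sigma:E^*\to E$ by $$\hat\Sigma u=\frac1n\sum_{k=1}^n\langle G_k,u\rangle G_k,\qquad u\in E^*.$$ Then, for any $t\ge1$, $$\mathbb{P}\Big(\Big|\|\hat\Sigma-\Sigma\|-\mathbb{E}\|\hat\Sigma-\Sigma\|\Big|\ge C\|\Sigma\|\Big(\Big(1+\sqrt{\frac{r(\Sigma)}{n}}\Big)\sqrt{\frac tn}+\frac tn\Big)\Big)\le e^{-t},$$ where $r(\Sigma)=\dfrac{(\mathbb{E}\|G\|)^2}{\|\Sigma\|}$.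
   Context: $E$ is a real Banach space, $E^*$ its dual, and $\langle x,u\rangle$ denotes the value of the functional $u\in E^*$ at $x\in E$. The symbol $\|\cdot\|$ denotes both the norm of a vector in $E$ and the operator norm of an operator $E^*\to E$. *)

(* Defs.v *)
From HB Require Import structures.
From mathcomp Require Import all_boot all_order all_algebra.
From mathcomp Require Import all_classical all_reals all_analysis.
Set Implicit Arguments.
Unset Strict Implicit.
Unset Printing Implicit Defensive.
Import Order.TTheory GRing.Theory Num.Theory.
Import numFieldNormedType.Exports.
Local Open Scope classical_set_scope.
Local Open Scope ring_scope.

Definition separable (T : topologicalType) : Prop :=
  exists2 D : set T, countable D & dense D.

(* Borel sigma-algebra; the carrier of [borel T] is convertible to [T] *)
Notation borel T := (g_sigma_algebraType (@open T)).

Record dual (R : realType) (E : normedModType R) := Dual {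
  dual_fun :> {linear E -> R^o} ;
  dual_continuous : continuous dual_fun }.

Section operator_norm.
Context (R : realType) (E : normedModType R).

(* Suprema are taken in R: they are the usual ones because elements of the
   dual are bounded, and [opnorm] is only meant for bounded operators. *)
Definition dual_norm (u : dual E) : R :=
  sup [set `|u x| | x in [set x : E | `|x| <= 1]].

Definition opnorm (A : dual E -> E) : R :=
  sup [set `|A u| | u in [set u : dual E | dual_norm u <= 1]].

End operator_norm.

Section vector_expectation.
Context d (Omega : measurableType d) (R : realType) (P : probability Omega R).
Context (E : normedModType R).

Definition simple (s : Omega -> E) : Prop :=
  measurable_fun setT (s : Omega -> borel E) /\ finite_set (range s).

Definition simple_expectation (s : Omega -> E) : E :=
  \sum_(y \in range s) fine (P (s @^-1` [set y])) *: y.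

Definition is_bochner_expectation (f : Omega -> E) (y : E) : Prop :=
  measurable_fun setT (f : Omega -> borel E) /\
  exists s : nat -> Omega -> E,
    [/\ forall k, simple (s k),
        (\int[P]_w (`|f w - s k w|)%:E)%E @[k --> \oo] --> 0%E &
        simple_expectation (s k) @[k --> \oo] --> y].

(* The (unique) Bochner expectation of [f]; 0 if [f] is not integrable. *)
Definition bochner_expectation (f : Omega -> E) : E :=
  xget 0 [set y | is_bochner_expectation f y].

End vector_expectation.

Section gaussian.
Context d (Omega : measurableType d) (R : realType) (P : probability Omega R).

(* [normal_prob 0 0] is the uniform law on [0, 1] in the library, so that the
   degenerate Gaussian law has to be treated apart. *)
Definition centered_gaussian_rv (X : Omega -> R) : Prop :=
  exists s : R, forall A : set R, measurable A ->
    P (X @^-1` A) = if s == 0 then \d_(0 : R) A else normal_prob 0 s A.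

Context (E : normedModType R).

Definition centered_gaussian_vector (G : {RV P >-> borel E}) : Prop :=
  forall u : dual E, centered_gaussian_rv (fun w => u (G w)).

Definition covariance_op (G : Omega -> E) (u : dual E) : E :=
  bochner_expectation P (fun w => (u (G w) : R) *: G w).

Definition effective_rank (G : Omega -> E) : R :=
  (fine 'E_P[fun w => `|G w|]) ^+ 2 / opnorm (covariance_op G).

End gaussian.

Definition sample_covariance_op (R : realType) (E : normedModType R) (n : nat)
    (x : 'I_n -> E) (u : dual E) : E :=
  n%:R^-1 *: \sum_(k < n) (u (x k) : R) *: x k.

Section iid.
Context d (Omega : measurableType d) (R : realType) (P : probability Omega R).
Context d' (T : measurableType d').

Definition mutually_independent (I : finType) (X : I -> {RV P >-> T}) : Prop :=
  forall (J : {set I}) (A : I -> set T), (forall i, measurable (A i)) ->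
    P (\bigcap_(i in [set` J]) (X i @^-1` A i)) =
    (\prod_(i in J) P (X i @^-1` A i))%E.

Definition same_law (X Y : {RV P >-> T}) : Prop :=
  forall A : set T, measurable A -> distribution P X A = distribution P Y A.

Definition iid_copies (I : finType) (X_ : I -> {RV P >-> T})
    (X : {RV P >-> T}) : Prop :=
  mutually_independent X_ /\ forall i, same_law (X_ i) X.

End iid.

(* Main.v *)
Require Import Defs.
From HB Require Import structures.
From mathcomp Require Import all_boot all_order all_algebra.
From mathcomp Require Import all_classical all_reals all_analysis.
From mathcomp Require Import measurable_realfun ring lra.
Set Implicit Arguments.
Unset Strict Implicit.
Unset Printing Implicit Defensive.
Import Order.TTheory GRing.Theory Num.Theory.
Import numFieldNormedType.Exports.
Local Open Scope classical_set_scope.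
Local Open Scope ring_scope.

(** Concentration of the sample covariance operator, by a self-bounding argument.

    Let [s] be the norm of [Sigma], and [F] the norm of the deviation of the
    sample covariance from [Sigma]. Since [E] is separable and covariances are
    symmetric, [F] is the supremum over a sequence of pairs [(u, v)] of
    contractive functionals of the quadratic forms
    [| 1/n * sum_k u(G_k) v(G_k) - E u(G) v(G) |] in Gaussian variables
    ([deviation_ge], [deviation_le]); [norming_functional], a form of the
    Hahn-Banach theorem, provides the functionals. For finitely many pairs
    everything is a function of a finite-dimensional centered Gaussian vector
    [X], and the Maurey-Pisier rotation argument applies: if [X'] is an
    independent copy of [X], the points [sin(th) X + cos(th) X'] and their
    derivatives in [th] are again independent copies, and one goes from [X'] to
    [X] in [N] small rotations. The result is ([rotation_concentration])
    [[
      (E exp(l F) * E exp(- l F)) ^ 2 <= E exp(8 l^2 S),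
    ]]
    where [S] bounds the variance of the linear part of [F] at [X]. The argument
    uses the rotation invariance of pairs of Gaussian vectors
    ([gaussian_family_rotation]), which is reduced to linear images by the
    Cramer-Wold theorem ([cramer_wold]).

    For the quadratic forms above, [S] is of order [s/n] times a sample second
    moment [1/n * sum_k u(G_k)^2], and such a moment is at most [s + F]. So the
    right-hand side is an exponential moment of [F] itself, with the small factor
    [32 l^2 s / n]. For [l <= n / (64 s)] it is absorbed in the left-hand side,
    and both moments of [l (F - E F)] are at most
    [exp(32 l^2 s (s + E F) / n)] ([self_bounded_expR]). The Markov inequality
    with an optimal [l] then gives the two tails.

    What remains is the finiteness of [E exp(l F)] for these [l], together with a
    bound [E F <= s (128 + 4 r / n)], where [r = (E |G|)^2 / s]. Both come from
    [deviation_expR_lty]: [F] is at most [s] plus the supremum of the sample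
    second moments; the square in the exponent is linearized by independent
    Gaussian multipliers [g_k], the vector [sum_k g_k G_k] has the law of [|g| G]
    for fixed [g], and the exponential moments of [|G|] are bounded by the same
    rotation argument, with constant [S] ([norm_vector_subgaussian]). The latter
    moments also make [|G|] square-integrable, so that the Bochner expectation
    that defines [Sigma] exists and commutes with functionals
    ([covariance_op_dual]). *)

(** * Hahn-Banach and norming functionals *)

Section hahn_banach.
Context (R : realType) (E : normedModType R).

(** Graph of a linear functional that is defined on a subspace and dominated by
    the norm; domination makes the graph single-valued. *)
Definition dominated_graph (g : set (E * R)) : Prop :=
  [/\ g (0, 0),
      forall x y r s, g (x, r) -> g (y, s) -> g (x + y, r + s),
      forall a x r, g (x, r) -> g (a *: x, a * r) &
      forall x r, g (x, r) -> r <= `|x|].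

Lemma dominated_graph_uniq g x r s :
  dominated_graph g -> g (x, r) -> g (x, s) -> r = s.
Proof.
move=> [g0 gD gZ gle].
have H p q : g (x, p) -> g (x, q) -> p <= q.
  move=> gp gq; have := gD _ _ _ _ gp (gZ (-1) _ _ gq).
  by rewrite scaleN1r subrr mulN1r => /gle; rewrite normr0 subr_le0.
by move=> gr gs; apply/eqP; rewrite eq_le !H.
Qed.

(** The one-dimensional extension step: the value [c] at [y] is chosen between
    the constraints imposed by the points of the graph on both sides. *)
Lemma dominated_graph_extend g y : dominated_graph g ->
  exists2 g', dominated_graph g' & g `<=` g' /\ exists c, g' (y, c).
Proof.
move=> [g0 gD gZ gle].
pose A := [set p.2 - `|p.1 - y| | p in g].
have Aub p' : g p' -> ubound A (`|p'.1 + y| - p'.2).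
  case: p' => x' r' /= g' _ [[x r] gp /= <-].
  rewrite lerBlDr addrAC -lerBlDr opprK.
  apply: (le_trans (gle _ _ (gD _ _ _ _ gp g'))).
  by rewrite [leRHS]addrC (_ : x + x' = (x - y) + (x' + y)) ?ler_normD// addrACA addNr addr0.
have A0 : A !=set0 by exists (0 - `|0 - y|); exists (0, 0).
have supA : has_sup A by split => //; eexists; apply: Aub g0.
pose c := sup A.
have cle x r : g (x, r) -> c <= `|x + y| - r.
  by move=> gp; apply: ge_sup => //; exact: (Aub (x, r)).
have cge x r : g (x, r) -> r - `|x - y| <= c.
  by move=> gp; apply: ub_le_sup => //; [case: supA|exists (x, r)].
exists [set p | exists x r t, g (x, r) /\ p = (x + t *: y, r + t * c)].
  split.
  - by exists 0, 0, 0; split => //; rewrite scale0r mul0r !addr0.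
  - move=> _ _ _ _ [x [r [t [gx [-> ->]]]]] [x' [r' [t' [gx' [-> ->]]]]].
    exists (x + x'), (r + r'), (t + t'); split; first exact: gD.
    by rewrite scalerDl mulrDl; congr pair; rewrite addrACA.
  - move=> a _ _ [x [r [t [gx [-> ->]]]]].
    exists (a *: x), (a * r), (a * t); split; first exact: gZ.
    by rewrite scalerDr mulrDr scalerA mulrA.
  - move=> _ _ [x [r [t [gx [-> ->]]]]].
    have [t0|t0|->] := ltrgtP t 0; last by rewrite scale0r mul0r !addr0; exact: gle.
    + have Nt0 : 0 < - t by rewrite oppr_gt0.
      have := cge _ _ (gZ (- t)^-1 _ _ gx).
      rewrite -(ler_pM2l Nt0) mulrBr mulrA divff ?gt_eqF// mul1r.
      have -> : - t * `|(- t)^-1 *: x - y| = `|x + t *: y|.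
        by rewrite -{1}(gtr0_norm Nt0) -normrZ scalerBr scalerA divff ?gt_eqF// scale1r scaleNr opprK.
      by lra.
    + have := cle _ _ (gZ t^-1 _ _ gx).
      rewrite -(ler_pM2l t0) mulrBr mulrA divff ?gt_eqF// mul1r.
      have -> : t * `|t^-1 *: x + y| = `|x + t *: y|.
        by rewrite -{1}(gtr0_norm t0) -normrZ scalerDr scalerA divff ?gt_eqF// scale1r.
      by lra.
split.
  by move=> [x r] gx; exists x, r, 0; split => //; rewrite scale0r mul0r !addr0.
by exists c, 0, 0, 1; split => //; rewrite scale1r mul1r !add0r.
Qed.

(** Zorn's lemma on the graphs that contain [g]. The empty set is allowed as a
    member so that the union of the empty chain belongs to the family. *)
Lemma dominated_graph_total g : dominated_graph g ->
  exists2 g', dominated_graph g' & g `<=` g' /\ forall y, exists c, g' (y, c).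
Proof.
move=> gg.
pose P := [set h | h = set0 \/ dominated_graph h /\ g `<=` h].
have [F FP tF|A [PA Amax]] := @Zorn_bigcup _ P.
  have [H|/existsNP[h /not_implyP[Fh hn]]] := pselect (forall h, F h -> h = set0).
    by left; apply/seteqP; split => // x [h Fh]; rewrite (H _ Fh).
  have [//|[hg gh]] := FP _ Fh.
  right; split; last by move=> x gx; exists h => //; exact: gh.
  have good h' x : F h' -> h' x -> dominated_graph h'.
    by move=> Fh' h'x; case: (FP _ Fh') => [h'0|[]//]; rewrite h'0 in h'x.
  split.
  - by exists h => //; case: hg.
  - move=> x y r s [h1 F1 h1x] [h2 F2 h2y].
    have [h12|h21] := tF _ _ F1 F2.
      by exists h2 => //; have [_ D _ _] := good _ _ F2 h2y; apply: D => //; apply: h12.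
    by exists h1 => //; have [_ D _ _] := good _ _ F1 h1x; apply: D => //; apply: h21.
  - move=> a x r [h1 F1 h1x].
    by exists h1 => //; have [_ _ Z _] := good _ _ F1 h1x; apply: Z.
  - move=> x r [h1 F1 h1x].
    by have [_ _ _ L] := good _ _ F1 h1x; apply: L.
have [A0|[Ag gA]] := PA.
  exfalso; apply: (Amax g) (or_intror (conj gg (fun p gp => gp))).
  by rewrite A0; split; [exact: sub0set|move=> /(_ (0, 0)); apply; case: gg].
exists A => //; split => [//|y].
have [A' A'g [AA' [c A'y]]] := dominated_graph_extend y Ag.
exists c; apply: contrapT => nAy.
apply: (Amax A') (or_intror (conj A'g (subset_trans gA AA'))).
by split; [exact: AA'|move=> A'A; apply: nAy; apply: A'A].
Qed.

(** The extension of [t x0 |-> t |x0|] from the line through [x0]. *)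
Lemma norming_functional (x0 : E) :
  exists u : dual E, (forall x, `|u x| <= `|x|) /\ u x0 = `|x0|.
Proof.
pose g0 := [set p : E * R | exists t, p = (t *: x0, t * `|x0|)].
have gg0 : dominated_graph g0.
  split.
  - by exists 0; rewrite scale0r mul0r.
  - by move=> _ _ _ _ [t [-> ->]] [s [-> ->]]; exists (t + s); rewrite scalerDl mulrDl.
  - by move=> a _ _ [t [-> ->]]; exists (a * t); rewrite scalerA mulrA.
  - by move=> _ _ [t [-> ->]]; rewrite normrZ ler_wpM2r// ler_norm.
have [g gg [g0g gtot]] := dominated_graph_total gg0.
have /choice[f gf] := gtot.
have [_ gD gZ gle] := gg.
have flin : linear (f : E -> R^o).
  move=> a x y; apply: (dominated_graph_uniq gg (gf _)).
  exact: gD (gZ _ _ _ (gf _)) (gf _).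
pose fL : {linear E -> R^o} := HB.pack f (GRing.isLinear.Build _ _ _ _ f flin).
have fle x : `|f x| <= `|x|.
  rewrite ler_norml gle// andbT lerNl.
  by have := gle _ _ (gZ (-1) _ _ (gf x)); rewrite mulN1r scaleN1r normrN.
have fc : continuous (fL : E -> R^o).
  apply: bounded_linear_continuous; apply/ex_bound; exists 1.
  near=> x; apply: (le_trans (fle x)).
  by near: x; apply: nbhs0_le.
exists (Dual fc); split => //=.
apply: (dominated_graph_uniq gg (gf _)).
by apply: g0g; exists 1; rewrite scale1r mul1r.
Unshelve. all: by end_near.
Qed.

End hahn_banach.

(** * Centered Gaussian laws on the line *)

Lemma eqW d (T : porderType d) (x y : T) : x = y -> (x <= y)%O.
Proof. by move->. Qed.

Section measurability.
Context d (T : measurableType d) (R : realType) (f : T -> R).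
Hypothesis mf : measurable_fun setT f.

Lemma measurable_expRM c : measurable_fun setT (fun x => (expR (c * f x))%:E).
Proof.
apply/measurable_EFinP; apply: measurableT_comp => //.
exact: measurable_funM.
Qed.

Lemma measurable_sublevel c : measurable [set x | f x <= c].
Proof.
rewrite (_ : [set _ | _] = f @^-1` `]-oo, c]).
  by rewrite -[X in measurable X]setTI; exact: mf.
by apply/seteqP; split => x /=; rewrite in_itv.
Qed.

End measurability.

Section gaussian_law.
Context (R : realType).
Local Notation mu := (@lebesgue_measure R).
Local Open Scope ereal_scope.

Lemma ge0_integral_normal_prob (m s : R) (f : R -> \bar R) :
  s != 0%R -> measurable_fun setT f -> (forall x, 0 <= f x) ->
  \int[normal_prob m s]_x f x = \int[mu]_x (f x * (normal_pdf m s x)%:E).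
Proof.
move=> s0 mf f0.
have dom := @normal_prob_dominates R m s.
rewrite -(Radon_Nikodym_SigmaFinite.change_of_variables dom)//.
have gint := Radon_Nikodym_SigmaFinite.f_integrable dom.
have mpdf : measurable_fun setT (fun x => (normal_pdf m s x)%:E).
  by apply/measurable_EFinP; exact: measurable_normal_pdf.
apply: ae_eq_integral => //.
- by apply: emeasurable_funM => //; exact: measurable_int gint.
- exact: emeasurable_funM.
- apply: ae_eqe_mul2l; apply: integral_ae_eq => //.
  move=> E _ mE.
  by rewrite -Radon_Nikodym_SigmaFinite.f_integral.
Qed.

(** Translation invariance holds on the half-open intervals, which determine the
    Lebesgue measure. *)
Lemma ge0_integral_shift (g : R -> \bar R) (c : R) :
  measurable_fun setT g -> (forall x, 0 <= g x) ->
  \int[mu]_x g (x - c)%R = \int[mu]_x g x.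
Proof.
move=> mg g0.
have mphi : measurable_fun setT ((fun x : R => x - c)%R : measurableTypeR R -> measurableTypeR R).
  by apply: measurable_funB.
have <- : \int[pushforward mu ((fun x : R => x - c)%R : measurableTypeR R -> measurableTypeR R)]_x g x
    = \int[mu]_x g (x - c)%R.
  by rewrite ge0_integral_pushforward.
apply: eq_measure_integral => A mA _.
apply/esym/lebesgue_measure_unique => //= _ [[a b]] _ <-.
rewrite /pushforward.
have -> : (fun x : R => (x - c)%R) @^-1` `]a, b] = [set` `](a + c)%R, (b + c)%R]].
  by apply/seteqP; split => x /=; rewrite !in_itv/= ltrBrDr lerBlDr.
rewrite [LHS]lebesgue_measure_itv [RHS]lebesgue_measure_itv/= !lte_fin ltrD2r.
by case: ifP => // _; rewrite -!EFinB; congr EFin; ring.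
Qed.

(** Variance 0 is a separate case because [normal_prob 0 0] is not the Dirac
    mass at 0. *)
Definition gaussian_law (v : R) : probability (measurableTypeR R) R :=
  if v == 0%R then [the probability (measurableTypeR R) R of \d_(0%R : measurableTypeR R)]
  else [the probability (measurableTypeR R) R of normal_prob 0 (Num.sqrt v)].

Lemma normal_pdf_var (m v x : R) : (0 < v)%R ->
  normal_pdf m (Num.sqrt v) x =
  ((Num.sqrt (v * pi *+ 2))^-1 * expR (- (x - m) ^+ 2 / (v *+ 2)))%R.
Proof.
move=> v0; rewrite normal_pdfE; last by rewrite gt_eqF// sqrtr_gt0.
by rewrite /normal_peak /normal_fun sqr_sqrtr// ltW.
Qed.

Lemma ge0_integral_gaussian_law (v : R) (f : R -> \bar R) :
  (0 < v)%R -> measurable_fun setT f -> (forall x, 0 <= f x) ->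
  \int[gaussian_law v]_x f x = \int[mu]_x (f x * (normal_pdf 0 (Num.sqrt v) x)%:E).
Proof.
move=> v0 mf f0; rewrite /gaussian_law gt_eqF//.
by apply: ge0_integral_normal_prob => //; rewrite gt_eqF// sqrtr_gt0.
Qed.

Lemma integral_gaussian_law0 (f : R -> \bar R) :
  measurable_fun setT f -> \int[gaussian_law 0]_x f x = f 0%R.
Proof.
move=> mf; rewrite /gaussian_law eqxx integral_dirac//.
by rewrite diracT mul1e.
Qed.

(** Completing the square turns the integrand into a shifted Gaussian density. *)
Lemma gaussian_law_expR (v c : R) : (0 <= v)%R ->
  \int[gaussian_law v]_x (expR (c * x))%:E = (expR (c ^+ 2 * v / 2))%:E.
Proof.
move=> v0.
have mf : measurable_fun setT (fun x : R => (expR (c * x))%:E).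
  exact: measurable_expRM.
have [v00|vn0] := eqVneq v 0%R.
  by rewrite v00 integral_gaussian_law0// !mulr0 mul0r expR0.
have {vn0}v0 : (0 < v)%R by rewrite lt_neqAle eq_sym vn0.
rewrite ge0_integral_gaussian_law//.
transitivity (\int[mu]_x ((expR (c ^+ 2 * v / 2))%:E *
    (normal_pdf (c * v) (Num.sqrt v) x)%:E)).
  apply: eq_integral => x _; rewrite -!EFinM; congr EFin.
  rewrite !normal_pdf_var// mulrCA [RHS]mulrCA -!expRD; congr (_ * expR _)%R.
  by field; rewrite gt_eqF.
rewrite ge0_integralZl//.
- by rewrite integral_normal_pdf mule1.
- by apply/measurable_EFinP; exact: measurable_normal_pdf.
- by move=> x _; rewrite lee_fin normal_pdf_ge0.
Qed.

(** The integrand is a multiple of the Gaussian density of variance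
    [v / (1 - 2 e v)]. *)
Lemma gaussian_law_expR_sqr (v e : R) : (0 <= v)%R -> (2 * e * v < 1)%R ->
  \int[gaussian_law v]_x (expR (e * x ^+ 2))%:E =
  ((Num.sqrt (1 - 2 * e * v))^-1)%:E.
Proof.
move=> v0 ev.
have mf : measurable_fun setT (fun x : R => (expR (e * x ^+ 2))%:E).
  by apply: measurable_expRM; exact: measurable_funX.
have [v00|vn0] := eqVneq v 0%R.
  rewrite v00 integral_gaussian_law0// expr0n/= !mulr0 expR0 subr0.
  by rewrite sqrtr1 invr1.
have {vn0}v0 : (0 < v)%R by rewrite lt_neqAle eq_sym vn0.
rewrite ge0_integral_gaussian_law//.
have D0 : (0 < 1 - 2 * e * v)%R by rewrite subr_gt0.
pose v' := (v / (1 - 2 * e * v))%R.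
have v'0 : (0 < v')%R by rewrite divr_gt0.
transitivity (\int[mu]_x (((Num.sqrt (1 - 2 * e * v))^-1)%:E *
    (normal_pdf 0 (Num.sqrt v') x)%:E)).
  apply: eq_integral => x _; rewrite -!EFinM; congr EFin.
  rewrite !normal_pdf_var// mulrCA -expRD [RHS]mulrA; congr (_ * expR _)%R.
    rewrite -invfM; congr (_^-1)%R.
    rewrite -sqrtrM ?ltW//; congr Num.sqrt.
    by rewrite /v'; field; rewrite gt_eqF.
  by rewrite /v' subr0; field; rewrite !gt_eqF.
rewrite ge0_integralZl//.
- by rewrite integral_normal_pdf mule1.
- by apply/measurable_EFinP; exact: measurable_normal_pdf.
- by move=> x _; rewrite lee_fin normal_pdf_ge0.
Qed.

(** The inequality [1 + y <= exp y] at [y = e x^2 / v] and [y = - e x^2 / v],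
    integrated, squeezes the second moment between two bounds that tend to [v]
    with [e]. *)
Lemma gaussian_law_sqr (v : R) : (0 <= v)%R ->
  \int[gaussian_law v]_x (x ^+ 2)%:E = v%:E.
Proof.
move=> v0.
have mf : measurable_fun setT (fun x : R => (x ^+ 2)%:E).
  by apply/measurable_EFinP; exact: measurable_funX.
have [v00|vn0] := eqVneq v 0%R.
  by rewrite v00 integral_gaussian_law0// expr0n.
have {vn0}v0 : (0 < v)%R by rewrite lt_neqAle eq_sym vn0.
set I := \int[_]_x _.
have I0 : 0 <= I by apply: integral_ge0 => x _; rewrite lee_fin sqr_ge0.
have mexp c : measurable_fun setT (fun x : R => (expR (c * x ^+ 2))%:E).
  by apply: measurable_expRM; exact: measurable_funX.
have IZ c : (0 <= c)%R -> \int[gaussian_law v]_x (c * x ^+ 2)%:E = c%:E * I.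
  move=> c0; under eq_integral do rewrite EFinM.
  by rewrite ge0_integralZl// => x _; rewrite lee_fin sqr_ge0.
have mZ c : measurable_fun setT (fun x : R => (c * x ^+ 2)%:E).
  apply/measurable_EFinP.
  by apply: measurable_funM => //; exact: measurable_funX.
have int1 : \int[gaussian_law v]_x 1 = 1.
  by rewrite integral_cst// mul1e; exact: probability_setT.
have up e : (0 < e)%R -> (e <= 1/8)%R -> I <= (v * (1 + 4 * e))%:E.
  move=> e0 e8.
  have ev : (2 * (e / v) * v = 2 * e)%R by field; rewrite gt_eqF.
  have : \int[gaussian_law v]_x (1 + (e / v * x ^+ 2)%:E) <=
         \int[gaussian_law v]_x (expR (e / v * x ^+ 2))%:E.
    apply: ge0_le_integral => //.
    - by move=> x _; rewrite -EFinD lee_fin addr_ge0// mulr_ge0 ?sqr_ge0// divr_ge0 ?ltW.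
    - by apply: emeasurable_funD (mZ _); exact: measurable_cst.
    - exact: mexp.
    - by move=> x _; rewrite -EFinD lee_fin expR_ge1Dx.
  rewrite ge0_integralD//; last 2 first.
  - by move=> x _; rewrite lee_fin mulr_ge0 ?sqr_ge0// divr_ge0 ?ltW.
  - exact: mZ.
  rewrite int1 IZ; last by rewrite divr_ge0 ?ltW.
  rewrite (gaussian_law_expR_sqr (ltW v0)); last by rewrite ev; lra.
  rewrite ev.
  have D0 : (0 < 1 - 2 * e)%R by lra.
  have : ((Num.sqrt (1 - 2 * e))^-1 <= 1 + e + 4 * e ^+ 2)%R.
    rewrite -[leLHS]mul1r ler_pdivrMr ?sqrtr_gt0//.
    have -> : (1 + e + 4 * e ^+ 2 = Num.sqrt ((1 + e + 4 * e ^+ 2) ^+ 2))%R.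
      by rewrite sqrtr_sqr ger0_norm//; nra.
    rewrite -sqrtrM ?sqr_ge0// -{1}(sqrtr1 R) ler_sqrt; last by rewrite mulr_ge0 ?sqr_ge0 ?(ltW D0).
    rewrite -subr_ge0 (_ : _ - 1 = e ^+ 2 * (5 - 10 * e - 32 * e ^+ 3))%R; last by ring.
    have e3 : (e ^+ 3 <= (1/8) ^+ 3)%R by rewrite lerXn2r// ?nnegrE; lra.
    by apply: mulr_ge0; [exact: sqr_ge0|lra].
  case: I I0 {IZ} => [r| |]; rewrite ?lee_fin//.
    move=> r0 h h'.
    have {h'}h' := le_trans h' h.
    have : (e / v * r <= e + 4 * e ^+ 2)%R by lra.
    rewrite mulrAC ler_pdivrMr// => h2.
    have : (e * r <= e * (v * (1 + 4 * e)))%R.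
      by apply: (le_trans h2); apply: eqW; ring.
    by rewrite ler_pM2l.
  by move=> _ _; rewrite gt0_muley ?lte_fin ?divr_gt0// addey.
have lo e : (0 < e)%R -> (e <= 1/8)%R -> (v * (1 - 4 * e))%:E <= I.
  move=> e0 e8.
  have ev : (2 * (- (e / v)) * v = - (2 * e))%R by field; rewrite gt_eqF.
  have : \int[gaussian_law v]_x 1 <=
         \int[gaussian_law v]_x ((expR (- (e / v) * x ^+ 2))%:E + (e / v * x ^+ 2)%:E).
    apply: ge0_le_integral => //.
    - exact: emeasurable_funD (mexp _) (mZ _).
    - move=> x _; rewrite -EFinD lee_fin.
      by have := expR_ge1Dx (- (e / v) * x ^+ 2)%R; rewrite mulNr; lra.
  rewrite ge0_integralD//; last 3 first.
  - exact: mexp.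
  - by move=> x _; rewrite lee_fin mulr_ge0 ?sqr_ge0// divr_ge0 ?ltW.
  - exact: mZ.
  rewrite int1 IZ; last by rewrite divr_ge0 ?ltW.
  rewrite (gaussian_law_expR_sqr (ltW v0)); last by rewrite ev; lra.
  rewrite ev opprK.
  have D0 : (0 < 1 + 2 * e)%R by lra.
  have : ((Num.sqrt (1 + 2 * e))^-1 <= 1 - e + 4 * e ^+ 2)%R.
    rewrite -[leLHS]mul1r ler_pdivrMr ?sqrtr_gt0//.
    have -> : (1 - e + 4 * e ^+ 2 = Num.sqrt ((1 - e + 4 * e ^+ 2) ^+ 2))%R.
      by rewrite sqrtr_sqr ger0_norm//; nra.
    rewrite -sqrtrM ?sqr_ge0// -{1}(sqrtr1 R) ler_sqrt; last by rewrite mulr_ge0 ?sqr_ge0 ?(ltW D0).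
    rewrite -subr_ge0 (_ : _ - 1 = e ^+ 2 * (5 + 10 * e + 32 * e ^+ 3))%R; last by ring.
    have e3 : (0 <= e ^+ 3)%R by rewrite exprn_ge0 ?ltW.
    by apply: mulr_ge0; [exact: sqr_ge0|lra].
  case: I I0 {IZ up} => [r| |]; rewrite ?lee_fin ?leey//.
    move=> r0 h h'.
    have : (e - 4 * e ^+ 2 <= e / v * r)%R by lra.
    rewrite [leRHS]mulrAC ler_pdivlMr// => h2.
    have : (e * (v * (1 - 4 * e)) <= e * r)%R.
      by apply: le_trans h2; apply: eqW; ring.
    by rewrite ler_pM2l.
have Ifin : I \is a fin_num.
  rewrite ge0_fin_numE// (le_lt_trans (up (1/8)%R _ _)) ?ltry//; lra.
have Ir := fineK Ifin; rewrite -Ir.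
congr EFin; apply/eqP; rewrite eq_le; apply/andP; split.
- apply/ler_addgt0Pr => d d0.
  pose e := Num.min (1/8)%R (d / (4 * v))%R.
  have e0 : (0 < e)%R by rewrite lt_min divr_gt0//= ?divr_gt0// mulr_gt0.
  have e1 : (e <= 1/8)%R by rewrite ge_min lexx.
  have e2 : (e <= d / (4 * v))%R by rewrite ge_min lexx orbT.
  have := up e e0 e1; rewrite -Ir lee_fin => /le_trans; apply.
  by move: e2; rewrite ler_pdivlMr ?mulr_gt0//; nra.
- apply/ler_addgt0Pr => d d0.
  pose e := Num.min (1/8)%R (d / (4 * v))%R.
  have e0 : (0 < e)%R by rewrite lt_min divr_gt0//= ?divr_gt0// mulr_gt0.
  have e1 : (e <= 1/8)%R by rewrite ge_min lexx.
  have e2 : (e <= d / (4 * v))%R by rewrite ge_min lexx orbT.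
  have := lo e e0 e1; rewrite -Ir lee_fin -lerBlDr; apply: le_trans.
  by move: e2; rewrite ler_pdivlMr ?mulr_gt0//; nra.
Qed.

(** [p_a(x) p_b(w - x) = p_(a+b)(w) p_c(x - m w)] with [c = ab/(a+b)] and
    [m = a/(a+b)]; integrating over [x] leaves the density of variance [a+b]. *)
Lemma gaussian_law_conv (a b : R) (f : R -> \bar R) :
  (0 <= a)%R -> (0 <= b)%R -> measurable_fun setT f -> (forall x, 0 <= f x) ->
  \int[gaussian_law a]_x \int[gaussian_law b]_y f (x + y)%R =
  \int[gaussian_law (a + b)]_x f x.
Proof.
move=> a0 b0 mf f0.
have mfD x : measurable_fun setT (fun y : R => f (x + y)%R).
  by apply: measurableT_comp => //; exact: measurable_funD.
have mF c : measurable_fun setT (fun x : R => \int[gaussian_law c]_y f (x + y)%R).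
  apply: (@measurable_fun_fubini_tonelli_F _ _ _ _ _ (gaussian_law c) (fun z : R * R => f (z.1 + z.2)%R)) => //.
  apply: measurableT_comp => //.
  by apply: measurable_funD; [exact: measurable_fst|exact: measurable_snd].
have [->|an0] := eqVneq a 0%R.
  rewrite integral_gaussian_law0// add0r.
  by under eq_integral do rewrite add0r.
have [->|bn0] := eqVneq b 0%R.
  rewrite addr0; apply: eq_integral => x _.
  by rewrite integral_gaussian_law0// addr0.
have {a0 an0}a0 : (0 < a)%R by rewrite lt_neqAle eq_sym an0.
have {b0 bn0}b0 : (0 < b)%R by rewrite lt_neqAle eq_sym bn0.
have ab0 : (0 < a + b)%R by rewrite addr_gt0.
have mp m s : measurable_fun setT (fun x : R => (normal_pdf m s x)%:E).
  by apply/measurable_EFinP; exact: measurable_normal_pdf.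
have p0 m s x : 0 <= (normal_pdf m s x : R)%:E by rewrite lee_fin normal_pdf_ge0.
rewrite ge0_integral_gaussian_law//; last by move=> x; exact: integral_ge0.
rewrite [RHS](ge0_integral_gaussian_law ab0 mf f0).
transitivity (\int[mu]_x \int[mu]_w
   (f w * ((normal_pdf 0 (Num.sqrt (a + b)) w)%:E *
   (normal_pdf (a / (a + b) * w) (Num.sqrt (a * b / (a + b))) x)%:E))).
  apply: eq_integral => x _.
  rewrite ge0_integral_gaussian_law// -ge0_integralZr//; last 2 first.
  - exact: emeasurable_funM (mfD _) (mp _ _).
  - by move=> y _; rewrite mule_ge0.
  rewrite -[LHS](ge0_integral_shift x)//; last 2 first.
  - apply: emeasurable_funM; last exact: measurable_cst.
    exact: emeasurable_funM (mfD _) (mp _ _).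
  - by move=> y; rewrite !mule_ge0.
  apply: eq_integral => w _.
  rewrite addrC subrK -muleA; congr (_ * _).
  rewrite -!EFinM; congr EFin.
  rewrite !normal_pdf_var// ?divr_gt0 ?mulr_gt0//.
  rewrite mulrACA [RHS]mulrACA -!expRD; congr (_ * expR _)%R.
    rewrite -!invfM; congr (_^-1)%R.
    rewrite -!sqrtrM ?mulrn_wge0 ?mulr_ge0 ?pi_ge0 ?ltW//; congr Num.sqrt.
    by field; rewrite gt_eqF.
  by field; rewrite !gt_eqF.
have mg : measurable_fun setT (fun z : R * R => f z.2 *
    ((normal_pdf 0 (Num.sqrt (a + b)) z.2)%:E *
    (normal_pdf (a / (a + b) * z.2) (Num.sqrt (a * b / (a + b))) z.1)%:E)).
  apply: emeasurable_funM.
    by apply: measurableT_comp => //; exact: measurable_snd.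
  apply: emeasurable_funM.
    by apply: (measurableT_comp (mp _ _)); exact: measurable_snd.
  apply/measurable_EFinP.
  under eq_fun do rewrite normal_pdf_var ?divr_gt0 ?mulr_gt0//.
  apply: measurable_funM => //; apply: measurableT_comp => //.
  apply: measurable_funM => //; apply: measurableT_comp => //.
  apply: measurable_funX; apply: measurable_funB; first exact: measurable_fst.
  by apply: measurable_funM => //; exact: measurable_snd.
have g0 z : 0 <= (fun z : R * R => f z.2 *
    ((normal_pdf 0 (Num.sqrt (a + b)) z.2)%:E *
    (normal_pdf (a / (a + b) * z.2) (Num.sqrt (a * b / (a + b))) z.1)%:E)) z.
  by rewrite /= !mule_ge0.
have := @fubini_tonelli _ _ _ _ R mu mu _ mg g0 => /= ->.
apply: eq_integral => w _.
under eq_integral do rewrite muleA.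
rewrite ge0_integralZl//; last by rewrite mule_ge0.
  by rewrite integral_normal_pdf mule1.
exact: mp.
Qed.

End gaussian_law.

(** * Centered Gaussian random variables and sums of independent ones *)

Section is_gaussian.
Context d (Omega : measurableType d) (R : realType) (P : probability Omega R).
Implicit Types (X : Omega -> R) (v c : R).
Local Open Scope ereal_scope.

Definition is_gaussian X v := [/\ measurable_fun setT X, (0 <= v)%R &
  forall A : set R, measurable A -> P (X @^-1` A) = gaussian_law v A].

Lemma ge0_integral_is_gaussian X v (f : R -> \bar R) :
  is_gaussian X v -> measurable_fun setT f -> (forall x, 0 <= f x) ->
  \int[P]_w f (X w) = \int[gaussian_law v]_x f x.
Proof.
move=> [mX v0 XE] mf f0.
transitivity (\int[pushforward P (X : Omega -> measurableTypeR R)]_x f x).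
  by rewrite ge0_integral_pushforward.
by apply: eq_measure_integral => A mA _; exact: XE.
Qed.

Lemma normal_prob_abs_sd (s : R) (A : set R) :
  normal_prob 0 s A = normal_prob 0 (Num.sqrt (s ^+ 2)) A.
Proof.
rewrite /normal_prob sqrtr_sqr; apply: eq_integral => x _; congr EFin.
rewrite /normal_pdf normr_eq0; case: ifP => // _.
by rewrite /normal_peak /normal_fun real_normK ?num_real.
Qed.

Lemma centered_gaussian_is_gaussian X : measurable_fun setT X ->
  centered_gaussian_rv P X -> exists v, is_gaussian X v.
Proof.
move=> mX [s Xs]; exists (s ^+ 2)%R; split => //; first exact: sqr_ge0.
move=> A mA; rewrite (Xs _ mA) /gaussian_law sqrf_eq0; case: ifP => [//|_].
by rewrite normal_prob_abs_sd.
Qed.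

Lemma is_gaussian_expR X v c : is_gaussian X v ->
  \int[P]_w (expR (c * X w))%:E = (expR (c ^+ 2 * v / 2))%:E.
Proof.
move=> gX; have [_ v0 _] := gX; rewrite -gaussian_law_expR//.
rewrite -(ge0_integral_is_gaussian (f := fun x => (expR (c * x))%:E) gX)//.
exact: measurable_expRM.
Qed.

Lemma is_gaussian_expR_sqr X v e : is_gaussian X v -> (2 * e * v < 1)%R ->
  \int[P]_w (expR (e * X w ^+ 2))%:E = ((Num.sqrt (1 - 2 * e * v))^-1)%:E.
Proof.
move=> gX ev; have [_ v0 _] := gX; rewrite -gaussian_law_expR_sqr//.
rewrite -(ge0_integral_is_gaussian (f := fun x => (expR (e * x ^+ 2))%:E) gX)//.
by apply: measurable_expRM; exact: measurable_funX.
Qed.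

Lemma is_gaussian_sqr X v : is_gaussian X v -> \int[P]_w (X w ^+ 2)%:E = v%:E.
Proof.
move=> gX; have [_ v0 _] := gX; rewrite -[RHS]gaussian_law_sqr//.
rewrite -(ge0_integral_is_gaussian (f := fun x => (x ^+ 2)%:E) gX)//.
- by apply/measurable_EFinP; exact: measurable_funX.
- by move=> x; rewrite lee_fin sqr_ge0.
Qed.

(** The second moment recovers the variance. *)
Lemma is_gaussian_uniq X v v' : is_gaussian X v -> is_gaussian X v' -> v = v'.
Proof.
by move=> /is_gaussian_sqr gv /is_gaussian_sqr; rewrite gv => -[].
Qed.

(** A Gaussian variable that lies in [-K, K] with probability at least 1/2 cannot
    be spread out: [1/2 <= E exp(1 - (X/K)^2) = e / sqrt(1 + 2v/K^2)]. *)
Lemma is_gaussian_small_ball X v K : is_gaussian X v -> (0 < K)%R ->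
  (2^-1)%:E <= P [set w | `|X w| <= K]%R -> (v <= 2 * expR 1 ^+ 2 * K ^+ 2)%R.
Proof.
move=> gX K0 PK; have [mX v0 _] := gX.
have K2 : (0 < K ^+ 2)%R by rewrite exprn_gt0.
have D0 : (0 < 1 + 2 * v / K ^+ 2)%R.
  by rewrite ltr_pwDl// divr_ge0 ?(ltW K2)// mulr_ge0.
have mS : measurable [set w | `|X w| <= K]%R.
  by apply: measurable_sublevel; apply: measurableT_comp.
have mE : measurable_fun setT (fun w => (expR (- (K ^+ 2)^-1 * X w ^+ 2))%:E).
  by apply: measurable_expRM; exact: measurable_funX.
have : P [set w | `|X w| <= K]%R <=
       (expR 1)%:E * \int[P]_w (expR (- (K ^+ 2)^-1 * X w ^+ 2))%:E.
  rewrite -ge0_integralZl//.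
  rewrite -(setIT [set w | _]) -integral_indic//.
  apply: ge0_le_integral => //.
  - by apply/measurable_EFinP; exact: measurable_indic.
  - exact: measurable_funeM.
  - move=> w _; rewrite -EFinM -expRD lee_fin indicE.
    case: (boolP (w \in _)) => [|_]; last by rewrite expR_ge0.
    rewrite inE/= => Xw.
    rewrite -[leLHS]expR0 ler_expR mulNr subr_ge0 mulrC ler_pdivrMr// mul1r.
    by rewrite -[leLHS]real_normK ?num_real// lerXn2r// nnegrE// ltW.
rewrite (is_gaussian_expR_sqr gX); last first.
  have : (0 <= (K ^+ 2)^-1 * v)%R by rewrite mulr_ge0 ?invr_ge0 ?(ltW K2).
  by rewrite mulrN mulNr -mulrA; lra.
move=> /(le_trans PK); rewrite -EFinM lee_fin.
rewrite (_ : 1 - 2 * - (K ^+ 2)^-1 * v = 1 + 2 * v / K ^+ 2)%R; last by ring.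
rewrite ler_pdivlMr ?sqrtr_gt0// => h.
have {h} : (Num.sqrt (1 + 2 * v / K ^+ 2) <= 2 * expR 1)%R by lra.
move=> h.
have : (Num.sqrt (1 + 2 * v / K ^+ 2) ^+ 2 <= (2 * expR 1) ^+ 2)%R.
  by rewrite lerXn2r// nnegrE ?sqrtr_ge0// mulr_ge0// expR_ge0.
rewrite sqr_sqrtr ?(ltW D0)// => h2.
have : (2 * v / K ^+ 2 <= 4 * expR 1 ^+ 2)%R by rewrite exprMn in h2; lra.
by rewrite ler_pdivrMr//; lra.
Qed.

End is_gaussian.

Section product_gaussian.
Context d1 d2 (T1 : measurableType d1) (T2 : measurableType d2) (R : realType).
Variables (P1 : probability T1 R) (P2 : probability T2 R).
Local Open Scope ereal_scope.

Lemma is_gaussian_prod (X : T1 -> R) (Y : T2 -> R) a b :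
  is_gaussian P1 X a -> is_gaussian P2 Y b ->
  is_gaussian (P1 \x P2) (fun z => X z.1 + Y z.2)%R (a + b)%R.
Proof.
move=> gX gY; have [mX a0 _] := gX; have [mY b0 _] := gY.
have mXY : measurable_fun setT (fun z : T1 * T2 => X z.1 + Y z.2)%R.
  by apply: measurable_funD; apply: measurableT_comp.
split => //; first exact: addr_ge0.
move=> A mA.
pose f : R -> \bar R := fun x => (\1_A x)%:E.
have mf : measurable_fun setT f by apply/measurable_EFinP; exact: measurable_indic.
have f0 x : 0 <= f x by rewrite lee_fin.
transitivity (\int[gaussian_law (a + b)]_x f x); last first.
  by rewrite integral_indic// setIT.
rewrite -gaussian_law_conv//.
have mfX x : measurable_fun setT (fun y : R => f (x + y)%R).
  by apply: measurableT_comp => //; exact: measurable_funD.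
rewrite -(ge0_integral_is_gaussian (f := fun x => \int[gaussian_law b]_y f (x + y)%R) gX); last 2 first.
- apply: (@measurable_fun_fubini_tonelli_F _ _ _ _ _ (gaussian_law b) (fun z : R * R => f (z.1 + z.2)%R)) => //.
  by apply: measurableT_comp => //; apply: measurable_funD.
- by move=> x; exact: integral_ge0.
have mS : measurable ((fun z : T1 * T2 => X z.1 + Y z.2)%R @^-1` A).
  by rewrite -[X in measurable X]setTI; exact: mXY.
transitivity (\int[P1 \x P2]_z f (X z.1 + Y z.2)%R).
  by have := integral_indic (P1 \x P2) measurableT mS; rewrite setIT => <-.
rewrite fubini_tonelli1//; last first.
  exact: (measurableT_comp mf mXY).
apply: eq_integral => x _.
by rewrite /fubini_F/= -(ge0_integral_is_gaussian (f := fun y => f (X x + y)%R) gY).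
Qed.

End product_gaussian.

(** * Sums of independent variables *)

Lemma measure_prod_ext d1 d2 (T1 : measurableType d1) (T2 : measurableType d2)
    (R : realType) (m1 m2 : {measure set (T1 * T2) -> \bar R}) :
  (m1 setT < +oo)%E ->
  (forall A B, measurable A -> measurable B -> m1 (A `*` B) = m2 (A `*` B)) ->
  forall C, measurable C -> m1 C = m2 C.
Proof.
move=> m1oo m12 C mC.
pose G : set (set (T1 * T2)) :=
  [set C | exists A, measurable A /\ exists B, measurable B /\ C = A `*` B].
apply: (measure_unique G (fun=> setT)) => //.
- rewrite measurable_prod_measurableType //; congr (<<s _ >>).
  rewrite predeqE; split => [[A mA [B mB <-]]|[A [mA [B [mB ->]]]]].
    by exists A; split => //; exists B.
  by exists A => //; exists B.
- move=> /= _ _ [X1 [mX1 [X2 [mX2 ->]]]] [Y1 [mY1 [Y2 [mY2 ->]]]].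
  rewrite -setXI; exists (X1 `&` Y1); split; first exact: measurableI.
  by exists (X2 `&` Y2); split => //; exact: measurableI.
- by move=> _; exists setT; split => //; exists setT; split => //; rewrite setXTT.
- by rewrite bigcup_const//; exists 0%N.
- by move=> _ [A [mA [B [mB ->]]]]; exact: m12.
Qed.

Section independent_sum.
Context d (Omega : measurableType d) (R : realType) (P : probability Omega R).
Variables (n : nat) (W : nat -> Omega -> R).
Hypothesis mW : forall k, measurable_fun setT (W k).
Hypothesis indepW : forall A : nat -> set R, (forall k, measurable (A k)) ->
  P [set w | forall k, (k < n)%N -> A k (W k w)] =
  (\prod_(0 <= k < n) P (W k @^-1` A k))%E.

Let S j w := \sum_(0 <= k < j) W k w.

Let mS j : measurable_fun setT (S j).
Proof. by apply: measurable_sum => k. Qed.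

Let tail (A : nat -> set R) j :=
  [set w | forall k, (j <= k)%N -> (k < n)%N -> A k (W k w)].

Let mtail A j : (forall k, measurable (A k)) -> measurable (tail A j).
Proof.
move=> mA.
have -> : tail A j = \bigcap_k (if (j <= k < n)%N then W k @^-1` A k else setT).
  apply/seteqP; split => [w tw k _ /=|w tw k jk kn].
    by case: ifP => // /andP[]; exact: tw.
  by have := tw k Logic.I; rewrite /= jk kn.
apply: bigcapT_measurable => k; case: ifP => // _.
by rewrite -[X in measurable X]setTI; exact: mW.
Qed.

Let head_indep j := forall A B, (forall k, measurable (A k)) -> measurable B ->
  P ((S j @^-1` B) `&` tail A j) =
  (P (S j @^-1` B) * \prod_(j <= k < n) P (W k @^-1` A k))%E.

(** Both sides are finite measures in [C], namely the law of [(S j, W j)] under [P]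
    restricted to an event on the later variables, and a multiple of a product
    law. They agree on rectangles, where the event on [W j] joins the event on
    the later variables. *)
Let pair_law j : (j < n)%N -> head_indep j ->
  forall A (C : set (R * R)), (forall k, measurable (A k)) -> measurable C ->
  P ((fun w => (S j w, W j w)) @^-1` C `&` tail A j.+1) =
  ((\prod_(j.+1 <= k < n) P (W k @^-1` A k)) *
   (P \x P) ((fun z => (S j z.1, W j z.2)) @^-1` C))%E.
Proof.
move=> jn IH A C mA mC.
have mT := mtail j.+1 mA.
have mSW : measurable_fun setT (fun w => (S j w, W j w)).
  exact: measurable_fun_pair (mS j) (mW j).
have mSW2 : measurable_fun setT (fun z : Omega * Omega => (S j z.1, W j z.2)).
  apply: measurable_fun_pair; first exact: measurableT_comp (mS j) measurable_fst.
  exact: measurableT_comp (mW j) measurable_snd.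
have p0 : 0 <= fine (\prod_(j.+1 <= k < n) P (W k @^-1` A k))%E.
  by apply: fine_ge0; apply: prode_ge0 => k _; exact: measure_ge0.
have pfin : (\prod_(j.+1 <= k < n) P (W k @^-1` A k))%E \is a fin_num.
  apply: prode_fin_num => k _.
  by rewrite fin_num_measure// -[X in measurable X]setTI; exact: mW.
rewrite -(fineK pfin).
pose p : {nonneg R} := NngNum p0.
pose m1 := pushforward (mrestr P mT) (fun w => (S j w, W j w)).
pose m2 := mscale p (pushforward (P \x P)%E (fun z => (S j z.1, W j z.2))).
change (m1 C = m2 mSW2 C).
apply: measure_prod_ext => //.
  by rewrite /= /pushforward preimage_setT /mrestr setTI ltey_eq fin_num_measure.
move=> A1 B1 mA1 mB1.
rewrite /m1 /m2 /= /mscale /= /pushforward /mrestr /=.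
pose A' k := if k == j then B1 else A k.
have mA' k : measurable (A' k) by rewrite /A'; case: ifP.
have := IH A' A1 mA' mA1.
have -> : S j @^-1` A1 `&` tail A' j =
   (fun w => (S j w, W j w)) @^-1` (A1 `*` B1) `&` tail A j.+1.
  apply/seteqP; split => w /=.
    move=> [wA1 tw]; split.
      by split => //; have := tw j (leqnn _) jn; rewrite /A' eqxx.
    move=> k jk kn; have := tw k (ltnW jk) kn.
    by rewrite /A' gtn_eqF.
  move=> [[wA1 wB1] tw]; split => // k jk kn.
  rewrite /A'; case: ifPn => [/eqP ->//|kj]; apply: tw => //.
  by rewrite ltn_neqAle eq_sym kj.
move=> ->.
have A'j : A' j = B1 by rewrite /A' eqxx.
rewrite [in LHS]big_ltn// A'j (fineK pfin).
rewrite (_ : _ @^-1` _ = (S j @^-1` A1) `*` (W j @^-1` B1)); last first.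
  by apply/seteqP; split => z.
rewrite product_measure1E; last 2 first.
- by rewrite -[X in measurable X]setTI; exact: mS.
- by rewrite -[X in measurable X]setTI; exact: mW.
rewrite muleA muleC; congr (_ * _)%E.
by apply: eq_big_nat => k /andP[jk _]; rewrite /A' gtn_eqF.
Qed.

Let head_indepP j : (j <= n)%N -> head_indep j.
Proof.
elim: j => [_ A B mA mB|j IH jn A B mA mB].
  have S0 w : S 0 w = 0 by rewrite /S big_geq.
  have [B0|B0] := pselect (B 0).
    rewrite (_ : S 0 @^-1` B = setT); last first.
      by apply/seteqP; split => // w _ /=; rewrite S0.
    rewrite setTI probability_setT mul1e -indepW//; congr (P _).
    by apply/seteqP; split => w tw k; [exact: tw|move=> _; exact: tw].
  rewrite (_ : S 0 @^-1` B = set0); last first.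
    by apply/seteqP; split => // w /=; rewrite S0.
  by rewrite set0I measure0 mul0e.
have {}IH := IH (ltnW jn).
have mD : measurable ((fun x : R * R => x.1 + x.2) @^-1` B).
  by rewrite -[X in measurable X]setTI; apply: measurable_funD.
have SS : S j.+1 @^-1` B = (fun w => (S j w, W j w)) @^-1` ((fun x => x.1 + x.2) @^-1` B).
  by apply/seteqP; split => w; rewrite /= /S big_nat_recr.
have := pair_law jn IH mA mD; rewrite -SS => ->.
have := pair_law jn IH (fun=> measurableT) mD; rewrite -SS.
rewrite (_ : tail _ _ = setT); last by apply/seteqP; split => // w _ k.
rewrite setIT => ->.
rewrite [X in (X * _ * _)%E]big1 ?mul1e 1?muleC// => k _.
by rewrite preimage_setT probability_setT.
Qed.

(** Independence in the form of an identity of image measures, to which Fubini's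
    theorem applies. *)
Lemma independent_sum_recr j (C : set (R * R)) : (j < n)%N -> measurable C ->
  P [set w | C (\sum_(0 <= k < j) W k w, W j w)] =
  (P \x P)%E [set z | C (\sum_(0 <= k < j) W k z.1, W j z.2)].
Proof.
move=> jn mC.
have := pair_law jn (head_indepP (ltnW jn)) (fun=> measurableT) mC.
rewrite (_ : tail _ _ = setT); last by apply/seteqP; split => // w _ k.
rewrite setIT => ->.
rewrite [X in (X * _)%E]big1 ?mul1e// => k _.
by rewrite preimage_setT probability_setT.
Qed.

Lemma is_gaussian_sum (v : nat -> R) :
  (forall k, (k < n)%N -> is_gaussian P (W k) (v k)) ->
  is_gaussian P (fun w => \sum_(0 <= k < n) W k w) (\sum_(0 <= k < n) v k).
Proof.
move=> gW.
suff H j : (j <= n)%N ->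
    is_gaussian P (fun w => \sum_(0 <= k < j) W k w) (\sum_(0 <= k < j) v k).
  exact: H.
elim: j => [_|j IH jn].
  split; first exact: mS.
    by rewrite big_geq.
  move=> A mA; rewrite big_geq// /gaussian_law eqxx /= diracE.
  have [A0|A0] := pselect (A 0).
    rewrite mem_set// (_ : _ @^-1` A = setT) ?probability_setT//.
    by apply/seteqP; split => // w _ /=; rewrite big_geq.
  rewrite memNset// (_ : _ @^-1` A = set0) ?measure0//.
  by apply/seteqP; split => // w /=; rewrite big_geq.
have [_ v0 E] := is_gaussian_prod (IH (ltnW jn)) (gW _ jn).
split; [exact: mS|by rewrite big_nat_recr|].
move=> A mA; rewrite big_nat_recr//= -E//.
have mD : measurable ((fun x : R * R => x.1 + x.2) @^-1` A).
  by rewrite -[X in measurable X]setTI; apply: measurable_funD.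
rewrite [RHS](_ : _ = P [set w | A (\sum_(0 <= k < j) W k w + W j w)]); last first.
  exact/esym/(independent_sum_recr jn mD).
congr (P _); by apply/seteqP; split => w; rewrite /= big_nat_recr.
Qed.

(** Fubini's theorem on [Omega * Omega] splits off one variable at a time. *)
Lemma independent_expR_sum :
  (\int[P]_w (expR (\sum_(0 <= k < n) W k w))%:E =
   \prod_(0 <= k < n) \int[P]_w (expR (W k w))%:E)%E.
Proof.
suff H j : (j <= n)%N -> (\int[P]_w (expR (\sum_(0 <= k < j) W k w))%:E =
   \prod_(0 <= k < j) \int[P]_w (expR (W k w))%:E)%E.
  exact: H.
elim: j => [_|j IH jn].
  rewrite big_geq//; under eq_integral do rewrite big_geq// expR0.
  by rewrite integral_cst// mul1e; exact: probability_setT.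
rewrite big_nat_recr//= -IH ?(ltnW jn)//.
pose f (x : R * R) : \bar R := (expR (x.1 + x.2))%:E.
have mf : measurable_fun setT f.
  by apply/measurable_EFinP; apply: measurableT_comp => //; apply: measurable_funD.
have f0 x : (0 <= f x)%E by rewrite lee_fin expR_ge0.
have mSW : measurable_fun setT (fun w => (S j w, W j w)).
  exact: measurable_fun_pair (mS j) (mW j).
have mSW2 : measurable_fun setT (fun z : Omega * Omega => (S j z.1, W j z.2)).
  apply: measurable_fun_pair; first exact: measurableT_comp (mS j) measurable_fst.
  exact: measurableT_comp (mW j) measurable_snd.
transitivity (\int[pushforward P (fun w => (S j w, W j w))]_x f x)%E.
  rewrite ge0_integral_pushforward//; apply: eq_integral => w _.
  by rewrite big_nat_recr.
transitivity (\int[pushforward (P \x P)%E (fun z => (S j z.1, W j z.2))]_x f x)%E.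
  by apply: eq_measure_integral => C mC _; exact: independent_sum_recr.
rewrite ge0_integral_pushforward// preimage_setT fubini_tonelli1; last 2 first.
- exact: (measurableT_comp mf mSW2).
- by move=> z; exact: f0.
have mE Z : measurable_fun setT Z -> measurable_fun setT (fun w : Omega => (expR (Z w))%:E).
  by move=> mZ; apply/measurable_EFinP; apply: measurableT_comp.
rewrite -ge0_integralZr//; last 2 first.
- exact: mE (mS j).
- by apply: integral_ge0 => w _; rewrite lee_fin expR_ge0.
apply: eq_integral => w _.
rewrite /fubini_F/= -ge0_integralZl//; last exact: mE.
by apply: eq_integral => w' _; rewrite -EFinM -expRD.
Qed.

End independent_sum.

(** * A Cramer-Wold theorem *)

Section orthants.
Context (R : realType) (I : finType).

(** Upper orthants are chosen as generators of the product sigma-algebra on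
    [I -> R] because they form a pi-system that exhausts the space. *)
Definition orthant (a : I -> R) : set (I -> R) := [set x | forall i, a i <= x i].
Definition orthants : set (set (I -> R)) := range orthant.

End orthants.

Notation vec R I := (g_sigma_algebraType (@orthants R I)).

Section vec_measurable.
Context (R : realType) (I : finType) d (T : measurableType d).

Lemma measurable_orthant (a : I -> R) : measurable (orthant a : set (vec R I)).
Proof. by apply: sub_sigma_algebra; exists a. Qed.

Lemma measurable_vec (f : T -> I -> R) :
  (forall i, measurable_fun setT (f ^~ i)) -> measurable_fun setT (f : T -> vec R I).
Proof.
move=> mf; apply: (@measurability _ _ T (vec R I) setT f (@orthants R I)) => //.
move=> _ [_ [a _ <-] <-]; rewrite setTI.
have -> : f @^-1` orthant a = \big[setI/setT]_(i : I) [set t | a i <= f t i].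
  apply/seteqP; split => t /=.
    by move=> h; apply: (big_ind (fun A : set T => A t)) => // i _; exact: h.
  move=> h i; move: h; rewrite (bigD1 i)//= => -[h _]; exact: h.
apply: bigsetI_measurable => i _.
rewrite (_ : [set t | _] = (f ^~ i) @^-1` `[a i, +oo[); last first.
  by apply/seteqP; split => t /=; rewrite in_itv/= andbT.
by rewrite -[X in measurable X]setTI; exact: mf.
Qed.

Lemma measurable_vec_coord (i : I) : measurable_fun setT (fun x : vec R I => x i).
Proof.
apply: (@measurability _ _ (vec R I) R setT _ (@RGenCInfty.G R)).
  exact: RGenCInfty.measurableE.
move=> _ [_ [a ->] <-]; rewrite setTI.
have -> : (fun x : vec R I => x i) @^-1` `[a, +oo[ =
    \bigcup_(n : nat) (orthant (fun j => if j == i then a else - n%:R) : set (vec R I)).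
  apply/seteqP; split => x /=; rewrite in_itv/= andbT.
    move=> ax; pose M := \sum_j `|x j|.
    exists (Num.truncn M).+1 => // j.
    case: ifPn => [/eqP ->//|_].
    rewrite lerNl; apply: le_trans (ltW (truncnS_gt M)).
    apply: (@le_trans _ _ `|x j|); first by rewrite -normrN ler_norm.
    by rewrite /M (bigD1 j)//= lerDl sumr_ge0.
  by move=> [n _ /(_ i)]; rewrite eqxx.
by apply: bigcupT_measurable => n; exact: measurable_orthant.
Qed.

Lemma measurable_vec_sum (c : I -> R) :
  measurable_fun setT (fun x : vec R I => \sum_i c i * x i).
Proof.
apply: measurable_sum => i.
by apply: measurable_funM => //; exact: measurable_vec_coord.
Qed.

End vec_measurable.

Section sharp_step.
Context (R : realType).

Lemma onem_expr_le (y : R) m : 0 <= y <= 1 -> (1 - y) ^+ m * (1 + m%:R * y) <= 1.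
Proof.
move=> /andP[y0 y1]; elim: m => [|m IH]; first by rewrite expr0 mul0r addr0 mulr1.
apply: le_trans IH; rewrite exprSr -mulrA ler_wpM2l ?exprn_ge0 ?subr_ge0//.
rewrite -natr1; have m0 : 0 <= m%:R :> R by [].
by nra.
Qed.

Lemma onem_expr_ge (y : R) m : 0 <= y <= 1 -> 1 - m%:R * y <= (1 - y) ^+ m.
Proof.
move=> /andP[y0 y1]; elim: m => [|m IH]; first by rewrite mul0r subr0.
apply: (@le_trans _ _ ((1 - m%:R * y) * (1 - y))).
  by rewrite -natr1; have m0 : 0 <= m%:R :> R by []; nra.
by rewrite exprSr ler_wpM2r ?subr_ge0.
Qed.

Lemma cvg_inv_natS : (fun m : nat => (1 + m%:R)^-1 : R) @ \oo --> 0.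
Proof.
have := @cvg_harmonic R; apply: cvg_trans; apply: near_eq_cvg.
by near=> m; rewrite /harmonic /= -natr1 addrC.
Unshelve. all: by end_near.
Qed.

(** With [y = q ^+ m], the power [(1 - y) ^+ (m * 2 ^ m)] is close to 0 or to 1
    according to whether [m * 2 ^ m * y = m * (2 q) ^+ m] is large or small; the
    factor [m] makes it large for [q = 1/2] as well. Hence these polynomials
    tend on [0, 1] to the indicator of [1/2 <= q]. *)
Definition sharp (m : nat) (q : R) : R := 1 - (1 - q ^+ m) ^+ (m * 2 ^ m).

Lemma sharp_bound m q : 0 <= q <= 1 -> 0 <= sharp m q <= 1.
Proof.
move=> /andP[q0 q1]; rewrite /sharp.
have h0 : 0 <= 1 - q ^+ m by rewrite subr_ge0 exprn_ile1.
have h1 : 1 - q ^+ m <= 1 by rewrite gerBl exprn_ge0.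
by rewrite subr_ge0 exprn_ile1//= gerBl exprn_ge0.
Qed.

Lemma cvg_sharp q : 0 <= q <= 1 ->
  sharp m q @[m --> \oo] --> (if 2^-1 <= q then 1 else 0 : R).
Proof.
move=> q01; have /andP[q0 q1] := q01.
case: ifPn => [q2|]; last rewrite -ltNge => q2.
- rewrite -[X in _ --> X]subr0; apply: cvgB; first exact: cvg_cst.
  apply: (@squeeze_cvgr _ _ _ _ (fun=> 0) (fun m => (1 + m%:R)^-1)); last 2 first.
  + exact: cvg_cst.
  + exact: cvg_inv_natS.
  near=> m; apply/andP; split.
    by rewrite exprn_ge0// subr_ge0 exprn_ile1.
  have y01 : 0 <= q ^+ m <= 1 by rewrite exprn_ge0//= exprn_ile1.
  have := onem_expr_le (m * 2 ^ m) y01; set u := (1 - _) ^+ _ => hu.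
  have m0 : 0 < 1 + m%:R :> R by rewrite ltr_pwDl.
  rewrite -[leRHS]mul1r ler_pdivlMr//; apply: le_trans hu.
  rewrite ler_wpM2l ?exprn_ge0 ?subr_ge0 ?exprn_ile1// lerD2l.
  rewrite natrM -mulrA ler_peMr// natrX -exprMn.
  rewrite exprn_ege1//.
  by move: q2; rewrite -(ler_pM2l (ltr0n R 2)) divff// => /le_trans; apply.
- pose s := Num.sqrt (2 * q).
  have s0 : 0 <= s by rewrite sqrtr_ge0.
  have s2 : s ^+ 2 = 2 * q by rewrite sqr_sqrtr// mulr_ge0.
  have s1 : s < 1.
    rewrite -(@ltr_pXn2r _ 2)// ?nnegrE// expr1n s2.
    by move: q2; rewrite -(ltr_pM2l (ltr0n R 2)) divff.
  apply: (@squeeze_cvgr _ _ _ _ (fun=> 0) (fun m => (1 - s)^-1 * s ^+ m)); last 2 first.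
  + exact: cvg_cst.
  + rewrite -(mulr0 (1 - s)^-1); apply: cvgM; first exact: cvg_cst.
    by apply: cvg_expr; rewrite ger0_norm.
  near=> m.
  have y01 : 0 <= q ^+ m <= 1 by rewrite exprn_ge0//= exprn_ile1.
  apply/andP; split; first by have /andP[] := sharp_bound m q01.
  rewrite /sharp lerBlDl -lerBlDr.
  apply: le_trans (onem_expr_ge _ y01); rewrite lerD2l lerN2.
  rewrite natrM -mulrA natrX -exprMn -s2 exprS expr1 exprMn mulrA.
  rewrite ler_wpM2r ?exprn_ge0// -[leRHS]mul1r ler_pdivlMr ?subr_gt0//.
  have := @onem_expr_le (1 - s) m; rewrite subKr => /(_ _) h.
  have {}h : s ^+ m * (1 + m%:R * (1 - s)) <= 1.
    by apply: h; rewrite subr_ge0 (ltW s1)/= gerBl.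
  apply: le_trans h; rewrite -subr_ge0 (_ : _ - _ = s ^+ m) ?exprn_ge0//; ring.
Unshelve. all: by end_near.
Qed.

End sharp_step.

Section trigonometric_determination.
Context (R : realType) (I : finType).
Local Notation T := (vec R I).
Variables mu nu : probability T R.

Let wave (xi : I -> R) (c : R) : T -> R := fun x => cos (\sum_i xi i * x i + c).

Hypothesis mu_nu : forall xi c,
  (\int[mu]_x (wave xi c x)%:E = \int[nu]_x (wave xi c x)%:E)%E.

Let bm (f : T -> R) := measurable_fun setT f /\ exists M, forall x, `|f x| <= M.

Let bm_wave xi c : bm (wave xi c).
Proof.
split; last by exists 1 => x; exact: cos_max.
apply: (@measurableT_comp _ _ _ _ _ _ (@cos R)).
  by apply: continuous_measurable_fun; exact: continuous_cos.
by apply: measurable_funD => //; exact: measurable_vec_sum.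
Qed.

Let bm_cst a : bm (cst a).
Proof. by split; [exact: measurable_cst|exists `|a|]. Qed.

Let bmD f g : bm f -> bm g -> bm (fun x => f x + g x).
Proof.
move=> [mf [M fM]] [mg [N gN]]; split; first exact: measurable_funD.
by exists (M + N) => x; rewrite (le_trans (ler_normD _ _))// lerD.
Qed.

Let bmM f g : bm f -> bm g -> bm (fun x => f x * g x).
Proof.
move=> [mf [M fM]] [mg [N gN]]; split; first exact: measurable_funM.
by exists (M * N) => x; rewrite normrM ler_pM.
Qed.

Let bm_int (m : probability T R) f : bm f -> m.-integrable setT (EFin \o f).
Proof.
move=> [mf [M fM]]; apply: measurable_bounded_integrable => //.
  exact: fin_num_fun_lty.
by exists M; split; [exact: num_real|move=> N MN x _; exact: le_trans (fM x) (ltW MN)].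
Qed.

Let same (f : T -> R) := (\int[mu]_x (f x)%:E = \int[nu]_x (f x)%:E)%E.

Let sameD f g : bm f -> bm g -> same f -> same g -> same (fun x => f x + g x).
Proof.
move=> bf bg sf sg; rewrite /same.
under eq_integral do rewrite EFinD.
under [RHS]eq_integral do rewrite EFinD.
by rewrite !integralD_EFin//; try exact: bm_int; rewrite sf sg.
Qed.

Let sameZ a f : bm f -> same f -> same (fun x => a * f x).
Proof.
move=> bf sf; rewrite /same.
under eq_integral do rewrite EFinM.
under [RHS]eq_integral do rewrite EFinM.
by rewrite !integralZl//; try exact: bm_int; rewrite sf.
Qed.

Let same_cvg (f : nat -> T -> R) (g : T -> R) M :
  (forall n, bm (f n)) -> (forall n x, `|f n x| <= M) ->
  (forall x, f n x @[n --> \oo] --> g x) ->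
  (forall n, same (f n)) -> bm g /\ same g.
Proof.
move=> bf fM fg sf.
have mg : measurable_fun setT g.
  apply: (@measurable_fun_cvg _ _ _ setT f) => [n|x _]; first by case: (bf n).
  exact: fg.
have H (m : probability T R) :
    (\int[m]_x (f n x)%:E @[n --> \oo] --> \int[m]_x (g x)%:E)%E.
  have [|||||_ _ h] := @dominated_convergence _ T R m setT measurableT
      (fun n x => (f n x)%:E) (fun x => (g x)%:E) (fun=> M%:E).
  - by move=> n; apply/measurable_EFinP; case: (bf n).
  - exact/measurable_EFinP.
  - by apply: aeW => x _; apply: cvg_EFin; [exact: nearW|exact: fg].
  - exact: (bm_int m (bm_cst M)).
  - by apply: aeW => x n _; rewrite lee_fin.
  - exact: h.
split.
  split => //; exists M => x.
  by apply: (cvgr_to_le (cvg_norm (fg x))); exact: nearW.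
have := H mu; rewrite (_ : (fun n => _) = (fun n => (\int[nu]_x (f n x)%:E)%E)); last first.
  by apply/funext => n; exact: sf.
by move=> h; exact: (cvg_unique _ h (H nu)).
Qed.

(** The functions [f] for which both measures give the same integral to [f] times
    any wave, and the multipliers of this class. The multipliers form an algebra
    closed under bounded pointwise limits; it contains the waves because a product
    of two cosines is a sum of two cosines. *)
Let waved f := bm f /\ forall xi c, same (fun x => f x * wave xi c x).
Let multiplier f := bm f /\ forall g, waved g -> waved (fun x => f x * g x).

Let waved1 : waved (cst 1).
Proof.
split; first exact: bm_cst.
move=> xi c; rewrite /same; under eq_integral do rewrite mul1r.
by under [RHS]eq_integral do rewrite mul1r.
Qed.

Let waved_same f : waved f -> same f.
Proof.
move=> [bf /(_ (fun=> 0) 0)]; rewrite /same /wave.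
have H (m : probability T R) : (\int[m]_x (f x * cos (\sum_i 0 * (x : I -> R) i + 0))%:E =
    \int[m]_x (f x)%:E)%E.
  apply: eq_integral => x _.
  by rewrite big1 ?addr0 ?cos0 ?mulr1// => i _; rewrite mul0r.
by rewrite !H.
Qed.

Let multiplier_wave xi c : multiplier (wave xi c).
Proof.
split; first exact: bm_wave.
move=> g [bg wg]; split; first exact: bmM.
move=> eta e.
have E (x : T) : wave xi c x * g x * wave eta e x =
    2^-1 * (g x * wave (fun i => xi i + eta i) (c + e) x +
            g x * wave (fun i => xi i - eta i) (c - e) x).
  rewrite /wave.
  rewrite (_ : \sum_i (xi i + eta i) * x i + (c + e) =
    (\sum_i xi i * x i + c) + (\sum_i eta i * x i + e)); last first.
    by rewrite addrACA -big_split/=; congr (_ + _); apply: eq_bigr => i _; rewrite mulrDl.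
  rewrite (_ : \sum_i (xi i - eta i) * x i + (c - e) =
    (\sum_i xi i * x i + c) - (\sum_i eta i * x i + e)); last first.
    rewrite opprD addrACA -sumrN -big_split/=; congr (_ + _).
    by apply: eq_bigr => i _; rewrite mulrBl.
  move: (\sum_i xi i * x i + c) (\sum_i eta i * x i + e) => A B.
  by rewrite cosD cosB; field.
have -> : (fun x => wave xi c x * g x * wave eta e x) = (fun x => 2^-1 *
    (g x * wave (fun i => xi i + eta i) (c + e) x +
            g x * wave (fun i => xi i - eta i) (c - e) x)) by exact/funext.
have b1 := bmM bg (bm_wave (fun i => xi i + eta i) (c + e)).
have b2 := bmM bg (bm_wave (fun i => xi i - eta i) (c - e)).
by apply: sameZ; [exact: bmD|exact: sameD].
Qed.

Let multiplierM f g : multiplier f -> multiplier g -> multiplier (fun x => f x * g x).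
Proof.
move=> [bf mf] [bg mg]; split; first exact: bmM.
move=> h /mg/mf; rewrite (_ : (fun x => f x * (g x * h x)) = (fun x => f x * g x * h x))//.
by apply/funext => x; rewrite mulrA.
Qed.

Let multiplierD f g : multiplier f -> multiplier g -> multiplier (fun x => f x + g x).
Proof.
move=> [bf mf] [bg mg]; split; first exact: bmD.
move=> h wh; have [b1 w1] := mf h wh; have [b2 w2] := mg h wh.
have -> : (fun x => (f x + g x) * h x) = (fun x => f x * h x + g x * h x).
  by apply/funext => x; rewrite mulrDl.
split; first exact: bmD.
move=> xi c.
have -> : (fun x => (f x * h x + g x * h x) * wave xi c x) =
    (fun x => f x * h x * wave xi c x + g x * h x * wave xi c x).
  by apply/funext => x; rewrite mulrDl.
by apply: sameD; [exact: bmM (bm_wave _ _)|exact: bmM (bm_wave _ _)| |].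
Qed.

Let multiplier_cst a : multiplier (cst a).
Proof.
split; first exact: bm_cst.
move=> h [bh wh]; split; first exact: bmM (bm_cst _) bh.
move=> xi c.
have -> : (fun x => cst a x * h x * wave xi c x) = (fun x => a * (h x * wave xi c x)).
  by apply/funext => x; rewrite mulrA.
by apply: sameZ; [exact: bmM (bm_wave _ _)|].
Qed.

Let multiplierX f n : multiplier f -> multiplier (fun x => f x ^+ n).
Proof.
move=> mf; elim: n => [|n IH]; first by apply: multiplier_cst.
have -> : (fun x => f x ^+ n.+1) = (fun x => f x * f x ^+ n).
  by apply/funext => x; rewrite exprS.
exact: multiplierM.
Qed.

Let multiplier_cvg (f : nat -> T -> R) (g : T -> R) M :
  (forall n, multiplier (f n)) -> (forall n x, `|f n x| <= M) ->
  (forall x, f n x @[n --> \oo] --> g x) -> multiplier g.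
Proof.
move=> mf fM fg.
have bg : bm g.
  suff [] : bm g /\ same g by [].
  apply: (@same_cvg f g M) => // n; first by case: (mf n).
  apply: waved_same; have [_ /(_ _ waved1)] := mf n.
  by rewrite (_ : (fun x => f n x * _) = f n)//; apply/funext => x; rewrite mulr1.
split => // h [bh wh]; split; first exact: bmM.
move=> xi c.
have [_ [N hN]] := bmM bh (bm_wave xi c).
have [] // := @same_cvg (fun n x => f n x * h x * wave xi c x)
   (fun x => g x * h x * wave xi c x) (M * N).
- move=> n; apply: bmM (bm_wave _ _); apply: bmM => //.
  by case: (mf n).
- by move=> n x; rewrite -mulrA normrM ler_pM.
- move=> x; apply: cvgM; last exact: cvg_cst.
  by apply: cvgM; [exact: fg|exact: cvg_cst].
- by move=> n; have [_ /(_ h (conj bh wh))[]] := mf n.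
Qed.

Let multiplier_sharp f m : multiplier f -> multiplier (fun x => sharp m (f x)).
Proof.
move=> mf.
have onem_mul g : multiplier g -> multiplier (fun x => 1 - g x).
  move=> mg; have -> : (fun x => 1 - g x) = (fun x => cst 1 x + cst (-1) x * g x).
    by apply/funext => x; rewrite mulN1r.
  by apply: multiplierD; [exact: multiplier_cst|exact: multiplierM (multiplier_cst _) mg].
by apply: (onem_mul _); apply: multiplierX; apply: (onem_mul _); exact: multiplierX.
Qed.

(** Half-spaces [0 <= sin((x_i - a)/k)] first, then the period [k] tends to
    infinity. *)
Let multiplier_halfspace i a : multiplier (fun x : T => if a <= x i then 1 else 0).
Proof.
pose q (k : nat) (x : T) := (1 + sin ((x i - a) / k.+1%:R)) / 2.
have q01 k x : 0 <= q k x <= 1.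
  by rewrite /q; have := sin_le1 ((x i - a) / k.+1%:R); have := sin_geN1 ((x i - a) / k.+1%:R); lra.
have mq k : multiplier (q k).
  have -> : q k = (fun x => cst 2^-1 x + cst 2^-1 x *
      wave (fun j => if j == i then k.+1%:R^-1 else 0) (- a / k.+1%:R - pi / 2) x).
    apply/funext => x; rewrite /q /wave /= (bigD1 i)//= eqxx big1 ?addr0; last first.
      by move=> j /negPf ->; rewrite mul0r.
    by rewrite addrA cosBpihalf [k.+1%:R^-1 * _]mulrC -mulrDl; field.
  exact: multiplierD (multiplier_cst _) (multiplierM (multiplier_cst _) (multiplier_wave _ _)).
have m1 k : multiplier (fun x : T => if 2^-1 <= q k x then 1 else 0).
  apply: (@multiplier_cvg (fun m x => sharp m (q k x)) _ 1).
  - by move=> m; exact: multiplier_sharp.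
  - by move=> m x; have /andP[s0 s1] := sharp_bound m (q01 k x); rewrite ger0_norm.
  - by move=> x; exact: cvg_sharp.
apply: (@multiplier_cvg (fun k x => if 2^-1 <= q k x then 1 else 0) _ 1) => //.
- by move=> k x; case: ifP; rewrite ?normr0 ?normr1.
- move=> x; apply: cvg_near_cst.
  near=> k.
  have kx : `|x i - a| < k.+1%:R.
    apply: (@lt_trans _ _ k%:R); last by rewrite ltr_nat.
    by near: k; exact: nbhs_infty_gtr.
  have small : `|(x i - a) / k.+1%:R| < pi.
    rewrite normrM normfV ltr_pdivrMr ?normr_gt0// [ltRHS]mulrC.
    rewrite (ger0_norm (ler0n _ _)) (lt_le_trans kx)// ler_peMr//.
    by have := pi_ge2 R; lra.
  have -> : (2^-1 <= q k x) = (0 <= sin ((x i - a) / k.+1%:R)).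
    by rewrite /q; apply/idP/idP; lra.
  have [ax|xa] := leP a (x i).
    rewrite sin_ge0_pi// divr_ge0 ?subr_ge0//=.
    by rewrite (le_trans (ler_norm _))// ltW.
  rewrite leNgt -[sin _]opprK oppr_lt0 -sinN sin_gt0_pi//.
  rewrite oppr_gt0 -mulNr opprB; apply/andP; split.
    by rewrite pmulr_llt0 ?subr_lt0// invr_gt0.
  by move: small; rewrite -normrN -mulNr opprB; apply: le_lt_trans; rewrite ler_norm.
Unshelve. all: by end_near.
Qed.

(** The indicator of an orthant is a product of indicators of half-spaces, hence a
    multiplier. *)
Lemma wave_determines (A : set T) : measurable A -> mu A = nu A.
Proof.
apply: (@measure_unique _ R T (@orthants R I) (fun n => orthant (fun=> - n%:R))) => //.
- move=> _ _ [a _ <-] [b _ <-]; exists (fun i => Num.max (a i) (b i)) => //.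
  apply/seteqP; split => x /=.
    by move=> h; split => i; move: (h i); rewrite ge_max => /andP[].
  by move=> [h1 h2] i; rewrite ge_max h1 h2.
- by move=> n; exists (fun=> - n%:R).
- apply/seteqP; split => // x _; pose M := \sum_j `|x j|.
  exists (Num.truncn M).+1 => // j.
  rewrite lerNl; apply: le_trans (ltW (truncnS_gt M)).
  apply: (@le_trans _ _ `|x j|); first by rewrite -normrN ler_norm.
  by rewrite /M (bigD1 j)//= lerDl sumr_ge0.
- move=> _ [a _ <-].
  have mo := @measurable_orthant R I a.
  have E : (\1_(orthant a) : T -> R) = (fun x : T => \prod_i (if a i <= x i then 1 else 0)).
    apply/funext => x; rewrite indicE; case: (boolP (x \in _)).
      by rewrite inE => h; rewrite big1// => i _; rewrite h.
    rewrite notin_setE => /existsNP[i /negP h].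
    by rewrite (bigD1 i)//= (negPf h) mul0r.
  have mul : multiplier (\1_(orthant a) : T -> R).
    rewrite E; elim: (index_enum I) => [|i r IH].
      have -> : (fun x : T => \prod_(i <- ([::] : seq I)) (if a i <= (x : I -> R) i then 1 else 0 : R)) = (cst 1 : T -> R).
        by apply/funext => x; rewrite big_nil.
      exact: multiplier_cst.
    have -> : (fun x : T => \prod_(j <- i :: r) (if a j <= x j then 1 else 0 : R)) =
       (fun x : T => (if a i <= x i then 1 else 0 : R) *
           \prod_(j <- r) (if a j <= x j then 1 else 0 : R)) :> (T -> R).
      by apply/funext => x; rewrite big_cons.
    exact: multiplierM.
  have s : same (\1_(orthant a) : T -> R).
    apply: waved_same; have [_ /(_ _ waved1)] := mul.
    by rewrite (_ : (fun x => _ * _) = (\1_(orthant a) : T -> R))//; apply/funext => x; rewrite mulr1.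
  by move: s; rewrite /same !integral_indic// !setIT.
- by move=> k; rewrite ltey_eq fin_num_measure//; exact: measurable_orthant.
Qed.

End trigonometric_determination.

Section cramer_wold.
Context d1 d2 (T1 : measurableType d1) (T2 : measurableType d2) (R : realType).
Variables (P1 : probability T1 R) (P2 : probability T2 R) (I : finType).
Variables (V : I -> T1 -> R) (W : I -> T2 -> R).
Hypothesis mV : forall i, measurable_fun setT (V i).
Hypothesis mW : forall i, measurable_fun setT (W i).

Lemma integral_vec_wave d (T : measurableType d) (P : probability T R)
    (U : I -> T -> R) (mU : measurable_fun setT ((fun t => U ^~ t) : T -> vec R I))
    (m : probability (vec R I) R)
    (mE : forall A, measurable A -> m A = P ((fun t => U ^~ t) @^-1` A)) xi c :
  (\int[m]_x (cos (\sum_i xi i * (x : I -> R) i + c))%:E =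
  \int[pushforward P (fun t => \sum_i xi i * U i t)%R]_y (cos (y + c))%:E)%E.
Proof.
have mcos : measurable_fun setT (@cos R).
  by apply: continuous_measurable_fun; exact: continuous_cos.
have mUi i : measurable_fun setT (U i).
  exact: (measurableT_comp (measurable_vec_coord i) mU).
have mS : measurable_fun setT (fun t => \sum_i xi i * U i t).
  by apply: measurable_sum => i; apply: measurable_funM.
have mc : measurable_fun setT (fun y : R => (cos (y + c))%:E).
  apply/measurable_EFinP; apply: (measurableT_comp mcos).
  exact: measurable_funD.
have bint (f : T -> R) : measurable_fun setT f ->
    P.-integrable setT (EFin \o (fun t => cos (f t + c))).
  move=> mf; apply: measurable_bounded_integrable => //.
  - exact: fin_num_fun_lty.
  - by apply: (measurableT_comp mcos); exact: measurable_funD.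
  - exists 1; split; first exact: num_real.
    by move=> M M1 t _; exact: le_trans (cos_max _) (ltW M1).
rewrite [RHS]integral_pushforward//; last first.
  exact: bint mS.
transitivity (\int[pushforward P ((fun t => U ^~ t) : T -> vec R I)]_x
    (cos (\sum_i xi i * (x : I -> R) i + c))%:E)%E.
  by apply: eq_measure_integral => A mA _; exact: mE.
rewrite integral_pushforward//; last first.
  exact: bint mS.
apply/measurable_EFinP; apply: (measurableT_comp mcos).
by apply: measurable_funD => //; exact: measurable_vec_sum.
Qed.

(** The integral of a wave against the law of a random vector only involves the
    law of one linear image of this vector, and waves determine the law. *)
Theorem cramer_wold (h : vec R I -> \bar R) :
  (forall (xi : I -> R) (A : set R), measurable A ->
    P1 ((fun t => \sum_i xi i * V i t) @^-1` A) =
    P2 ((fun t => \sum_i xi i * W i t) @^-1` A)) ->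
  measurable_fun setT h -> (forall x, 0 <= h x)%E ->
  (\int[P1]_t h (V ^~ t) = \int[P2]_t h (W ^~ t))%E.
Proof.
move=> VW mh h0.
have mV' : measurable_fun setT ((fun t => V ^~ t) : T1 -> vec R I).
  exact: measurable_vec.
have mW' : measurable_fun setT ((fun t => W ^~ t) : T2 -> vec R I).
  exact: measurable_vec.
pose X1 : {RV P1 >-> vec R I} :=
  HB.pack ((fun t => V ^~ t) : T1 -> vec R I) (isMeasurableFun.Build _ _ _ _ _ mV').
pose X2 : {RV P2 >-> vec R I} :=
  HB.pack ((fun t => W ^~ t) : T2 -> vec R I) (isMeasurableFun.Build _ _ _ _ _ mW').
transitivity (\int[distribution P1 X1]_x h x)%E.
  by rewrite ge0_integral_distribution.
transitivity (\int[distribution P2 X2]_x h x)%E; last first.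
  by rewrite ge0_integral_distribution.
apply: eq_measure_integral => A mA _.
apply: (wave_determines (mu := distribution P1 X1) (nu := distribution P2 X2)) => // xi c.
rewrite (integral_vec_wave (P := P1) (U := V))// (integral_vec_wave (P := P2) (U := W))//.
apply: eq_measure_integral.
- by apply: measurable_sum => i; exact: measurable_funM.
- by apply: measurable_sum => i; exact: measurable_funM.
- by move=> mU1 mU2 B mB _; exact: VW.
Qed.

End cramer_wold.

(** * Concentration by rotating two independent copies *)

(** Jensen's inequality for the mean of the numbers [#|D| * a d]. *)
Lemma expR_sum_le (R : realType) (D : finType) (a : D -> R) : (0 < #|D|)%N ->
  expR (\sum_d a d) <= #|D|%:R^-1 * \sum_d expR (#|D|%:R * a d).
Proof.
move=> D0; set m := \sum_d a d; set n : R := #|D|%:R.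
have n0 : 0 < n by rewrite ltr0n.
rewrite -[leLHS]mul1r -[1](mulVf (lt0r_neq0 n0)) -mulrA ler_pM2l ?invr_gt0//.
apply: (@le_trans _ _ (\sum_d expR m * (1 + (n * a d - m)))).
  rewrite -mulr_sumr big_split/= sumrB -mulr_sumr -/m !sumr_const.
  by rewrite -/n mulrC -[m *+ _]mulr_natl -/n subrr addr0.
apply: ler_sum => d _.
rewrite -[X in _ <= expR X](subrKC m) expRD ler_wpM2l ?expR_ge0//.
exact: expR_ge1Dx.
Qed.

(** Convexity on the segment from 0 to [y]. *)
Lemma expR_convex0 (R : realType) (th y : R) : 0 <= th <= 1 ->
  expR (th * y) <= 1 - th + th * expR y.
Proof.
move=> /andP[th0 th1].
have h1 := expR_ge1Dx ((1 - th) * y); have h2 := expR_ge1Dx (- (th * y)).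
have -> : expR y = expR (th * y) * expR ((1 - th) * y).
  by rewrite -expRD; congr expR; ring.
have e0 := expR_ge0 (th * y).
have {}h2 : 1 >= expR (th * y) * (1 - th * y).
  by rewrite -[leRHS](expRxMexpNx_1 (th * y)) ler_wpM2l.
have {}h1 : expR (th * y) * (1 + (1 - th) * y) <= expR (th * y) * expR ((1 - th) * y).
  by rewrite ler_wpM2l.
by nra.
Qed.

Section cauchy_schwarz.
Context d (T : measurableType d) (R : realType) (P : {measure set T -> \bar R}).

(** Cauchy-Schwarz, from [f g <= (t f^2 + g^2 / t) / 2] with the optimal [t]. *)
Lemma integral_mul_le (f g : T -> R) (a b : R) : 0 < a -> 0 < b ->
  measurable_fun setT f -> measurable_fun setT g ->
  (forall x, 0 <= f x) -> (forall x, 0 <= g x) ->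
  (\int[P]_x (f x ^+ 2)%:E <= a%:E)%E -> (\int[P]_x (g x ^+ 2)%:E <= b%:E)%E ->
  (\int[P]_x (f x * g x)%:E <= (Num.sqrt (a * b))%:E)%E.
Proof.
move=> a0 b0 mf mg f0 g0 fa gb.
pose t := Num.sqrt (b / a).
have t0 : 0 < t by rewrite sqrtr_gt0 divr_gt0.
have mf2 : measurable_fun setT (fun x => (f x ^+ 2)%:E).
  by apply/measurable_EFinP; exact: measurable_funX.
have mg2 : measurable_fun setT (fun x => (g x ^+ 2)%:E).
  by apply/measurable_EFinP; exact: measurable_funX.
have f20 x : (0 <= (f x ^+ 2)%:E)%E by rewrite lee_fin sqr_ge0.
have g20 x : (0 <= (g x ^+ 2)%:E)%E by rewrite lee_fin sqr_ge0.
apply: (@le_trans _ _ (\int[P]_x ((t / 2)%:E * (f x ^+ 2)%:E + (t^-1 / 2)%:E * (g x ^+ 2)%:E))%E).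
  apply: ge0_le_integral => //.
  - by move=> x _; rewrite lee_fin mulr_ge0.
  - by apply/measurable_EFinP; exact: measurable_funM.
  - by apply: emeasurable_funD; apply: emeasurable_funM => //; exact: measurable_cst.
  - move=> x _; rewrite -!EFinM -EFinD lee_fin.
    have := sqr_ge0 (t * f x - g x).
    have -> : (t * f x - g x) ^+ 2 = 2 * t * (t / 2 * f x ^+ 2 + t^-1 / 2 * g x ^+ 2 - f x * g x).
      by field; rewrite gt_eqF.
    by rewrite pmulr_rge0 ?mulr_gt0// subr_ge0.
rewrite ge0_integralD//; last 4 first.
- by move=> x _; rewrite mule_ge0// lee_fin divr_ge0// ltW.
- exact: measurable_funeM.
- by move=> x _; rewrite mule_ge0// lee_fin divr_ge0// invr_ge0 ltW.
- exact: measurable_funeM.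
rewrite !ge0_integralZl//; last 2 first.
- by rewrite lee_fin divr_ge0// invr_ge0 ltW.
- by rewrite lee_fin divr_ge0// ltW.
have -> : Num.sqrt (a * b) = t / 2 * a + t^-1 / 2 * b.
  have -> : b = t ^+ 2 * a by rewrite sqr_sqrtr ?divr_ge0 ?ltW// divfK// gt_eqF.
  rewrite mulrCA -expr2 -exprMn sqrtr_sqr ger0_norm ?mulr_ge0 ?(ltW t0) ?(ltW a0)//.
  by field; rewrite gt_eqF.
rewrite EFinD !EFinM; apply: leeD; apply: lee_wpmul2l => //.
- by rewrite lee_fin divr_ge0// ltW.
- by rewrite lee_fin divr_ge0// invr_ge0 ltW.
Qed.

End cauchy_schwarz.

Section gaussian_family.
Context d (Omega : measurableType d) (R : realType) (P : probability Omega R).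
Context (D : finType).
Implicit Types (X : D -> Omega -> R) (xi x y : D -> R).

Definition gaussian_family X :=
  (forall i, measurable_fun setT (X i)) /\
  forall xi, exists v, is_gaussian P (fun w => \sum_i xi i * X i w) v.

Lemma gaussian_family_proj X i : gaussian_family X -> exists v, is_gaussian P (X i) v.
Proof.
move=> [mX /(_ (fun j => if j == i then 1 else 0))[v gv]]; exists v.
have -> // : X i = (fun w => \sum_j (if j == i then 1 else 0) * X j w).
apply/funext => w; rewrite (bigD1 i)//= eqxx mul1r big1 ?addr0//.
by move=> j /negPf ->; rewrite mul0r.
Qed.

(** Convexity of the exponential reduces the claim to single coordinates, whose
    joint law may be degenerate. *)
Lemma gaussian_family_expR_sqr X : gaussian_family X ->
  exists2 e : R, 0 < e &
  (\int[P]_w (expR (e * (1 + \sum_i X i w ^+ 2)))%:E < +oo)%E.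
Proof.
move=> gX; have [mX _] := gX.
have [D0|] := posnP #|D|.
  exists 1 => //; have noD (i : D) : False by have := card0_eq D0 i; rewrite inE.
  rewrite (eq_integral (fun=> (expR 1)%:E)); last first.
    by move=> w _; rewrite big1 ?addr0 ?mulr1// => i; case: (noD i).
  rewrite integral_cst// lte_mul_pinfty//; first exact: fin_num_fun_lty.
move=> D0.
have /choice[v gv] := fun i => gaussian_family_proj i gX.
have v0 i : 0 <= v i by have [] := gv i.
pose n : R := #|D|%:R.
have n0 : 0 < n by rewrite ltr0n.
pose V := 1 + \sum_i v i.
have vV i : v i <= V.
  by rewrite /V (bigD1 i)//= addrCA lerDl addr_ge0// sumr_ge0.
have V0 : 0 < V by rewrite ltr_pwDl// sumr_ge0.
pose e := (4 * n * V)^-1.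
have e0 : 0 < e by rewrite invr_gt0 !mulr_gt0.
exists e => //.
have mE i : measurable_fun setT (fun w => (expR (n * e * X i w ^+ 2))%:E).
  by apply: measurable_expRM; exact: measurable_funX.
have mS : measurable_fun setT (fun w => (expR (e * (1 + \sum_i X i w ^+ 2)))%:E).
  apply: measurable_expRM; apply: measurable_funD => //.
  by apply: measurable_sum => i; exact: measurable_funX.
apply: (@le_lt_trans _ _ (\int[P]_w ((expR e)%:E * \sum_i (expR (n * e * X i w ^+ 2))%:E))%E).
  apply: ge0_le_integral => //.
  - apply: measurable_funeM; exact: emeasurable_sum.
  - move=> w _; rewrite sumEFin -EFinM lee_fin mulrDr mulr1 expRD ler_wpM2l ?expR_ge0//.
    rewrite mulr_sumr; apply: (le_trans (expR_sum_le _ D0)).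
    under [leRHS]eq_bigr do rewrite -mulrA.
    by rewrite ler_piMl ?sumr_ge0// invf_le1// ler1n.
rewrite ge0_integralZl//; last 2 first.
- exact: emeasurable_sum.
- by move=> w _; apply: sume_ge0 => i _; rewrite lee_fin expR_ge0.
rewrite lte_mul_pinfty//.
rewrite ge0_integral_sum//.
apply: lte_sum_pinfty => i _.
have nev : 2 * (n * e) * v i < 1.
  rewrite /e (_ : _ * _ = v i / (2 * V)); last by field; rewrite !gt_eqF.
  by rewrite ltr_pdivrMr ?mulr_gt0// mul1r; have := vV i; lra.
by rewrite (is_gaussian_expR_sqr (gv i) nev) ltry.
Qed.

(** The linear images of both pairs are centered Gaussian, so by Cramer-Wold only
    their variances have to be compared; these agree because
    [a' ^+ 2 + b' ^+ 2 = a ^+ 2 + b ^+ 2] pointwise for an orthogonal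
    transformation. *)
Lemma gaussian_family_rotation X (c s : R) (K : (D -> R) -> (D -> R) -> \bar R) :
  gaussian_family X -> c ^+ 2 + s ^+ 2 = 1 ->
  measurable_fun setT (fun x : vec R (D + D)%type => K (x \o inl) (x \o inr)) ->
  (forall x y, 0 <= K x y)%E ->
  (\int[P \x P]_z K (X ^~ z.1) (X ^~ z.2) =
   \int[P \x P]_z K (fun i => s * X i z.1 + c * X i z.2)%R
                    (fun i => c * X i z.1 - s * X i z.2)%R)%E.
Proof.
move=> [mX gX] cs mK K0.
pose V (i : D + D) (z : Omega * Omega) := match i with
  | inl i => X i z.1 | inr i => X i z.2 end.
pose W (i : D + D) (z : Omega * Omega) := match i with
  | inl i => s * X i z.1 + c * X i z.2 | inr i => c * X i z.1 - s * X i z.2 end.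
have m1 i : measurable_fun setT (fun z : Omega * Omega => X i z.1).
  by apply: measurableT_comp.
have m2 i : measurable_fun setT (fun z : Omega * Omega => X i z.2).
  by apply: measurableT_comp.
have mV i : measurable_fun setT (V i) by case: i => i; [exact: m1|exact: m2].
have mW i : measurable_fun setT (W i).
  case: i => i; first by apply: measurable_funD; apply: measurable_funM.
  by apply: measurable_funB; apply: measurable_funM.
have H := @cramer_wold _ _ _ _ R (P \x P)%E (P \x P)%E _ V W mV mW
  (fun u => K (u \o inl) (u \o inr)) _ mK (fun u => K0 _ _).
apply: H => xi A mA.
pose a w := \sum_i xi (inl i) * X i w.
pose b w := \sum_i xi (inr i) * X i w.
pose a' w := \sum_i (s * xi (inl i) + c * xi (inr i)) * X i w.
pose b' w := \sum_i (c * xi (inl i) - s * xi (inr i)) * X i w.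
have a'E w : a' w = s * a w + c * b w.
  rewrite /a /b !mulr_sumr -big_split/=; apply: eq_bigr => i _.
  by rewrite mulrDl !mulrA.
have b'E w : b' w = c * a w - s * b w.
  rewrite /a /b !mulr_sumr -sumrB/=; apply: eq_bigr => i _.
  by rewrite mulrBl !mulrA.
have -> : (fun z => \sum_i xi i * V i z) = (fun z => a z.1 + b z.2).
  by apply/funext => z; rewrite big_sumType.
have -> : (fun z => \sum_i xi i * W i z) = (fun z => a' z.1 + b' z.2).
  apply/funext => z; rewrite big_sumType/= /a' /b' -!big_split/=.
  by apply: eq_bigr => i _; ring.
have [va ga] : exists v, is_gaussian P a v by exact: gX.
have [vb gb] : exists v, is_gaussian P b v by exact: gX.
have [va' ga'] : exists v, is_gaussian P a' v by exact: gX.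
have [vb' gb'] : exists v, is_gaussian P b' v by exact: gX.
have [_ _ ->//] := is_gaussian_prod ga gb.
have [_ _ ->//] := is_gaussian_prod ga' gb'.
suff -> : va + vb = va' + vb' by [].
have msq f v : is_gaussian P f v -> measurable_fun setT (fun w => (f w ^+ 2)%:E).
  by move=> [mf _ _]; apply/measurable_EFinP; exact: measurable_funX.
have sq0 (f : Omega -> R) w : (0 <= (f w ^+ 2)%:E)%E by rewrite lee_fin sqr_ge0.
apply: EFin_inj; rewrite !EFinD.
rewrite -(is_gaussian_sqr ga) -(is_gaussian_sqr gb) -(is_gaussian_sqr ga') -(is_gaussian_sqr gb').
rewrite -!ge0_integralD//; [|exact: msq ga'|exact: msq gb'|exact: msq ga|exact: msq gb].
apply: eq_integral => w _; rewrite -!EFinD; congr EFin.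
rewrite a'E b'E -[LHS]mulr1 -cs; ring.
Qed.

End gaussian_family.

Section integral_on_product.
Context d (Omega : measurableType d) (R : realType) (P : probability Omega R).

Lemma integral_prod_probability (f : Omega * Omega -> \bar R) :
  measurable_fun setT f -> (forall z, 0 <= f z)%E ->
  (\int[P \x P]_z f z = \int[P]_w \int[P]_w' f (w, w'))%E.
Proof. by move=> mf f0; rewrite fubini_tonelli1. Qed.

Lemma integral_prod_swap (f : Omega * Omega -> \bar R) :
  measurable_fun setT f -> (forall z, 0 <= f z)%E ->
  (\int[P]_w \int[P]_w' f (w, w') = \int[P]_w' \int[P]_w f (w, w'))%E.
Proof. by move=> mf f0; have := @fubini_tonelli _ _ _ _ R P P f mf f0. Qed.

End integral_on_product.

Section rotation_concentration.
Context d (Omega : measurableType d) (R : realType) (P : probability Omega R).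
Context (D : finType) (X : D -> Omega -> R).
Variables (F S : (D -> R) -> R) (c0 : R).
Hypothesis gX : gaussian_family P X.
Hypothesis mF : measurable_fun setT (F : vec R D -> R).
Hypothesis mS : measurable_fun setT (S : vec R D -> R).
Hypothesis c0_ge0 : 0 <= c0.

Let q (x : D -> R) := 1 + \sum_i x i ^+ 2.

(** A one-sided first-order expansion of [F] at [x] along rotations towards [y]:
    the linear form [xi] depends on [x] only, and its variance is at most [S x]. *)
Hypothesis F_expand : forall x, exists xi : D -> R,
  (forall v, is_gaussian P (fun w => \sum_i xi i * X i w) v -> v <= S x) /\
  forall y dl, 0 <= dl <= pi / 2 ->
  F x - F (fun i => cos dl * x i - sin dl * y i) <=
    sin dl * \sum_i xi i * y i + sin dl ^+ 2 * (c0 * (q x + q y)).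

Let mX i : measurable_fun setT (X i) := gX.1 i.

Let mXF (G : (D -> R) -> R) : measurable_fun setT (G : vec R D -> R) ->
  measurable_fun setT (fun w => G (X ^~ w)).
Proof. by move=> mG; apply: (measurableT_comp mG); exact: measurable_vec. Qed.

Let mq : measurable_fun setT (q : vec R D -> R).
Proof.
apply: measurable_funD => //; apply: measurable_sum => i.
by apply: measurable_funX; exact: measurable_vec_coord.
Qed.

Let q0 x : 0 <= q x.
Proof. by rewrite addr_ge0// sumr_ge0// => i _; exact: sqr_ge0. Qed.

Let M e := (\int[P]_w (expR (e * q (X ^~ w)))%:E)%E.

Let mexp a (G : (D -> R) -> R) : measurable_fun setT (G : vec R D -> R) ->
  measurable_fun setT (fun w => expR (a * G (X ^~ w))).
Proof.
move=> mG; apply: measurableT_comp => //.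
by apply: measurable_funM => //; exact: mXF.
Qed.

(** For small [e] the remainder term disappears from the exponential moments. *)
Let M_near1 : exists e0 C : R, [/\ 0 < e0, 0 <= C &
  forall e, 0 <= e <= e0 -> (M e <= (1 + e * C)%:E)%E].
Proof.
have [e0 e00] := gaussian_family_expR_sqr gX; rewrite -/(M e0) => Me0.
have M0 e : (0 <= M e)%E by apply: integral_ge0 => w _; rewrite lee_fin expR_ge0.
have Mfin : M e0 \is a fin_num by rewrite ge0_fin_numE.
exists e0, (fine (M e0) / e0); split => //.
  by rewrite divr_ge0 ?(ltW e00)// fine_ge0.
move=> e /andP[e_ge0 ee0].
pose th := e / e0.
have th0 : 0 <= th by rewrite divr_ge0// ltW.
have th1 : th <= 1 by rewrite ler_pdivrMr// mul1r.
apply: (@le_trans _ _ (\int[P]_w (1 + th%:E * (expR (e0 * q (X ^~ w)))%:E))%E).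
  apply: ge0_le_integral => //.
  - by apply/measurable_EFinP; exact: mexp mq.
  - apply: emeasurable_funD; first exact: measurable_cst.
    apply: measurable_funeM; apply/measurable_EFinP; exact: mexp mq.
  - move=> w _; rewrite -EFinM -EFinD lee_fin.
    have -> : e * q (X ^~ w) = th * (e0 * q (X ^~ w)).
      by rewrite /th mulrA divfK// gt_eqF.
    apply: (le_trans (expR_convex0 _ _)); first by rewrite th0 th1.
    by rewrite lerD2r gerBl.
rewrite ge0_integralD//; last 2 first.
- by move=> w _; rewrite -EFinM lee_fin mulr_ge0// expR_ge0.
- apply: measurable_funeM; apply/measurable_EFinP; exact: mexp mq.
rewrite ge0_integralZl//; last first.
  by apply/measurable_EFinP; exact: mexp mq.
have -> : (\int[P]_w 1 = 1)%E.
  by rewrite integral_cst// mul1e; exact: probability_setT.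
rewrite -/(M e0) -(fineK Mfin).
by rewrite -EFinM -EFinD lee_fin lerD2l /th mulrAC mulrA.
Qed.

Let step (N : nat) : R := pi / 2 / N%:R.

Let step_itv N : (0 < N)%N -> 0 <= step N <= pi / 2.
Proof.
move=> N0; have N0' : 0 < N%:R :> R by rewrite ltr0n.
rewrite /step !divr_ge0 ?pi_ge0//= ler_pdivrMr//.
by rewrite ler_peMr ?ler1n// divr_ge0 ?pi_ge0.
Qed.

Let sin_step N : (0 < N)%N -> 0 <= sin (step N) /\ N%:R * sin (step N) <= 2.
Proof.
move=> N0; have N0' : 0 < N%:R :> R by rewrite ltr0n.
have /andP[s0 s1] := step_itv N0.
have p0 := pi_ge0 R.
split; first by apply: sin_ge0_pi; rewrite s0/=; lra.
have [p2 _] := pihalf_02_cos_pihalf R; have /andP[_ {}p2] := p2.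
have : sin (step N) <= step N.
  have [|x _] := @MVT_segment R sin cos 0 (step N) s0 (fun x _ => is_derive_sin x).
    by apply: continuous_subspaceT; exact: continuous_sin.
  rewrite sin0 !subr0 => ->.
  by rewrite ler_piMl// cos_le1.
move=> /(ler_wpM2l (ltW N0')); rewrite /step => /le_trans; apply.
by rewrite mulrC divfK ?gt_eqF.
Qed.

Let K l N (x y : D -> R) : \bar R := (expR (l * N%:R *
  (F x - F (fun i => cos (step N) * x i - sin (step N) * y i))))%:E.

Let mK l N :
  measurable_fun setT (fun u : vec R (D + D)%type => K l N (u \o inl) (u \o inr)).
Proof.
apply: measurable_expRM; apply: measurable_funB.
  apply: (measurableT_comp mF); apply: measurable_vec => i.
  exact: (measurable_vec_coord (inl i)).
apply: (measurableT_comp mF); apply: measurable_vec => i.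
apply: measurable_funB; apply: measurable_funM => //.
  exact: (measurable_vec_coord (inl i)).
exact: (measurable_vec_coord (inr i)).
Qed.

Let K0 l N x y : (0 <= K l N x y)%E.
Proof. by rewrite lee_fin expR_ge0. Qed.

Let mX1 (a b : R) i : measurable_fun setT (fun z : Omega * Omega => a * X i z.1 + b * X i z.2).
Proof.
by apply: measurable_funD; apply: measurable_funM => //; apply: measurableT_comp.
Qed.

Let mKX l N : measurable_fun setT (fun z : Omega * Omega => K l N (X ^~ z.1) (X ^~ z.2)).
Proof.
have mg : measurable_fun setT ((fun z i => match i with
    inl i => X i z.1 | inr i => X i z.2 end) : Omega * Omega -> vec R (D + D)%type).
  by apply: measurable_vec => -[i|i]; apply: measurableT_comp.
exact: (measurableT_comp (mK l N) mg).
Qed.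

(** Telescoping along the quarter circle from the second copy to the first one,
    in [N] steps that all have the same law. *)
Let rotation_steps l N : (0 < N)%N ->
  (\int[P \x P]_z (expR (l * (F (X ^~ z.1) - F (X ^~ z.2))))%:E <=
   \int[P \x P]_z K l N (X ^~ z.1) (X ^~ z.2))%E.
Proof.
move=> N0; have N0' : 0 < N%:R :> R by rewrite ltr0n.
pose Z (j : nat) (z : Omega * Omega) i :=
  sin (j%:R * step N) * X i z.1 + cos (j%:R * step N) * X i z.2.
have Z0 z : Z 0 z = X ^~ z.2.
  by apply/funext => i; rewrite /Z mul0r sin0 cos0 mul0r mul1r add0r.
have ZN z : Z N z = X ^~ z.1.
  apply/funext => i; rewrite /Z /step [N%:R * _]mulrC divfK ?gt_eqF//.
  by rewrite sin_pihalf cos_pihalf mul0r mul1r addr0.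
have mFZ j : measurable_fun setT (fun z => F (Z j z)).
  by apply: (measurableT_comp mF); apply: measurable_vec => i; exact: mX1.
pose E j (z : Omega * Omega) : \bar R := (expR (N%:R * (l * (F (Z j.+1 z) - F (Z j z)))))%:E.
have mE j : measurable_fun setT (E j).
  by apply: measurable_expRM; apply: measurable_funM => //; exact: measurable_funB.
have E0 j z : (0 <= E j z)%E by rewrite lee_fin expR_ge0.
have EK j : (\int[P \x P]_z E j z = \int[P \x P]_z K l N (X ^~ z.1) (X ^~ z.2))%E.
  rewrite (@gaussian_family_rotation _ _ _ _ _ X (cos (j.+1%:R * step N))
    (sin (j.+1%:R * step N)) (K l N) gX (cos2Dsin2 _) (mK l N) (K0 l N)).
  apply: eq_integral => z _; rewrite /E /K; congr (expR _)%:E.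
  rewrite mulrA [N%:R * l]mulrC; congr (_ * (F _ - F _)).
  apply/funext => i; rewrite /Z.
  have -> : j%:R * step N = j.+1%:R * step N - step N by rewrite -natr1; ring.
  by rewrite sinB cosB; ring.
apply: (@le_trans _ _ (\int[P \x P]_z ((N%:R^-1)%:E * \sum_(j < N) E j z))%E).
  apply: ge0_le_integral => //.
  - apply: measurable_expRM; apply: measurable_funB.
      by under eq_fun do rewrite -ZN; exact: mFZ.
    by under eq_fun do rewrite -Z0; exact: mFZ.
  - apply: measurable_funeM; apply: emeasurable_sum => j; exact: mE.
  - move=> z _; rewrite sumEFin -EFinM lee_fin.
    have -> : l * (F (X ^~ z.1) - F (X ^~ z.2)) = \sum_(j < N) l * (F (Z j.+1 z) - F (Z j z)).
      rewrite -mulr_sumr; congr (_ * _).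
      rewrite -ZN -[in RHS](big_mkord xpredT (fun j => F (Z j.+1 z) - F (Z j z))).
      by rewrite telescope_sumr// Z0.
    have := @expR_sum_le R 'I_N (fun j => l * (F (Z j.+1 z) - F (Z j z))).
    by rewrite card_ord; apply.
rewrite ge0_integralZl//; last 2 first.
- by apply: emeasurable_sum => j; exact: mE.
- by move=> z _; exact: sume_ge0.
rewrite ge0_integral_sum//.
under eq_bigr do rewrite EK.
set J := (\int[_]_z K _ _ _ _)%E.
rewrite sumr_const card_ord -[(J *+ N)%R]/(J *+ N)%E -mule_natl muleA -EFinM mulVf ?gt_eqF//.
by rewrite mul1e.
Qed.

Let S_ge0 x : 0 <= S x.
Proof.
have [xi [xiS _]] := F_expand x; have [v gv] := gX.2 xi.
by apply: le_trans (xiS v gv); case: gv.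
Qed.

(** One step: the linear part contributes its variance, the remainder the factor
    [m], by Cauchy-Schwarz in each copy. *)
Let one_step l N T m : (0 < N)%N -> 0 <= l -> 0 < T -> 0 < m ->
  (\int[P]_w (expR (8 * l ^+ 2 * S (X ^~ w)))%:E <= T%:E)%E ->
  (M (2 * (l * N%:R * sin (step N) ^+ 2 * c0)) <= m%:E)%E ->
  (\int[P \x P]_z K l N (X ^~ z.1) (X ^~ z.2) <= (m * Num.sqrt T)%:E)%E.
Proof.
move=> N0 l0 T0 m0 hT hm; have N0' : 0 < N%:R :> R by rewrite ltr0n.
have [sn0 sn2] := sin_step N0.
set e := l * N%:R * sin (step N) ^+ 2 * c0 in hm.
have e0 : 0 <= e by rewrite !mulr_ge0// ltW.
have meq : measurable_fun setT (fun w => expR (e * q (X ^~ w))) by exact: mexp mq.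
have eq2 : (\int[P]_w (expR (e * q (X ^~ w)) ^+ 2)%:E <= m%:E)%E.
  apply: le_trans hm; apply: eqW.
  by apply: eq_integral => w _; rewrite expr2 -expRD /e; congr (expR _)%:E; ring.
rewrite integral_prod_probability//.
apply: (@le_trans _ _ (\int[P]_w ((Num.sqrt m)%:E *
    (expR (e * q (X ^~ w)) * expR (4 * l ^+ 2 * S (X ^~ w)))%:E))%E).
  apply: ge0_le_integral => //.
  - by move=> w _; exact: integral_ge0.
  - exact: (@measurable_fun_fubini_tonelli_F _ _ _ _ _ P _ (mKX l N)).
  - apply: measurable_funeM; apply/measurable_EFinP; apply: measurable_funM => //; exact: mexp mS.
  move=> w _ /=.
  have [xi [xiS xiF]] := F_expand (X ^~ w); have [v gv] := gX.2 xi.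
  have {}xiS := xiS v gv.
  pose f w' := expR (l * N%:R * sin (step N) * \sum_i xi i * X i w').
  have mf : measurable_fun setT f.
    apply: measurableT_comp => //; apply: measurable_funM => //.
    by case: gv.
  have f2 : (\int[P]_w' (f w' ^+ 2)%:E <=
      (expR ((2 * (l * N%:R * sin (step N))) ^+ 2 * v / 2))%:E)%E.
    rewrite -(is_gaussian_expR _ gv); apply: eqW.
    by apply: eq_integral => w' _; rewrite /f expr2 -expRD; congr (expR _)%:E; ring.
  have fg := integral_mul_le (expR_gt0 _) m0 mf meq (fun=> expR_ge0 _) (fun=> expR_ge0 _) f2 eq2.
  apply: (@le_trans _ _ (\int[P]_w' ((expR (e * q (X ^~ w)))%:E *
      (f w' * expR (e * q (X ^~ w')))%:E))%E).
    apply: ge0_le_integral => //.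
    - exact: (measurableT_comp (mKX l N) (pair1_measurable w)).
    - apply: measurable_funeM; apply/measurable_EFinP; exact: measurable_funM.
    - move=> w' _; rewrite /K -EFinM lee_fin /f -!expRD ler_expR.
      have := ler_wpM2l (mulr_ge0 l0 (ltW N0')) (xiF (X ^~ w') _ (step_itv N0)).
      by move=> /le_trans; apply; rewrite /e; apply: eqW; ring.
  rewrite ge0_integralZl//; last 2 first.
  - by apply/measurable_EFinP; exact: measurable_funM.
  - by move=> w' _; rewrite lee_fin mulr_ge0 ?expR_ge0.
  apply: (le_trans (lee_wpmul2l _ fg)); first by rewrite lee_fin expR_ge0.
  rewrite -!EFinM lee_fin [leRHS]mulrCA ler_wpM2l ?expR_ge0//.
  rewrite sqrtrM ?expR_ge0// mulrC ler_wpM2l ?sqrtr_ge0//.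
  have -> : expR ((2 * (l * N%:R * sin (step N))) ^+ 2 * v / 2) =
      expR ((l * (N%:R * sin (step N))) ^+ 2 * v) ^+ 2.
    by rewrite [RHS]expr2 -expRD; congr expR; field.
  rewrite sqrtr_sqr ger0_norm ?expR_ge0// ler_expR.
  apply: ler_pM => //; [exact: sqr_ge0|by case: gv|].
  rewrite exprMn mulrC ler_wpM2r ?sqr_ge0//.
  have -> : (4 : R) = 2 ^+ 2 by rewrite expr2; ring.
  by rewrite lerXn2r// nnegrE ?mulr_ge0// ltW.
rewrite ge0_integralZl//; last first.
  by apply/measurable_EFinP; apply: measurable_funM => //; exact: mexp mS.
have -> : m * Num.sqrt T = Num.sqrt m * Num.sqrt (m * T).
  by rewrite sqrtrM ?ltW// mulrA -expr2 sqr_sqrtr// ltW.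
rewrite EFinM; apply: lee_wpmul2l; first by rewrite lee_fin sqrtr_ge0.
apply: integral_mul_le => //; first exact: mexp mS.
apply: le_trans hT; apply: eqW.
apply: eq_integral => w _; rewrite expr2 -expRD; congr (expR _)%:E; ring.
Qed.

(** The square of [E exp(l F) * E exp(-l F)] is bounded without centering [F], so
    [S] may be unbounded and related to [F] itself. With [N] rotation steps the
    linear parts contribute [E exp(8 l^2 S)] whatever [N] is, while the
    remainders, of order [1/N] in total, vanish as [N] grows. *)
Theorem rotation_concentration l : 0 <= l ->
  ((\int[P]_w (expR (l * F (X ^~ w)))%:E * \int[P]_w (expR (- l * F (X ^~ w)))%:E) *
   (\int[P]_w (expR (l * F (X ^~ w)))%:E * \int[P]_w (expR (- l * F (X ^~ w)))%:E) <=
   \int[P]_w (expR (8 * l ^+ 2 * S (X ^~ w)))%:E)%E.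
Proof.
move=> l0.
set AB := (\int[P]_w (expR (l * F (X ^~ w)))%:E * \int[P]_w (expR (- l * F (X ^~ w)))%:E)%E.
have mF1 a : measurable_fun setT (fun w => (expR (a * F (X ^~ w)))%:E).
  by apply/measurable_EFinP; exact: mexp mF.
have ABE : AB = (\int[P \x P]_z (expR (l * (F (X ^~ z.1) - F (X ^~ z.2))))%:E)%E.
  rewrite integral_prod_probability; last 2 first.
  - apply: measurable_expRM; apply: measurable_funB.
      exact: (measurableT_comp (mXF mF) measurable_fst).
    exact: (measurableT_comp (mXF mF) measurable_snd).
  - by move=> z; rewrite lee_fin expR_ge0.
  rewrite /AB -ge0_integralZr//; last first.
    by apply: integral_ge0 => w _; rewrite lee_fin expR_ge0.
  apply: eq_integral => w _; rewrite -ge0_integralZl//.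
  apply: eq_integral => w' _; rewrite -EFinM -expRD; congr (expR _)%:E => /=; ring.
have AB0 : (0 <= AB)%E by apply: mule_ge0; apply: integral_ge0 => w _; rewrite lee_fin expR_ge0.
set TT := (\int[P]_w (expR (8 * l ^+ 2 * S (X ^~ w)))%:E)%E.
have TT1 : (1 <= TT)%E.
  have <- : (\int[P]_w 1 = 1)%E.
    by rewrite integral_cst// mul1e; exact: probability_setT.
  apply: ge0_le_integral => //.
    by apply/measurable_EFinP; exact: mexp mS.
  move=> w _; rewrite lee_fin -[leLHS]expR0 ler_expR mulr_ge0// mulr_ge0//.
  exact: sqr_ge0.
have [->|TTy] := eqVneq TT +oo%E; first by rewrite leey.
have TTfin : TT \is a fin_num.
  by rewrite ge0_fin_numE ?(le_trans _ TT1)// lt_neqAle TTy leey.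
pose T := fine TT.
have TE : TT = T%:E by rewrite fineK.
have T1 : 1 <= T by rewrite -lee_fin -TE.
have T0 : 0 < T by rewrite (lt_le_trans _ T1).
have [e0 [C [e00 C0 MC]]] := M_near1.
have bound N : (0 < N)%N -> 8 * l * c0 / N%:R <= e0 ->
    (AB <= ((1 + 8 * l * c0 / N%:R * C) * Num.sqrt T)%:E)%E.
  move=> N0 hN; have N0' : 0 < N%:R :> R by rewrite ltr0n.
  rewrite ABE; apply: (le_trans (rotation_steps l N0)).
  have [sn0 sn2] := sin_step N0.
  have cN0 : 0 <= 8 * l * c0 / N%:R by rewrite divr_ge0 ?(ltW N0')// !mulr_ge0.
  apply: one_step => //.
  - by rewrite ltr_pwDl// mulr_ge0.
  - by rewrite -/TT TE.
  set e := 2 * _.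
  have e_ge0 : 0 <= e by rewrite /e !mulr_ge0 ?sqr_ge0// ltW.
  have eN : e <= 8 * l * c0 / N%:R.
    rewrite ler_pdivlMr//.
    have -> : e * N%:R = 2 * l * c0 * (N%:R * sin (step N)) ^+ 2 by rewrite /e; ring.
    have -> : 8 * l * c0 = 2 * l * c0 * 2 ^+ 2 by ring.
    have l2 : 0 <= 2 * l * c0 by rewrite !mulr_ge0.
    have Ns : 0 <= N%:R * sin (step N) by rewrite mulr_ge0// ltW.
    by rewrite ler_wpM2l// lerXn2r// nnegrE.
  apply: (le_trans (MC e _)); first by rewrite e_ge0 (le_trans eN).
  by rewrite lee_fin lerD2l ler_wpM2r.
have bound2 : (AB <= (Num.sqrt T)%:E)%E.
  pose a := 8 * l * c0.
  have a0 : 0 <= a by rewrite !mulr_ge0.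
  have large b (N : nat) : 0 < b -> a / b < N%:R -> a / N.+1%:R <= b.
    move=> b0; rewrite ltr_pdivrMr// => h; rewrite ler_pdivrMr ?ltr0n//.
    by rewrite -natr1; nra.
  have ABfin : AB \is a fin_num.
    rewrite ge0_fin_numE//; apply: (@le_lt_trans _ _ _ _ _ (bound (Num.truncn (a / e0)).+2 _ _)) => //.
      by apply: large => //; exact: truncnS_gt.
    exact: ltry.
  rewrite -(fineK ABfin) lee_fin; apply/ler_addgt0Pr => eta eta0.
  pose b := Num.min e0 (eta / (C * Num.sqrt T + 1)).
  have CT0 : 0 <= C * Num.sqrt T by rewrite mulr_ge0// sqrtr_ge0.
  have CT1 : 0 < C * Num.sqrt T + 1 by lra.
  have b0 : 0 < b by rewrite lt_min e00 divr_gt0.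
  have hb := large b (Num.truncn (a / b)).+1 b0 (truncnS_gt _).
  have := bound (Num.truncn (a / b)).+2 (ltn0Sn _); rewrite -/a => /(_ _) h.
  have : (AB <= ((1 + a / (Num.truncn (a / b)).+2%:R * C) * Num.sqrt T)%:E)%E.
    by apply: h; rewrite (le_trans hb)// ge_min lexx.
  rewrite -{1}(fineK ABfin) lee_fin => /le_trans; apply.
  rewrite mulrDl mul1r lerD2l -mulrA.
  apply: (@le_trans _ _ (b * (C * Num.sqrt T))); first by rewrite ler_wpM2r.
  apply: (@le_trans _ _ (eta / (C * Num.sqrt T + 1) * (C * Num.sqrt T))).
    by rewrite ler_wpM2r// ge_min lexx orbT.
  by rewrite mulrAC ler_pdivrMr// ler_pM2l//; lra.
rewrite TE (le_trans (lee_pmul AB0 AB0 bound2 bound2))//.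
by rewrite -EFinM -expr2 sqr_sqrtr// ltW.
Qed.

End rotation_concentration.

(** * Functions that satisfy the first-order expansion, and countable suprema *)

Lemma bigmax0_attained (R : realDomainType) n (f : 'I_n -> R) :
  (exists j, \big[Num.max/0]_j f j = f j) \/ \big[Num.max/0]_j f j = 0.
Proof.
elim: (index_enum _) => [|j r [[i IH]|IH]]; first by right; rewrite big_nil.
- left; rewrite big_cons IH; have [_|_] := leP (f i) (f j).
    by exists j.
  by exists i.
- rewrite big_cons IH; have [_|_] := leP 0 (f j); last by right.
  by left; exists j.
Qed.

Section expandable.
Context d (Omega : measurableType d) (R : realType) (P : probability Omega R).
Context (D : finType) (X : D -> Omega -> R).
Variables (S : (D -> R) -> R) (c0 : R).

(** The hypothesis of the concentration theorem, as a property of [F] that is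
    stable under absolute values and finite maxima: at a given point only the
    function that attains the maximum matters. *)
Definition expandable (F : (D -> R) -> R) := forall x, exists xi : D -> R,
  (forall v, is_gaussian P (fun w => \sum_i xi i * X i w) v -> v <= S x) /\
  forall y dl, 0 <= dl <= pi / 2 ->
  F x - F (fun i => cos dl * x i - sin dl * y i) <=
    sin dl * \sum_i xi i * y i +
    sin dl ^+ 2 * (c0 * ((1 + \sum_i x i ^+ 2) + (1 + \sum_i y i ^+ 2))).

Lemma expandable_norm F : expandable F -> expandable (fun x => - F x) ->
  expandable (fun x => `|F x|).
Proof.
move=> eF eNF x; have [Fx|Fx] := leP 0 (F x).
  have [xi [xiS xiF]] := eF x; exists xi; split => // y dl dl01.
  apply: le_trans (xiF y dl dl01); rewrite ger0_norm// lerD2l lerN2.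
  exact: ler_norm.
have [xi [xiS xiF]] := eNF x; exists xi; split => // y dl dl01.
apply: le_trans (xiF y dl dl01); rewrite ltr0_norm// lerD2l lerN2.
by rewrite -normrN ler_norm.
Qed.

Lemma expandable_bigmax n (F : 'I_n -> (D -> R) -> R) : 0 <= c0 ->
  (forall x, 0 <= S x) ->
  (forall j, expandable (F j)) -> expandable (fun x => \big[Num.max/0]_j F j x).
Proof.
move=> c00 S0 eF x.
have [[j Fj]|Fx0] := bigmax0_attained (F ^~ x).
- have [xi [xiS xiF]] := eF j x; exists xi; split => // y dl dl01.
  apply: le_trans (xiF y dl dl01); rewrite Fj lerD2l lerN2.
  exact: (le_bigmax _ (fun j => F j _)).
- exists (fun=> 0); split => [v gv|y dl dl01].
    suff -> : v = 0 by exact: S0.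
    apply: EFin_inj; rewrite -(is_gaussian_sqr gv).
    rewrite (eq_integral (fun=> 0%E)) ?integral0// => w _.
    by rewrite big1 ?expr0n// => i _; rewrite mul0r.
  rewrite Fx0 sub0r [X in _ <= _ * X + _]big1 => [|i _]; last by rewrite mul0r.
  rewrite mulr0 add0r.
  apply: (@le_trans _ _ 0); first by rewrite oppr_le0; exact: bigmax_ge_id.
  rewrite mulr_ge0 ?sqr_ge0// mulr_ge0//.
  by rewrite !addr_ge0// sumr_ge0// => i _; exact: sqr_ge0.
Qed.

End expandable.

Lemma cos_onem_le (R : realType) (dl : R) : 0 <= dl <= pi / 2 ->
  0 <= 1 - cos dl <= sin dl ^+ 2 /\ 0 <= sin dl <= 1.
Proof.
move=> /andP[dl0 dl1]; have p0 := pi_ge0 R.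
have c0 : 0 <= cos dl by apply: cos_ge0_pihalf; rewrite dl1 andbT; lra.
have c1 := cos_le1 dl.
have s0 : 0 <= sin dl by apply: sin_ge0_pi; rewrite dl0/=; lra.
split; last by rewrite s0 sin_le1.
by rewrite subr_ge0 c1/= sin2cos2 lerD2l lerN2 expr2 ler_piMr.
Qed.

Lemma measurable_bigmax d (T : measurableType d) (R : realType) n
    (f : 'I_n -> T -> R) : (forall j, measurable_fun setT (f j)) ->
  measurable_fun setT (fun x => \big[Num.max/0]_j f j x).
Proof.
move=> mf; elim: (index_enum _) => [|j r IH].
  rewrite (_ : (fun x => _) = cst 0); first exact: measurable_cst.
  by apply/funext => x; rewrite big_nil.
rewrite (_ : (fun x => _) = (fun x => Num.max (f j x) (\big[Num.max/0]_(j <- r) f j x))).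
  exact: measurable_maxr.
by apply/funext => x; rewrite big_cons.
Qed.

Section countable_supremum.
Context d (T : measurableType d) (R : realType) (P : probability T R).
Variables (f : nat -> T -> R) (g : T -> R).
Hypothesis mf : forall n, measurable_fun setT (f n).
Hypothesis fg : forall n x, f n x <= g x.
Hypothesis gf : forall x c, (forall n, f n x <= c) -> g x <= c.

Definition running_max n x := \big[Num.max/0]_(j < n) f j x.
Hypothesis g0 : forall x, 0 <= g x.

Lemma measurable_running_max n : measurable_fun setT (running_max n).
Proof. exact: measurable_bigmax. Qed.

Lemma running_max_le n x : running_max n x <= g x.
Proof. by apply: bigmax_le. Qed.

Lemma running_max_nd x : nondecreasing_seq (running_max ^~ x).
Proof. by move=> m n mn; exact: (@le_bigmax_ord _ _ _ _ _ xpredT (f ^~ x)). Qed.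

Lemma cvg_running_max x : running_max n x @[n --> \oo] --> g x.
Proof.
have ub : has_ubound (range (running_max ^~ x)).
  by exists (g x) => _ [n _ <-]; exact: running_max_le.
have := nondecreasing_cvgn (@running_max_nd x) ub.
rewrite (_ : sup _ = g x)//; apply/eqP; rewrite eq_le; apply/andP; split.
  by apply: ge_sup => [|_ [n _ <-]]; [exists (running_max 0 x), 0%N|exact: running_max_le].
apply: gf => n; apply: (@le_trans _ _ (running_max n.+1 x)).
  exact: (@le_bigmax _ _ _ _ (fun j : 'I_n.+1 => f j x) ord_max).
by apply: ub_le_sup => //; exists n.+1.
Qed.

Lemma measurable_countable_supremum : measurable_fun setT g.
Proof.
apply: (@measurable_fun_cvg _ _ _ setT running_max).
  exact: measurable_running_max.
by move=> x _; exact: cvg_running_max.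
Qed.

(** Exponential moments pass to the supremum by monotone convergence. *)
Lemma expR_running_max_le l (c : \bar R) : 0 <= l ->
  (forall n, \int[P]_x (expR (l * running_max n x))%:E <= c)%E ->
  (\int[P]_x (expR (l * g x))%:E <= c)%E.
Proof.
move=> l0 H.
have mE n : measurable_fun setT (fun x => (expR (l * running_max n x))%:E).
  by apply: measurable_expRM; exact: measurable_running_max.
have -> : (\int[P]_x (expR (l * g x))%:E =
    \int[P]_x (limn (fun n => (expR (l * running_max n x))%:E)))%E.
  apply: eq_integral => x _; apply/esym/cvg_lim => //.
  apply: cvg_EFin; first exact: nearW.
  apply: (cvg_comp (fun n => l * running_max n x) expR); last exact: continuous_expR.
  by apply: cvgM; [exact: cvg_cst|exact: cvg_running_max].
have cv := @cvg_monotone_convergence _ T R P setT measurableT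
   (fun n x => (expR (l * running_max n x))%:E) mE
   (fun n x _ => expR_ge0 _).
rewrite -(cvg_lim _ (cv _))//; last first.
  by move=> x _ m n mn; rewrite lee_fin ler_expR ler_wpM2l// running_max_nd.
apply: lime_le; last exact: nearW.
apply/cvg_ex; eexists; apply: cv => x _ m n mn.
by rewrite lee_fin ler_expR ler_wpM2l// running_max_nd.
Qed.

End countable_supremum.

(** * Functionals on a separable Banach space *)

Section dual_facts.
Context (R : realType) (E : normedModType R).
Implicit Types (u v : dual E) (x : E).

(** Norming functionals at the points of a countable dense set. *)
Lemma norming_sequence : separable E -> exists u_ : nat -> dual E,
  (forall i x, `|u_ i x| <= `|x|) /\
  forall x c, (forall i, `|u_ i x| <= c) -> `|x| <= c.
Proof.
move=> [D Dc Dd].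
have [s sD] : exists s : nat -> E, D `<=` range s.
  have /pfcard_geP[->|[f]] := Dc; first by exists (fun=> 0).
  by exists f => x Dx; have [n _ <-] := 'surj_f Dx; exists n.
have /choice[u_ hu] := fun n => norming_functional (s n).
exists u_; split => [i x|x c xc]; first by have [] := hu i.
apply/ler_addgt0Pr => e e0.
have e2 : 0 < e / 2 by rewrite divr_gt0.
have [y [xy Dy]] : (ball x (e / 2) `&` D) !=set0.
  by apply: Dd; [exists x; exact: ballxx|exact: ball_open].
have [n _ ny] := sD _ Dy.
move: xy; rewrite -ball_normE/= => xy.
have [ule un] := hu n; rewrite ny in un.
have h1 : `|x| <= `|y| + e / 2.
  by rewrite -lerBlDl (le_trans (lerB_dist _ _))// ltW.
have h2 : `|y| <= `|u_ n x| + e / 2.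
  rewrite -un (_ : u_ n y = u_ n x - u_ n (x - y)); last first.
    by rewrite linearB/= subKr.
  rewrite (le_trans (ler_norm _))// (le_trans (ler_normB _ _))// lerD2l.
  by rewrite (le_trans (ule _))// ltW.
by have := xc n; lra.
Qed.

Lemma dual_lincomb (I : finType) (xi : I -> R) (u : I -> dual E) :
  exists w : dual E, forall x, w x = \sum_i xi i * u i x.
Proof.
have flin : linear ((fun x => \sum_i xi i * u i x) : E -> R^o).
  move=> a x y /=; rewrite scaler_sumr -big_split/=; apply: eq_bigr => i _.
  by rewrite linearP/= mulrDr; congr (_ + _); rewrite /GRing.scale/= mulrCA.
pose fL : {linear E -> R^o} := HB.pack ((fun x => \sum_i xi i * u i x) : E -> R^o)
  (GRing.isLinear.Build _ _ _ _ _ flin).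
have fc : continuous (fL : E -> R^o).
  move=> x; rewrite /continuous_at /=.
  elim: (index_enum I) => [|i r IH].
    rewrite big_nil; under eq_fun do rewrite big_nil; exact: cvg_cst.
  rewrite big_cons; under eq_fun do rewrite big_cons.
  apply: (@cvgD _ R^o) => //; apply: cvgM; first exact: cvg_cst.
  exact: dual_continuous.
by exists (Dual fc).
Qed.

Lemma dual_le u : exists2 M, 0 < M & forall x, `|u x| <= M * `|x|.
Proof.
have : bounded_near (dual_fun u) (nbhs 0).
  by apply: continuous_linear_bounded; exact: dual_continuous.
move=> /linear_boundedP H; near (pinfty_nbhs R) => M; exists M => //.
near: M; exact: H.
Unshelve. all: by end_near. Qed.

Let ball1_0 u : [set `|u x| | x in [set x : E | `|x| <= 1]] !=set0.
Proof. by exists `|u 0|; exists 0 => //=; rewrite normr0. Qed.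

Lemma dual_le_norm u x : `|u x| <= dual_norm u * `|x|.
Proof.
have [->|x0] := eqVneq x 0; first by rewrite linear0 !normr0 mulr0.
have nx0 : 0 < `|x| by rewrite normr_gt0.
rewrite -ler_pdivrMr//.
have [M M0 uM] := dual_le u.
apply: ub_le_sup.
  by exists M => _ [y /= y1 <-]; rewrite (le_trans (uM y))// ler_piMr// ltW.
exists (`|x|^-1 *: x) => /=.
  by rewrite normrZ normfV normr_id mulVf// gt_eqF.
by rewrite linearZ/= /GRing.scale/= normrM normfV normr_id mulrC.
Qed.

Lemma dual_norm_le u c : 0 <= c -> (forall x, `|u x| <= c * `|x|) -> dual_norm u <= c.
Proof.
move=> c0 uc; apply: ge_sup => // _ [x /= x1 <-].
by rewrite (le_trans (uc x))// ler_piMr.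
Qed.

Lemma unit_dual_le u x : dual_norm u <= 1 -> `|u x| <= `|x|.
Proof.
move=> u1; rewrite (le_trans (dual_le_norm u x))// ler_piMl//.
Qed.

Lemma contraction_dual_norm u : (forall x, `|u x| <= `|x|) -> dual_norm u <= 1.
Proof. by move=> h; apply: dual_norm_le => // x; rewrite mul1r. Qed.

Lemma continuous_borel_measurable (f : E -> R) : continuous f ->
  measurable_fun setT (f : borel E -> R).
Proof.
move=> cf; apply: (@measurability _ _ (borel E) R setT f (@RGenOInfty.G R)).
  exact: RGenOInfty.measurableE.
move=> _ [_ [a ->] <-]; rewrite setTI; apply: sub_sigma_algebra.
by apply: open_comp => // ? _; exact: cf.
Qed.

Lemma continuous_borel_measurable_self (f : E -> E) : continuous f ->
  measurable_fun setT (f : borel E -> borel E).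
Proof.
move=> cf; apply: (@measurability _ _ (borel E) (borel E) setT f (@open E)) => //.
move=> _ [A oA <-]; rewrite setTI; apply: sub_sigma_algebra.
by apply: open_comp => // ? _; exact: cf.
Qed.

Lemma measurable_dual u : measurable_fun setT (u : borel E -> R).
Proof. by apply: continuous_borel_measurable; exact: dual_continuous. Qed.

Lemma measurable_norm_borel : measurable_fun setT ((fun x : E => `|x|) : borel E -> R).
Proof. by apply: continuous_borel_measurable; exact: norm_continuous. Qed.

End dual_facts.

(** * The norm of a Gaussian vector *)

Lemma integral_prob_cst d (T : measurableType d) (R : realType)
  (P : probability T R) (c : R) : (\int[P]_x c%:E = c%:E)%E.
Proof.
rewrite (integral_cst P measurableT) -[RHS]mule1; congr (_ * _)%E.
exact: probability_setT.
Qed.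

Section jensen.
Context d (T : measurableType d) (R : realType) (P : probability T R).
Variables (g : T -> R) (m : R).
Hypothesis mg : measurable_fun setT g.
Hypothesis g0 : forall x, 0 <= g x.
Hypothesis gm : (\int[P]_x (g x)%:E = m%:E)%E.

Let m0 : 0 <= m.
Proof. by rewrite -lee_fin -gm; apply: integral_ge0 => x _; rewrite lee_fin. Qed.

Let mE c : measurable_fun setT (fun x => (expR (c * g x))%:E).
Proof.
exact: measurable_expRM.
Qed.

Let mgE : measurable_fun setT (fun x => (g x)%:E).
Proof. exact/measurable_EFinP. Qed.

Let int_affine a b : 0 <= a -> 0 <= b ->
  (\int[P]_x (a%:E + b%:E * (g x)%:E) = (a + b * m)%:E)%E.
Proof.
move=> a0 b0; rewrite ge0_integralD//; last 2 first.
- by move=> x _; rewrite mule_ge0 ?lee_fin.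
- exact: measurable_funeM.
rewrite ge0_integralZl// ?lee_fin//; last by move=> x _; rewrite lee_fin.
by rewrite gm integral_prob_cst.
Qed.

(** The tangent of the exponential at [c * m]. Its linear part is split according to
    the sign of [c], because the moment on the right may be infinite. *)
Lemma expR_jensen c : ((expR (c * m))%:E <= \int[P]_x (expR (c * g x))%:E)%E.
Proof.
set e := expR (c * m); have e0 : 0 <= e := expR_ge0 _.
pose p := Num.max c 0; pose q := Num.max (- c) 0.
have p0 : 0 <= p by rewrite le_max lexx orbT.
have q0 : 0 <= q by rewrite le_max lexx orbT.
have cE : c = p - q by rewrite /p /q; have [?|?] := leP c 0; have [?|?] := leP (- c) 0; lra.
have ep0 : 0 <= e * p by rewrite mulr_ge0.
have eq0 : 0 <= e * q by rewrite mulr_ge0.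
have pm0 : 0 <= e * p * m by rewrite mulr_ge0.
have qm0 : 0 <= e + e * q * m by rewrite addr_ge0// mulr_ge0.
have aff0 a b x : 0 <= a -> 0 <= b -> (0 <= a%:E + b%:E * (g x)%:E)%E.
  by move=> a0 b0; rewrite adde_ge0// mule_ge0// lee_fin.
have maff a b : measurable_fun setT (fun x => a%:E + b%:E * (g x)%:E)%E.
  by apply: emeasurable_funD; [exact: measurable_cst|exact: measurable_funeM].
have : (\int[P]_x ((e + e * q * m)%:E + (e * p)%:E * (g x)%:E) <=
  \int[P]_x ((expR (c * g x))%:E + ((e * p * m)%:E + (e * q)%:E * (g x)%:E)))%E.
  apply: ge0_le_integral => //.
  - by move=> x _; exact: aff0.
  - exact: emeasurable_funD.
  - move=> x _; rewrite -!EFinM -!EFinD lee_fin.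
    have := ler_wpM2l e0 (expR_ge1Dx (c * g x - c * m)).
    rewrite /e -[X in _ <= X]expRD subrKC -/e {1 2}cE; set E := expR (c * g x).
    by lra.
rewrite int_affine// ge0_integralD//; last by move=> x _; exact: aff0.
rewrite int_affine// -addrA [e * q * m + _]addrC EFinD.
by rewrite leeD2rE.
Qed.

End jensen.

(** The product form of the concentration bound turns a lower bound on one
    exponential moment into an upper bound on the other. *)
Lemma ereal_sqr_cancel (R : realType) (A B : \bar R) (b r : R) :
  (0 <= A)%E -> 0 < b -> 0 <= r -> (b%:E <= B)%E ->
  ((A * B) * (A * B) <= (r ^+ 2)%:E)%E -> (A <= (r / b)%:E)%E.
Proof.
move=> A0 b0 r0 bB H.
have B0 : (0 <= B)%E by apply: le_trans bB; rewrite lee_fin ltW.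
have Ab0 : (0 <= A * b%:E)%E by rewrite mule_ge0// lee_fin ltW.
have {}H : (A * b%:E * (A * b%:E) <= (r ^+ 2)%:E)%E.
  by apply: le_trans H; apply: lee_pmul => //; apply: lee_wpmul2l.
case: A A0 Ab0 H => [a| |]//; last first.
  by move=> _ _; rewrite gt0_mulye ?lte_fin// mulyy leye_eq.
move=> a0 ab0; rewrite -!EFinM -expr2 !lee_fin => H.
rewrite ler_pdivlMr//.
by rewrite -(@ler_pXn2r _ 2)// nnegrE// mulr_ge0// ?ltW// -lee_fin.
Qed.

Section gaussian_vector.
Context d (Omega : measurableType d) (R : realType) (P : probability Omega R).
Context (E : normedModType R) (G : {RV P >-> borel E}).
Hypothesis gG : centered_gaussian_vector G.

Definition contraction (u : dual E) := forall x, `|u x| <= `|x|.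

Lemma measurable_dual_vector (u : dual E) : measurable_fun setT (fun w => u (G w)).
Proof. exact: (measurableT_comp (measurable_dual u) (measurable_funPT G)). Qed.

Lemma measurable_norm_vector : measurable_fun setT (fun w => `|(G w : E)|).
Proof. exact: (measurableT_comp (@measurable_norm_borel R E) (measurable_funPT G)). Qed.

Lemma dual_is_gaussian (u : dual E) : exists v, is_gaussian P (fun w => u (G w)) v.
Proof.
exact: centered_gaussian_is_gaussian (measurable_dual_vector u) (gG u).
Qed.

Lemma dual_gaussian_family (I : finType) (u : I -> dual E) :
  gaussian_family P (fun i w => u i (G w)).
Proof.
split=> [i|xi]; first exact: measurable_dual_vector.
have [w hw] := dual_lincomb xi u; have [v gv] := dual_is_gaussian w.
by exists v; under eq_fun do rewrite -hw.
Qed.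

Lemma norm_vector_tight : exists2 K : R, 0 < K & ((2^-1)%:E <= P [set w | (`|(G w : E)| <= K)%R])%E.
Proof.
pose F (n : nat) := [set w | `|(G w : E)| <= n%:R].
have mF n : measurable (F n).
  exact: measurable_sublevel measurable_norm_vector _.
have UF : \bigcup_n F n = setT.
  apply/seteqP; split => // w _; exists (Num.truncn `|(G w : E)|).+1 => //=.
  exact/ltW/truncnS_gt.
have := @nondecreasing_cvg_mu _ _ _ P F mF.
rewrite UF => /(_ measurableT) cv.
have {}cv : (P \o F) n @[n --> \oo] --> 1%E.
  rewrite -[X in _ --> X](probability_setT P); apply: cv => m n mn.
  by apply/subsetPset => w /= /le_trans; apply; rewrite ler_nat.
have [n hn] : exists n, ((2^-1)%:E <= P (F n))%E.
  apply: contrapT => /forallNP H.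
  have : (limn (P \o F) <= (2^-1 : R)%:E)%E.
    apply: lime_le; first by apply/cvg_ex; exists 1%E.
    by apply: nearW => n; have /negP := H n; rewrite -ltNge => /ltW.
  by rewrite (cvg_lim _ cv)// lee_fin; lra.
exists n.+1%:R => //; apply: (le_trans hn); apply: le_measure; rewrite ?inE//.
  exact: (mF n.+1).
by move=> w /= /le_trans; apply; rewrite ler_nat.
Qed.

(** The norm is at most some [K] with probability at least 1/2, hence so is every
    contraction, and a Gaussian law with this property has a bounded variance. *)
Lemma contraction_variance_bounded : exists2 V : R, 0 <= V &
  forall u v, contraction u -> is_gaussian P (fun w => u (G w)) v -> v <= V.
Proof.
have [K K0 PK] := norm_vector_tight.
exists (2 * expR 1 ^+ 2 * K ^+ 2); first by rewrite !mulr_ge0 ?expR_ge0 ?(ltW K0).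
move=> u v cu gv; apply: (is_gaussian_small_ball gv K0).
apply: (le_trans PK); apply: le_measure; rewrite ?inE.
- exact: measurable_sublevel measurable_norm_vector _.
- apply: measurable_sublevel; apply: measurableT_comp => //.
  exact: measurable_dual_vector.
- by move=> w /=; apply: le_trans (cu _).
Qed.

End gaussian_vector.

Section gaussian_norm.
Context d (Omega : measurableType d) (R : realType) (P : probability Omega R).
Context (E : normedModType R) (G : {RV P >-> borel E}).
Hypothesis gG : centered_gaussian_vector G.
Variables (u_ : nat -> dual E) (V : R).
Hypothesis u_le : forall i, contraction (u_ i).
Hypothesis u_norming : forall x c, (forall i, `|u_ i x| <= c) -> `|x| <= c.
Hypothesis V0 : 0 <= V.
Hypothesis variance_le : forall u v, contraction u ->
  is_gaussian P (fun w => u (G w)) v -> v <= V.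

Let nu i w := `|u_ i (G w)|.

Let mnu i : measurable_fun setT (nu i).
Proof. by apply: measurableT_comp => //; exact: measurable_dual_vector. Qed.

Let nu_le n w : nu n w <= `|(G w : E)|. Proof. exact: u_le. Qed.

Let nu_norming w c : (forall n, nu n w <= c) -> `|(G w : E)| <= c.
Proof. exact: u_norming. Qed.

Let X n (i : 'I_n) w := u_ i (G w).

(** The expansion of a linear form has the remainder [(1 - cos dl) * a * x j],
    which is of second order in [sin dl]. *)
Let expandable_coord n (a : R) (j : 'I_n) : `|a| = 1 ->
  expandable P (@X n) (fun=> V) 1 (fun x => a * x j).
Proof.
move=> a1 x; exists (fun i => if i == j then a else 0).
have sumE (z : 'I_n -> R) : \sum_i (if i == j then a else 0) * z i = a * z j.
  rewrite (bigD1 j)//= eqxx big1 ?addr0// => i /negPf ->.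
  by rewrite mul0r.
split => [v|y dl dl01].
  have [w hw] := dual_lincomb (fun i : 'I_n => if i == j then a else 0) (fun i => u_ i).
  rewrite (_ : (fun w => _) = (fun om => w (G om))); last first.
    by apply/funext => om; rewrite hw.
  apply: variance_le => z; rewrite hw (sumE (fun i => u_ i z)) normrM a1 mul1r.
  exact: u_le.
rewrite sumE.
have [/andP[c0 c1] _] := cos_onem_le dl01.
rewrite (_ : _ - _ = sin dl * (a * y j) + (1 - cos dl) * (a * x j)); last by ring.
rewrite lerD2l mul1r.
have xq : x j ^+ 2 <= \sum_i x i ^+ 2.
  by rewrite (bigD1 j)//= lerDl sumr_ge0// => i _; exact: sqr_ge0.
have yq : 0 <= \sum_i y i ^+ 2 by rewrite sumr_ge0// => i _; exact: sqr_ge0.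
have axj : a * x j <= 1 + x j ^+ 2.
  rewrite (le_trans (ler_norm _))// normrM a1 mul1r.
  by rewrite -[x j ^+ 2]real_normK ?num_real//; have := normr_ge0 (x j); nra.
apply: (@le_trans _ _ ((1 - cos dl) * (1 + x j ^+ 2))); first by rewrite ler_wpM2l.
apply: ler_pM => //; first by rewrite addr_ge0// sqr_ge0.
lra.
Qed.

Let norm_running l n : 0 <= l ->
  ((\int[P]_w (expR (l * running_max nu n w))%:E *
    \int[P]_w (expR (- l * running_max nu n w))%:E) *
   (\int[P]_w (expR (l * running_max nu n w))%:E *
    \int[P]_w (expR (- l * running_max nu n w))%:E) <= (expR (4 * l ^+ 2 * V) ^+ 2)%:E)%E.
Proof.
move=> l0.
pose F (x : 'I_n -> R) := \big[Num.max/0]_j `|x j|.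
have mF : measurable_fun setT (F : vec R 'I_n -> R).
  apply: measurable_bigmax => j; apply: measurableT_comp => //.
  exact: measurable_vec_coord.
have eF : expandable P (@X n) (fun=> V) 1 F.
  apply: (expandable_bigmax (F := fun j x => `|x j|)) => // j.
  apply: (expandable_norm (F := fun x => x j)).
    have := @expandable_coord n 1 j (normr1 _).
    by rewrite (_ : (fun x => 1 * x j) = (fun x => x j))//; apply/funext => x; rewrite mul1r.
  have := @expandable_coord n (-1) j; rewrite normrN1 => /(_ erefl).
  by rewrite (_ : (fun x => -1 * x j) = (fun x => - x j))//; apply/funext => x; rewrite mulN1r.
have gX : gaussian_family P (@X n) by exact: dual_gaussian_family.
have := rotation_concentration gX mF (measurable_cst V) ler01 eF l0.
move=> /le_trans; apply.
have -> : (\int[P]_w (expR (8 * l ^+ 2 * cst V ((@X n) ^~ w)))%:E =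
    (expR (8 * l ^+ 2 * V))%:E)%E by rewrite /cst; exact: integral_prob_cst.
by rewrite lee_fin [leRHS]expr2 -expRD; apply: eqW; congr expR; ring.
Qed.

Let g0 (w : Omega) : 0 <= `|(G w : E)|. Proof. exact: normr_ge0. Qed.

Let mg : measurable_fun setT (fun w => `|(G w : E)|).
Proof. exact: measurable_norm_vector. Qed.

Let mgE c : measurable_fun setT (fun w => (expR (c * `|(G w : E)|))%:E).
Proof.
exact: measurable_expRM.
Qed.

Let norm_expR_gen l b : 0 <= l -> 0 < b ->
  (b%:E <= \int[P]_w (expR (- l * `|(G w : E)|))%:E)%E ->
  (\int[P]_w (expR (l * `|(G w : E)|))%:E <= (expR (4 * l ^+ 2 * V) / b)%:E)%E.
Proof.
move=> l0 b0 hb.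
apply: (expR_running_max_le mnu nu_le nu_norming g0 l0) => n.
apply: (ereal_sqr_cancel _ b0 (expR_ge0 _) _ (norm_running n l0)).
  by apply: integral_ge0 => w _; rewrite lee_fin expR_ge0.
apply: (le_trans hb); apply: ge0_le_integral => //.
  by apply: measurable_expRM; exact: measurable_running_max.
move=> w _; rewrite lee_fin ler_expR !mulNr lerN2 ler_wpM2l//.
exact: (running_max_le nu_le g0).
Qed.

(** Tightness bounds [E exp(-l |G|)] from below, which is all that integrability
    needs. *)
Lemma norm_vector_expR_lty l : 0 <= l ->
  (\int[P]_w (expR (l * `|(G w : E)|))%:E < +oo)%E.
Proof.
move=> l0; have [K K0 PK] := norm_vector_tight G.
have b0 : 0 < 2^-1 * expR (- l * K) by rewrite mulr_gt0 ?invr_gt0 ?expR_gt0.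
apply: (le_lt_trans (norm_expR_gen l0 b0 _)); last exact: ltry.
have mA : measurable [set w | `|(G w : E)| <= K].
  exact: measurable_sublevel mg _.
apply: (@le_trans _ _ (\int[P]_w ((expR (- l * K))%:E * (\1_[set w | `|(G w : E)| <= K] w)%:E))%E).
  rewrite ge0_integralZl//; last first.
    by apply/measurable_EFinP; exact: measurable_indic.
  rewrite integral_indic// setIT EFinM muleC.
  by apply: lee_wpmul2l => //; rewrite lee_fin expR_ge0.
apply: ge0_le_integral => //.
- apply: measurable_funeM; apply/measurable_EFinP; exact: measurable_indic.
- move=> w _; rewrite -EFinM lee_fin indicE.
  case: (boolP (w \in _)) => [|_]; last by rewrite mulr0 expR_ge0.
  by rewrite inE/= mulr1 ler_expR !mulNr lerN2 => ?; rewrite ler_wpM2l.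
Qed.

Lemma norm_vector_integrable :
  (\int[P]_w (`|(G w : E)|)%:E = (fine (\int[P]_w (`|(G w : E)|)%:E))%:E)%E.
Proof.
rewrite fineK// ge0_fin_numE; last by apply: integral_ge0 => w _; rewrite lee_fin.
apply: le_lt_trans (norm_vector_expR_lty ler01).
apply: ge0_le_integral => //; first exact/measurable_EFinP.
move=> w _; rewrite lee_fin mul1r; apply: le_trans (expR_ge1Dx _).
by rewrite lerDr.
Qed.

(** Jensen's inequality provides the lower bound [exp(-l m)] on [E exp(-l |G|)]. *)
Lemma norm_vector_subgaussian l (m := fine (\int[P]_w (`|(G w : E)|)%:E)%E) : 0 <= l ->
  (\int[P]_w (expR (l * `|(G w : E)|))%:E <= (expR (l * m + 4 * l ^+ 2 * V))%:E)%E.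
Proof.
move=> l0.
have := norm_expR_gen l0 (expR_gt0 (- l * m)) (expR_jensen mg g0 norm_vector_integrable (- l)).
by rewrite -expRN -expRD mulNr opprK addrC.
Qed.

End gaussian_norm.

(** * Bochner expectations *)

Section bochner.
Context d (Omega : measurableType d) (R : realType) (P : probability Omega R).
Context (E : completeNormedModType R).
Hypothesis sepE : separable E.
Implicit Types (f s : Omega -> E) (v : dual E).

Let measurable_dual_comp f v : measurable_fun setT (f : Omega -> borel E) ->
  measurable_fun setT (fun w => v (f w)).
Proof. exact: (measurableT_comp (measurable_dual v)). Qed.

(** In a separable space the norm is a countable supremum of functionals, which
    makes the norm of a difference of measurable maps measurable. *)
Lemma measurable_norm_sub f g : measurable_fun setT (f : Omega -> borel E) ->
  measurable_fun setT (g : Omega -> borel E) ->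
  measurable_fun setT (fun w => `|f w - g w|).
Proof.
move=> mf mg; have [u_ [ule unorm]] := norming_sequence sepE.
apply: (@measurable_countable_supremum _ _ _ (fun i w => `|u_ i (f w) - u_ i (g w)|)).
- move=> i; apply: measurableT_comp => //.
  by apply: measurable_funB; exact: measurable_dual_comp.
- by move=> i w; rewrite -linearB; exact: ule.
- move=> w c h; apply: unorm => i; rewrite linearB; exact: h.
- by move=> w.
Qed.

Lemma simple_expectation_dual s v : simple s ->
  (\int[P]_w (v (s w))%:E = (v (simple_expectation P s))%:E)%E.
Proof.
move=> [ms fs].
rewrite /simple_expectation fsbig_finite//=.
rewrite linear_sum/=.
have mp y : measurable (s @^-1` [set y]).
  rewrite -[X in measurable X]setTI; apply: ms => //.
  rewrite -[X in measurable X]setCK; apply: measurableC.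
  apply: sub_sigma_algebra; apply: closed_openC.
  exact: (accessible_closed_set1 (hausdorff_accessible (@norm_hausdorff R E))).
transitivity (\int[P]_w (\sum_(y <- finmap.enum_fset (fset_set (range s)))
    ((v y)%:E * (\1_(s @^-1` [set y]) w)%:E)))%E.
  apply: eq_integral => w _.
  rewrite (bigD1_seq (s w)) ?finmap.fset_uniq//=; last first.
    by rewrite in_fset_set// inE; exists w.
  rewrite indicE mem_set// mule1 big1 ?adde0// => y ys.
  by rewrite indicE memNset ?mule0//= => ysw; rewrite ysw eqxx in ys.
rewrite integral_sum//; last first.
  by move=> y; apply: integrableZl => //; exact: integrable_indic.
rewrite -sumEFin; apply: eq_bigr => y _.
rewrite integralZl//; last by exact: integrable_indic.
rewrite integral_indic// setIT linearZ/= /GRing.scale/= EFinM muleC; congr (_ * _)%E.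
by rewrite fineK// fin_num_measure.
Qed.

Let integrable_dual f v : measurable_fun setT (f : Omega -> borel E) ->
  contraction v -> (\int[P]_w (`|f w|)%:E < +oo)%E ->
  P.-integrable setT (fun w => (v (f w))%:E).
Proof.
move=> mf cv fi; apply/integrableP; split.
  by apply/measurable_EFinP; exact: measurable_dual_comp.
apply: le_lt_trans fi; apply: ge0_le_integral => //.
- apply: measurableT_comp => //.
  by apply/measurable_EFinP; exact: measurable_dual_comp.
- by apply/measurable_EFinP; exact: (measurableT_comp (@measurable_norm_borel R E)).
- by move=> w _ /=; rewrite lee_fin.
Qed.

Let simple_integrable s : simple s -> (\int[P]_w (`|s w|)%:E < +oo)%E.
Proof.
move=> [ms fs].
have mn : measurable_fun setT (fun w => `|s w|).
  exact: (measurableT_comp (@measurable_norm_borel R E)).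
have : P.-integrable setT (EFin \o (fun w => `|s w|)).
  apply: measurable_bounded_integrable => //; first exact: fin_num_fun_lty.
  pose M := \sum_(y <- finmap.enum_fset (fset_set (range s))) `|y|.
  exists M; split; first exact: num_real.
  move=> N MN w _ /=; rewrite normr_id (le_trans _ (ltW MN))//.
  rewrite /M (bigD1_seq (s w)) ?finmap.fset_uniq//=; last first.
    by rewrite in_fset_set// inE; exists w.
  by rewrite lerDl sumr_ge0.
by move=> /integrableP[_]; under eq_integral do rewrite /= normr_id.
Qed.

Let simple_dist f s v : measurable_fun setT (f : Omega -> borel E) ->
  contraction v -> (\int[P]_w (`|f w|)%:E < +oo)%E -> simple s ->
  ((`|v (simple_expectation P s) - fine (\int[P]_w (v (f w))%:E)|)%:E <=
    \int[P]_w (`|f w - s w|)%:E)%E.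
Proof.
move=> mf cv fi ss; have [ms _] := ss.
have i1 := integrable_dual ms cv (simple_integrable ss).
have i2 := integrable_dual mf cv fi.
have -> : (`|v (simple_expectation P s) - fine (\int[P]_w (v (f w))%:E)|%:E =
    `|\int[P]_w ((v (s w))%:E - (v (f w))%:E)|)%E.
  rewrite integralB//= (simple_expectation_dual v ss).
  have I2 : (\int[P]_w (v (f w))%:E)%E \is a fin_num.
    exact: (integrable_fin_num measurableT i2).
  by rewrite -[in RHS](fineK I2).
apply: (le_trans (le_abse_integral P measurableT _)).
  by case/integrableP : (integrableB measurableT i1 i2).
apply: ge0_le_integral => //.
- apply: measurableT_comp => //.
  by case/integrableP : (integrableB measurableT i1 i2).
- by apply/measurable_EFinP; exact: measurable_norm_sub.
- move=> w _; rewrite -EFinB/= lee_fin -linearB distrC.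
  exact: cv.
Qed.

(** Functionals commute with simple expectations; both sides are the limit along the
    approximating simple functions. *)
Lemma bochner_expectation_dual f y v : measurable_fun setT (f : Omega -> borel E) ->
  (\int[P]_w (`|f w|)%:E < +oo)%E -> is_bochner_expectation P f y ->
  contraction v -> v y = fine (\int[P]_w (v (f w))%:E)%E.
Proof.
move=> mf fi [_ [s [ss fs sy]]] cv.
set I := fine _.
have h1 : v (simple_expectation P (s k)) @[k --> \oo] --> v y.
  exact: (cvg_comp _ _ sy (@dual_continuous _ _ v y)).
have h2 : v (simple_expectation P (s k)) @[k --> \oo] --> I.
  apply/(@cvgrPdist_lt _ R^o) => e e0.
  have : \forall k \near \oo, (\int[P]_w (`|f w - s k w|)%:E < e%:E)%E.
    have /fine_cvgP[ffin fcv] := fs.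
    move/(@cvgrPdist_lt _ R^o) : fcv => /(_ e e0) fcv.
    near=> k.
    have kfin : (\int[P]_w (`|f w - s k w|)%:E)%E \is a fin_num by near: k.
    have : `|0 - fine (\int[P]_w (`|f w - s k w|)%:E)%E| < e by near: k.
    rewrite sub0r normrN => h; rewrite -(fineK kfin) lte_fin.
    exact: le_lt_trans (ler_norm _) h.
  apply: filterS => k hk; rewrite distrC -lte_fin.
  exact: le_lt_trans (simple_dist mf cv fi (ss k)) hk.
exact: (cvg_unique _ h1 h2).
Unshelve. all: by end_near. Qed.

(** Approximation by nearest points in a countable dense set. *)
Lemma bochner_expectation_exists f : measurable_fun setT (f : Omega -> borel E) ->
  (\int[P]_w (`|f w|)%:E < +oo)%E -> exists y, is_bochner_expectation P f y.
Proof.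
move=> mf fi.
have [D Dc Dd] := sepE.
have [z zD] : exists z : nat -> E, D `<=` range z.
  have /pfcard_geP[->|[g]] := Dc; first by exists (fun=> 0).
  by exists g => x Dx; have [n _ <-] := 'surj_g Dx; exists n.
(* s k w is a point nearest to f w among 0, z 0, ..., z (k-1) *)
pose s := fix s k w := if k is k'.+1 then
  if `|f w - z k'| < `|f w - s k' w| then z k' else s k' w else 0 : E.
have ss k : simple (s k).
  elim: k => [|k [ms fs]].
    split; first exact: measurable_cst.
    apply: (@sub_finite_set _ _ [set 0]); last exact: finite_set1.
    by move=> _ [w _ <-].
  split.
    rewrite (_ : s k.+1 = (fun w => if `|f w - z k| < `|f w - s k w| then z k else s k w))//.
    apply: measurable_fun_ifT => //.
      apply: measurable_fun_ltr; first exact: measurable_norm_sub.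
      exact: measurable_norm_sub.
  apply: (@sub_finite_set _ _ (range (s k) `|` [set z k])).
    by move=> _ [w _ <-] /=; case: ifP => _; [right|left; exists w].
  by rewrite finite_setU; split => //; exact: finite_set1.
have s_nd w : nonincreasing_seq (fun k => `|f w - s k w|).
  apply/nonincreasing_seqP => k /=.
  by case: ifPn => // /ltW.
have s_f k w : `|f w - s k w| <= `|f w|.
  by apply: (le_trans (s_nd w _ _ (leq0n k))); rewrite /= subr0.
have s_cvg w : `|f w - s k w| @[k --> \oo] --> (0 : R).
  apply/(@cvgrPdist_lt _ R^o) => e e0.
  have [y [fy Dy]] : (ball (f w) e `&` D) !=set0.
    by apply: Dd; [exists (f w); exact: ballxx|exact: ball_open].
  have [n _ ny] := zD _ Dy.
  move: fy; rewrite -ball_normE/= -ny => fz.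
  exists n.+1 => // k /= nk.
  rewrite sub0r normrN normr_id.
  apply: (le_lt_trans (s_nd w _ _ nk)) => /=.
  by case: ifPn => [//|]; rewrite -leNgt => /le_lt_trans; apply.
have fsk : (\int[P]_w (`|f w - s k w|)%:E @[k --> \oo] --> 0)%E.
  have mfn : measurable_fun setT (fun w => (`|f w|)%:E).
    by apply/measurable_EFinP; exact: (measurableT_comp (@measurable_norm_borel R E)).
  have [|||||_ _] := @dominated_convergence _ Omega R P setT measurableT
      (fun k w => (`|f w - s k w|)%:E) (fun=> 0%E) (fun w => (`|f w|)%:E).
  - move=> k; apply/measurable_EFinP; apply: measurable_norm_sub => //.
    by have [] := ss k.
  - exact: measurable_cst.
  - by apply: aeW => w _; apply: cvg_EFin; [exact: nearW|exact: s_cvg].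
  - apply/integrableP; split => //.
    by under eq_integral do rewrite /= normr_id.
  - by apply: aeW => w k _ /=; rewrite normr_id lee_fin.
  - by rewrite integral0.
have efin k : (\int[P]_w (`|f w - s k w|)%:E)%E \is a fin_num.
  rewrite ge0_fin_numE; last by apply: integral_ge0 => w _; rewrite lee_fin.
  apply: le_lt_trans fi; apply: ge0_le_integral => //.
  - apply/measurable_EFinP; apply: measurable_norm_sub => //.
    by have [] := ss k.
  - by apply/measurable_EFinP; exact: (measurableT_comp (@measurable_norm_borel R E)).
  - by move=> w _; rewrite lee_fin.
pose e k := fine (\int[P]_w (`|f w - s k w|)%:E)%E.
have e_cvg : e k @[k --> \oo] --> (0 : R).
  by have /fine_cvgP[_] := fsk.
have dist k l : `|simple_expectation P (s k) - simple_expectation P (s l)| <= e k + e l.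
  have [v [cv <-]] := norming_functional (simple_expectation P (s k) - simple_expectation P (s l)).
  have h j : `|v (simple_expectation P (s j)) - fine (\int[P]_w (v (f w))%:E)%E| <= e j.
    by rewrite -lee_fin /e fineK//; exact: simple_dist.
  have := h k; have := h l; rewrite linearB/= !ler_norml => /andP[? ?] /andP[? ?].
  by lra.
have cvs : cvg (simple_expectation P (s k) @[k --> \oo]).
  apply: cauchy_cvg; apply/cauchy_exP => eps eps0.
  have e2 : 0 < eps / 2 by rewrite divr_gt0.
  move/(@cvgrPdist_lt _ R^o) : e_cvg => /(_ _ e2)[N _ HN].
  have eN k : (N <= k)%N -> e k < eps / 2.
    by move=> Nk; have := HN k Nk; rewrite sub0r normrN; apply: le_lt_trans; exact: ler_norm.
  exists (simple_expectation P (s N)); exists N => // k /= Nk.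
  rewrite -ball_normE/=; apply: (le_lt_trans (dist _ _)).
  by have := eN N (leqnn N); have := eN k Nk; lra.
have /cvg_ex[y sy] := cvs.
by exists y; split => //; exists s; split.
Qed.

End bochner.

Section covariance.
Context d (Omega : measurableType d) (R : realType) (P : probability Omega R).
Context (E : completeNormedModType R) (G : {RV P >-> borel E}).
Hypothesis sepE : separable E.
Hypothesis gG : centered_gaussian_vector G.

Lemma norm_vector_sqr_lty : (\int[P]_w (`|(G w : E)| ^+ 2)%:E < +oo)%E.
Proof.
have [u_ [ule unorm]] := norming_sequence sepE.
have [V V0 hV] := contraction_variance_bounded G.
have mg := measurable_norm_vector G.
have h := norm_vector_expR_lty gG ule unorm V0 hV ler01.
apply: (@le_lt_trans _ _ (4%:E * \int[P]_w (expR (1 * `|(G w : E)|))%:E)%E); last first.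
  by rewrite lte_mul_pinfty.
have me : measurable_fun setT (fun w => (expR (1 * `|(G w : E)|))%:E).
  exact: measurable_expRM.
rewrite -ge0_integralZl//; apply: ge0_le_integral => //.
- by apply/measurable_EFinP; exact: measurable_funX.
- exact: measurable_funeM.
- move=> w _; rewrite -EFinM lee_fin mul1r.
  set y := `|_|; have y0 : 0 <= y by exact: normr_ge0.
  have -> : expR y = expR (y / 2) ^+ 2 by rewrite expr2 -expRD -splitr.
  have := expR_ge1Dx (y / 2) => h2.
  have : (1 + y / 2) ^+ 2 <= expR (y / 2) ^+ 2.
    by rewrite lerXn2r// nnegrE ?expR_ge0// addr_ge0// divr_ge0.
  by nra.
Qed.

Lemma covariance_op_dual (u v : dual E) : contraction v ->
  v (covariance_op P G u) = fine (\int[P]_w (u (G w) * v (G w))%:E)%E.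
Proof.
move=> cv.
pose f (w : Omega) : E := u (G w) *: (G w : E).
have mf : measurable_fun setT (f : Omega -> borel E).
  have cphi : continuous (fun x : E => (u x : R) *: x).
    by move=> x; apply: cvgZ; [exact: dual_continuous|exact: cvg_id].
  exact: (measurableT_comp (continuous_borel_measurable_self cphi) (measurable_funPT G)).
have fi : (\int[P]_w (`|f w|)%:E < +oo)%E.
  have [M M0 uM] := dual_le u.
  apply: (@le_lt_trans _ _ (M%:E * \int[P]_w (`|(G w : E)| ^+ 2)%:E)%E); last first.
    by rewrite lte_mul_pinfty ?lee_fin ?ltW// norm_vector_sqr_lty.
  have mg := measurable_norm_vector G.
  have mg2 : measurable_fun setT (fun w => (`|(G w : E)| ^+ 2)%:E).
    by apply/measurable_EFinP; exact: measurable_funX.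
  rewrite -ge0_integralZl//; last by rewrite lee_fin ltW.
  apply: ge0_le_integral => //.
  - by apply/measurable_EFinP; exact: (measurableT_comp (@measurable_norm_borel R E)).
  - exact: measurable_funeM.
  - move=> w _; rewrite -EFinM lee_fin /f normrZ expr2 mulrA.
    by rewrite ler_wpM2r.
have [y0 hy0] := bochner_expectation_exists sepE mf fi.
have hy : is_bochner_expectation P f (covariance_op P G u).
  exact: (@xgetPex _ 0 [set y | is_bochner_expectation P f y] (ex_intro _ y0 hy0)).
rewrite (bochner_expectation_dual sepE mf fi hy cv); congr fine.
by apply: eq_integral => w _; rewrite /f linearZ.
Qed.

End covariance.

(** * Operator norms as countable suprema *)

Section covariance_norm.
Context d (Omega : measurableType d) (R : realType) (P : probability Omega R).
Context (E : completeNormedModType R) (G : {RV P >-> borel E}).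
Hypothesis sepE : separable E.
Hypothesis gG : centered_gaussian_vector G.
Local Notation Sigma := (covariance_op P G).

Definition cov (u v : dual E) : R := fine (\int[P]_w (u (G w) * v (G w))%:E)%E.

Lemma cov_sym u v : cov u v = cov v u.
Proof. by rewrite /cov; congr fine; apply: eq_integral => w _; rewrite mulrC. Qed.

Lemma dual_covariance_op (u v : dual E) : contraction v -> v (Sigma u) = cov u v.
Proof. exact: covariance_op_dual. Qed.

Lemma cov_variance (u : dual E) v : is_gaussian P (fun w => u (G w)) v -> cov u u = v.
Proof.
move=> gv; rewrite /cov (eq_integral (fun w => (u (G w) ^+ 2)%:E)).
  by rewrite (is_gaussian_sqr gv).
by move=> w _; rewrite expr2.
Qed.

Let int_norm_mul_le (u u' : dual E) v v' : is_gaussian P (fun w => u (G w)) v ->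
  is_gaussian P (fun w => u' (G w)) v' ->
  (\int[P]_w (`|u (G w) * u' (G w)|)%:E <= ((v + v') / 2)%:E)%E.
Proof.
move=> gv gv'.
have mu := measurable_dual_vector G u; have mu' := measurable_dual_vector G u'.
have mf2 (f : Omega -> R) : measurable_fun setT f -> measurable_fun setT (fun w => (2^-1 * f w ^+ 2)%:E).
  by move=> mf; apply/measurable_EFinP; apply: measurable_funM => //; exact: measurable_funX.
have half f a : is_gaussian P f a -> (\int[P]_w (2^-1 * f w ^+ 2)%:E = (a / 2)%:E)%E.
  move=> gf; have [mf _ _] := gf.
  under eq_integral do rewrite EFinM.
  rewrite ge0_integralZl//; last 2 first.
  - by apply/measurable_EFinP; exact: measurable_funX.
  - by move=> w _; rewrite lee_fin sqr_ge0.
  by rewrite (is_gaussian_sqr gf) -EFinM mulrC.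
apply: (@le_trans _ _ (\int[P]_w ((2^-1 * u (G w) ^+ 2)%:E + (2^-1 * u' (G w) ^+ 2)%:E))%E).
  apply: ge0_le_integral => //.
  - apply/measurable_EFinP; apply: measurableT_comp => //; exact: measurable_funM.
  - exact: emeasurable_funD (mf2 _ mu) (mf2 _ mu').
  - move=> w _; rewrite -EFinD lee_fin.
    have h1 := sqr_ge0 (u (G w) - u' (G w)); have h2 := sqr_ge0 (u (G w) + u' (G w)).
    by rewrite ler_norml; apply/andP; split; nra.
rewrite ge0_integralD//; last 4 first.
- by move=> w _; rewrite lee_fin mulr_ge0// sqr_ge0.
- exact: mf2.
- by move=> w _; rewrite lee_fin mulr_ge0// sqr_ge0.
- exact: mf2.
by rewrite (half _ _ gv) (half _ _ gv') -EFinD -mulrDl.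
Qed.

Let mul_integrable (u u' : dual E) :
  P.-integrable setT (fun w => (u (G w) * u' (G w))%:E).
Proof.
have [v gv] := dual_is_gaussian gG u; have [v' gv'] := dual_is_gaussian gG u'.
apply/integrableP; split.
  by apply/measurable_EFinP; apply: measurable_funM; exact: measurable_dual_vector.
exact: le_lt_trans (int_norm_mul_le gv gv') (ltry _).
Qed.

Let mul_fin (u u' : dual E) : (\int[P]_w (u (G w) * u' (G w))%:E)%E \is a fin_num.
Proof. exact: (integrable_fin_num measurableT (mul_integrable u u')). Qed.

Lemma cov_le (u u' : dual E) v v' : is_gaussian P (fun w => u (G w)) v ->
  is_gaussian P (fun w => u' (G w)) v' -> `|cov u u'| <= (v + v') / 2.
Proof.
move=> gv gv'; rewrite -lee_fin.
have -> : (`|cov u u'|%:E = `|\int[P]_w (u (G w) * u' (G w))%:E|)%E.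
  by rewrite -[in RHS](fineK (mul_fin u u')).
apply: le_trans (int_norm_mul_le gv gv'); apply: (le_abse_integral P measurableT) => //.
by case/integrableP : (mul_integrable u u').
Qed.

Lemma covZl (u u' v : dual E) c : (forall x, u' x = c * u x) -> cov u' v = c * cov u v.
Proof.
move=> h; rewrite /cov (eq_integral (fun w => c%:E * (u (G w) * v (G w))%:E)%E); last first.
  by move=> w _; rewrite h -EFinM mulrA.
rewrite integralZl//.
by rewrite -(fineK (mul_fin u v)) -EFinM.
Qed.

Let opset := [set `|Sigma u| | u in [set u : dual E | dual_norm u <= 1]].

Lemma unit_dual_contraction (u : dual E) : dual_norm u <= 1 -> contraction u.
Proof. by move=> u1 x; exact: unit_dual_le. Qed.

Lemma covariance_op_le (u : dual E) V : 0 <= V ->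
  (forall u v, contraction u -> is_gaussian P (fun w => u (G w)) v -> v <= V) ->
  contraction u -> `|Sigma u| <= V.
Proof.
move=> V0 hV cu; have [v [cv <-]] := norming_functional (Sigma u).
rewrite dual_covariance_op// (le_trans (ler_norm _))//.
have [a ga] := dual_is_gaussian gG u; have [b gb] := dual_is_gaussian gG v.
rewrite (le_trans (cov_le ga gb))//.
by have := hV _ _ cu ga; have := hV _ _ cv gb; lra.
Qed.

Lemma zero_dual : exists u : dual E, forall x, u x = 0.
Proof.
have [u' _] := norming_functional (0 : E).
have [u hu] := dual_lincomb (fun i : 'I_1 => 0 : R) (fun=> u').
by exists u => x; rewrite hu big1// => i _; rewrite mul0r.
Qed.

Let opset0 : opset !=set0.
Proof.
have [u hu] := zero_dual; exists `|Sigma u|; exists u => //=.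
by apply: contraction_dual_norm => x; rewrite hu normr0.
Qed.

Lemma opnorm_covariance_le V : 0 <= V ->
  (forall u v, contraction u -> is_gaussian P (fun w => u (G w)) v -> v <= V) ->
  opnorm Sigma <= V.
Proof.
move=> V0 hV; apply: ge_sup => // _ [u /= u1 <-].
by apply: covariance_op_le => //; exact: unit_dual_contraction.
Qed.

Let opset_ub : has_ubound opset.
Proof.
have [V V0 hV] := contraction_variance_bounded G.
exists V => _ [u /= u1 <-].
by apply: covariance_op_le => //; exact: unit_dual_contraction.
Qed.

Lemma variance_le_opnorm (u : dual E) v : contraction u ->
  is_gaussian P (fun w => u (G w)) v -> v <= opnorm Sigma.
Proof.
move=> cu gv; rewrite -(cov_variance gv) -dual_covariance_op//.
rewrite (le_trans (ler_norm _))// (le_trans (cu _))//.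
apply: ub_le_sup => //; exists u => //=; exact: contraction_dual_norm.
Qed.

Lemma opnorm_covariance_ge0 : 0 <= opnorm Sigma.
Proof.
have [u hu] := zero_dual; have [v gv] := dual_is_gaussian gG u.
have v0 : 0 <= v by case: gv.
by apply: (le_trans v0); apply: (variance_le_opnorm _ gv) => x; rewrite hu normr0.
Qed.

(** If the norm is 0, all variances vanish, hence all covariances by [cov_le], and
    norming functionals show that [Sigma] is 0. *)
Lemma opnorm_covariance_gt0 : Sigma <> (fun=> 0) -> 0 < opnorm Sigma.
Proof.
move=> Sn0; rewrite lt_neqAle opnorm_covariance_ge0 andbT eq_sym; apply/negP => /eqP s0.
apply: Sn0; apply/funext => u.
have [v [cv vS]] := norming_functional (Sigma u).
have [M M0 uM] := dual_le u.
have [u' hu'] := dual_lincomb (fun i : 'I_1 => M^-1) (fun=> u).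
have u'E x : u' x = M^-1 * u x by rewrite hu' big_ord1.
have cu' : contraction u'.
  move=> x; rewrite u'E normrM normfV (gtr0_norm M0) mulrC ler_pdivrMr//.
  by rewrite mulrC.
apply/eqP; rewrite -normr_eq0 -vS dual_covariance_op//.
have [a ga] := dual_is_gaussian gG u'; have [b gb] := dual_is_gaussian gG v.
have a0 : a = 0.
  by apply/eqP; rewrite eq_le -{1}s0 (variance_le_opnorm cu' ga)/=; case: ga.
have b0 : b = 0.
  by apply/eqP; rewrite eq_le -{1}s0 (variance_le_opnorm cv gb)/=; case: gb.
have := cov_le ga gb; rewrite a0 b0 addr0 mul0r normr_le0 => /eqP c0.
by move: c0; rewrite (covZl _ u'E) => /eqP; rewrite mulf_eq0 invr_eq0 gt_eqF//= => /eqP ->; rewrite normr0.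
Qed.

(** A functional of positive variance, from which independent scalar Gaussians are
    made. *)
Lemma exists_positive_variance : Sigma <> (fun=> 0) -> exists (u : dual E) v,
  0 < v /\ is_gaussian P (fun w => u (G w)) v.
Proof.
move=> Sn0; apply: contrapT => /forallNP H.
have : opnorm Sigma <= 0.
  apply: opnorm_covariance_le => // u v _ gv; rewrite leNgt; apply/negP => v0.
  by have /forallNP/(_ v) := H u; apply.
by rewrite leNgt opnorm_covariance_gt0.
Qed.

Section deviation.
Variables (n : nat) (x : 'I_n -> E).

Let A (u : dual E) : E := sample_covariance_op x u - Sigma u.
Let q (u v : dual E) := n%:R^-1 * (\sum_(k < n) u (x k) * v (x k)) - cov u v.

Let dual_A (u v : dual E) : contraction v -> v (A u) = q u v.
Proof.
move=> cv; rewrite /A linearB dual_covariance_op// linearZ linear_sum /q; congr (_ * _ - _).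
by apply: eq_bigr => k _; rewrite linearZ.
Qed.

Let q_sym u v : q u v = q v u.
Proof.
rewrite /q cov_sym; congr (_ * _ - _); apply: eq_bigr => k _; exact: mulrC.
Qed.

Let A_ub : has_ubound [set `|A u| | u in [set u : dual E | dual_norm u <= 1]].
Proof.
have [V V0 hV] := contraction_variance_bounded G.
exists (n%:R^-1 * (\sum_(k < n) `|x k| ^+ 2) + V) => _ [u /= /unit_dual_contraction cu <-].
rewrite (le_trans (ler_normB _ _))// lerD//; last exact: covariance_op_le.
rewrite /sample_covariance_op normrZ ger0_norm// ler_wpM2l//.
rewrite (le_trans (ler_norm_sum _ _ _))//; apply: ler_sum => k _.
by rewrite normrZ expr2 ler_wpM2r.
Qed.

Lemma deviation_ge (u v : dual E) : contraction u -> contraction v ->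
  `|n%:R^-1 * (\sum_(k < n) u (x k) * v (x k)) - cov u v| <=
  opnorm (sample_covariance_op x \- Sigma).
Proof.
move=> cu cv; rewrite -/(q u v) -dual_A// (le_trans (cv _))//.
by apply: ub_le_sup => //; exists u => //=; exact: contraction_dual_norm.
Qed.

(** Testing on a norming sequence suffices, because the form is symmetric. *)
Lemma deviation_le (u_ : nat -> dual E) c :
  (forall i, contraction (u_ i)) ->
  (forall x c, (forall i, `|u_ i x| <= c) -> `|x| <= c) ->
  (forall i j, `|n%:R^-1 * (\sum_(k < n) u_ i (x k) * u_ j (x k)) - cov (u_ i) (u_ j)| <= c) ->
  opnorm (sample_covariance_op x \- Sigma) <= c.
Proof.
move=> ule unorm hc; apply: ge_sup.
  have [u hu] := zero_dual; exists `|A u|; exists u => //=.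
  by apply: contraction_dual_norm => y; rewrite hu normr0.
move=> _ [u /= /unit_dual_contraction cu <-]; apply: (unorm _ c) => i.
rewrite dual_A// q_sym -dual_A// (le_trans (cu _))//; apply: (unorm _ c) => j.
by rewrite dual_A//; exact: hc.
Qed.

End deviation.

End covariance_norm.

(** * Independent copies *)

Section iid.
Context d (Omega : measurableType d) (R : realType) (P : probability Omega R).
Context (E : normedModType R) (G : {RV P >-> borel E}).
Variables (n : nat) (G_ : 'I_n -> {RV P >-> borel E}).
Hypothesis iidG : iid_copies G_ G.

Lemma copy_is_gaussian k (u : dual E) v :
  is_gaussian P (fun w => u (G w)) v -> is_gaussian P (fun w => u (G_ k w)) v.
Proof.
move=> [mu v0 gu]; split => //; first exact: measurable_dual_vector.
move=> A mA; rewrite -gu//.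
have mB : measurable ((u : borel E -> R) @^-1` A).
  by rewrite -[X in measurable X]setTI; exact: measurable_dual.
exact: iidG.2 k _ mB.
Qed.

Section functions.
Variable phi : 'I_n -> E -> R.
Hypothesis mphi : forall k, measurable_fun setT (phi k : borel E -> R).

(** The sums of independent variables above are indexed by natural numbers, hence
    the extension by 0. *)
Let W (k : nat) (w : Omega) : R := if insub k is Some i then phi i (G_ i w) else 0.

Let W_ord (i : 'I_n) w : W i w = phi i (G_ i w).
Proof. by rewrite /W valK. Qed.

Let mW k : measurable_fun setT (W k).
Proof.
rewrite /W; case: insubP => [i _ _|_]; last exact: measurable_cst.
exact: (measurableT_comp (mphi i) (measurable_funPT (G_ i))).
Qed.

Let indepW (A : nat -> set R) : (forall k, measurable (A k)) ->
  P [set w | forall k, (k < n)%N -> A k (W k w)] =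
  (\prod_(0 <= k < n) P (W k @^-1` A k))%E.
Proof.
move=> mA.
have mB i : measurable ((phi i : borel E -> R) @^-1` A i).
  by rewrite -[X in measurable X]setTI; exact: mphi.
have := iidG.1 [set: 'I_n]%SET (fun i => phi i @^-1` A i) mB.
rewrite big_mkord.
have -> : \bigcap_(i in [set` [set: 'I_n]%SET]) (G_ i @^-1` (phi i @^-1` A i)) =
    [set w | forall k, (k < n)%N -> A k (W k w)].
  apply/seteqP; split => w h.
    move=> k kn; rewrite (W_ord (Ordinal kn)).
    by apply: (h (Ordinal kn)); rewrite /= finset.in_setT.
  move=> i _ /=; rewrite -W_ord; exact: h.
move=> ->; rewrite (eq_bigl xpredT); last by move=> i; rewrite finset.in_setT.
apply: eq_bigr => i _; congr (P _).
by apply/seteqP; split => w /=; rewrite W_ord.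
Qed.

Let sumW w : \sum_(0 <= k < n) W k w = \sum_(i < n) phi i (G_ i w).
Proof. by rewrite big_mkord; apply: eq_bigr => i _; exact: W_ord. Qed.

Lemma iid_expR_sum :
  (\int[P]_w (expR (\sum_(i < n) phi i (G_ i w)))%:E =
   \prod_(i < n) \int[P]_w (expR (phi i (G_ i w)))%:E)%E.
Proof.
have := independent_expR_sum mW indepW.
under eq_integral do rewrite sumW.
move=> ->; rewrite big_mkord; apply: eq_bigr => i _.
by apply: eq_integral => w _; rewrite W_ord.
Qed.

Lemma iid_gaussian_sum_of (v : 'I_n -> R) :
  (forall i, is_gaussian P (fun w => phi i (G_ i w)) (v i)) ->
  is_gaussian P (fun w => \sum_(i < n) phi i (G_ i w)) (\sum_i v i).
Proof.
move=> gv.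
pose v' (k : nat) : R := if insub k is Some i then v i else 0.
have v'_ord (i : 'I_n) : v' i = v i by rewrite /v' valK.
have := @is_gaussian_sum _ _ _ P n W mW indepW v'.
rewrite (_ : (fun w => \sum_(0 <= k < n) W k w) = (fun w => \sum_(i < n) phi i (G_ i w))); last first.
  exact/funext/sumW.
rewrite big_mkord (eq_bigr v) => [|i _]; last exact: v'_ord.
apply => k kn; rewrite (v'_ord (Ordinal kn)).
rewrite (_ : W k = (fun w => phi (Ordinal kn) (G_ (Ordinal kn) w))); first exact: gv.
by apply/funext => w; exact: (W_ord (Ordinal kn)).
Qed.

End functions.

Lemma iid_dual_sum (u : 'I_n -> dual E) (v : 'I_n -> R) :
  (forall i, is_gaussian P (fun w => u i (G w)) (v i)) ->
  is_gaussian P (fun w => \sum_(i < n) u i (G_ i w)) (\sum_i v i).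
Proof.
move=> gv; apply: (@iid_gaussian_sum_of (fun i => u i)) => i.
- exact: measurable_dual.
- exact: copy_is_gaussian.
Qed.

End iid.

(** * Exponential moments of the sample covariance *)

Section sample_moment.
Context d (Omega : measurableType d) (R : realType) (P : probability Omega R).
Context (E : completeNormedModType R) (G : {RV P >-> borel E}).
Hypothesis sepE : separable E.
Hypothesis gG : centered_gaussian_vector G.
Local Notation Sigma := (covariance_op P G).
Hypothesis Sigma0 : Sigma <> (fun=> 0).
Variables (n : nat) (G_ : 'I_n -> {RV P >-> borel E}).
Hypothesis n0 : (1 <= n)%N.
Hypothesis iidG : iid_copies G_ G.
Variable z_ : nat -> dual E.
Hypothesis cz : forall i, contraction (z_ i).

Let s0 := opnorm Sigma.
Let m1 := fine (\int[P]_w (`|(G w : E)|)%:E)%E.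

Let s0_gt0 : 0 < s0. Proof. exact: opnorm_covariance_gt0. Qed.

Definition sample_sqr (i : nat) (w : Omega) : R :=
  n%:R^-1 * \sum_(k < n) z_ i (G_ k w) ^+ 2.

Let norm_expR l : 0 <= l ->
  (\int[P]_w (expR (l * `|(G w : E)|))%:E <= (expR (l * m1 + 4 * l ^+ 2 * s0))%:E)%E.
Proof.
move=> l0; have [u_ [ule unorm]] := norming_sequence sepE.
apply: (norm_vector_subgaussian gG ule unorm) => //; first exact: ltW.
by move=> u v cu gu; have := variance_le_opnorm sepE gG cu gu.
Qed.

Lemma scaled_gaussian (u : dual E) v c : is_gaussian P (fun w => u (G w)) v ->
  exists2 u' : dual E, (forall x, u' x = c * u x) &
  is_gaussian P (fun w => u' (G w)) (c ^+ 2 * v).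
Proof.
move=> gu; have [u' hu'] := dual_lincomb (fun i : 'I_1 => c) (fun=> u).
have u'E x : u' x = c * u x by rewrite hu' big_ord1.
exists u' => //; have [v' gv'] := dual_is_gaussian gG u'.
suff <- : v' = c ^+ 2 * v by [].
rewrite -(cov_variance gv') -(cov_variance gu).
by rewrite (covZl gG _ u'E) cov_sym (covZl gG _ u'E) mulrA expr2.
Qed.

Let lmax N (c : 'I_n -> R) (w : Omega) :=
  \big[Num.max/0]_(i < N) `|\sum_k c k * z_ i (G_ k w)|.

Let sumsq (c : 'I_n -> R) : R := \sum_k c k ^+ 2.

Let sumsq_ge0 c : 0 <= sumsq c.
Proof. by apply: sumr_ge0 => k _; exact: sqr_ge0. Qed.

(** For fixed coefficients, [sum_k c_k G_k] has the law of [|c| G]. *)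
Let lmax_law N (c : 'I_n -> R) l : 0 <= l ->
  (\int[P]_w (expR (l * lmax N c w))%:E <=
   (expR (l * Num.sqrt (sumsq c) * m1 + 4 * (l * Num.sqrt (sumsq c)) ^+ 2 * s0))%:E)%E.
Proof.
move=> l0; have r0 : 0 <= Num.sqrt (sumsq c) by exact: sqrtr_ge0.
apply: le_trans (norm_expR (mulr_ge0 l0 r0)).
pose h (x : 'I_N -> R) : \bar R := (expR (l * \big[Num.max/0]_i `|x i|))%:E.
have mh : measurable_fun setT (h : vec R 'I_N -> \bar R).
  apply/measurable_EFinP; apply: measurableT_comp => //.
  apply: measurable_funM; first exact: measurable_cst.
  apply: measurable_bigmax => j.
  by apply: measurableT_comp => //; exact: measurable_vec_coord.
pose V (i : 'I_N) w := \sum_k c k * z_ i (G_ k w).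
pose W (i : 'I_N) w := Num.sqrt (sumsq c) * z_ i (G w).
have mV i : measurable_fun setT (V i).
  by apply: measurable_sum => k; apply: measurable_funM => //; exact: measurable_dual_vector.
have mW i : measurable_fun setT (W i).
  by apply: measurable_funM => //; exact: measurable_dual_vector.
have H := @cramer_wold _ _ _ _ R P P _ V W mV mW h _ mh (fun x => expR_ge0 _).
rewrite (_ : (\int[P]_w (expR (l * lmax N c w))%:E = \int[P]_w h (W ^~ w))%E); last first.
  apply: H => xi A mA.
  have [u hu] := dual_lincomb xi (fun i : 'I_N => z_ i).
  have [v gv] := dual_is_gaussian gG u.
  have /choice[cu hcu] : forall k, exists u' : dual E, (forall x, u' x = c k * u x) /\
      is_gaussian P (fun w => u' (G w)) (c k ^+ 2 * v).
    by move=> k; have [u' h1 h2] := scaled_gaussian (c k) gv; exists u'.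
  have g1 := iid_dual_sum iidG (fun k => (hcu k).2).
  have [u' hu' g2] := scaled_gaussian (Num.sqrt (sumsq c)) gv.
  have E1 : (fun w => \sum_i xi i * V i w) = (fun w => \sum_k cu k (G_ k w)).
    apply/funext => w; rewrite /V.
    under eq_bigr do rewrite mulr_sumr.
    rewrite exchange_big/=; apply: eq_bigr => k _.
    rewrite (hcu k).1 hu mulr_sumr; apply: eq_bigr => i _; exact: mulrCA.
  have E2 : (fun w => \sum_i xi i * W i w) = (fun w => u' (G w)).
    apply/funext => w; rewrite hu' hu mulr_sumr; apply: eq_bigr => i _; exact: mulrCA.
  rewrite E1 E2; have [_ _ ->//] := g1; have [_ _ ->//] := g2.
  by rewrite -mulr_suml sqr_sqrtr// sumsq_ge0.
apply: ge0_le_integral => //.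
- by move=> w _; rewrite /h lee_fin expR_ge0.
- exact: (measurableT_comp mh (measurable_vec (f := fun w => W ^~ w) mW)).
- by apply: measurable_expRM; exact: measurable_norm_vector.
- move=> w _; rewrite /h lee_fin ler_expR -mulrA ler_wpM2l//.
  apply: bigmax_le; first exact: mulr_ge0.
  by move=> i _; rewrite /W normrM ger0_norm// ler_wpM2l//; exact: cz.
Qed.

(** [exp(a^2/2) = E exp(g a)] for a standard Gaussian [g]. The copies [G_k] of a
    second sample, tested on a functional [u0] of variance [v0 > 0], provide the
    Gaussian multipliers. *)
Lemma sample_sqr_expR N :
  (\int[P]_w (expR (n%:R / (64 * s0) * running_max sample_sqr N w))%:E <=
   (expR (n%:R + m1 ^+ 2 / (16 * s0)))%:E)%E.
Proof.
have nR0 : 0 < n%:R :> R by rewrite ltr0n.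
have [u0 [v0 [v0_gt0 gu0]]] := exists_positive_variance sepE gG Sigma0.
pose sd := Num.sqrt v0; have sd0 : 0 < sd by rewrite sqrtr_gt0.
have sd2 : sd ^+ 2 = v0 by rewrite sqr_sqrtr// ltW.
pose g (k : 'I_n) w := sd^-1 * u0 (G_ k w).
have mg k : measurable_fun setT (g k).
  by apply: measurable_funM => //; exact: measurable_dual_vector.
have gsum (a : 'I_n -> R) : is_gaussian P (fun w => \sum_k g k w * a k) (sumsq a).
  have /choice[u hu] : forall k, exists u : dual E, (forall x, u x = (sd^-1 * a k) * u0 x) /\
      is_gaussian P (fun w => u (G w)) ((sd^-1 * a k) ^+ 2 * v0).
    by move=> k; have [u h1 h2] := scaled_gaussian (sd^-1 * a k) gu0; exists u.
  have := iid_dual_sum iidG (fun k => (hu k).2).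
  rewrite (_ : \sum_i _ = sumsq a); last first.
    by apply: eq_bigr => k _; rewrite -sd2; field; rewrite gt_eqF.
  rewrite (_ : (fun w => \sum_i u i (G_ i w)) = (fun w => \sum_k g k w * a k))//.
  by apply/funext => w; apply: eq_bigr => k _; rewrite (hu k).1 /g mulrAC.
(* l^2 / 2 is the coefficient 1 / (64 s0) of the sum of squares *)
pose l := Num.sqrt (32 * s0)^-1.
have l0 : 0 <= l by exact: sqrtr_ge0.
have l2 : l ^+ 2 = (32 * s0)^-1 by rewrite sqr_sqrtr// invr_ge0 mulr_ge0// ltW.
pose K (z : Omega * Omega) : \bar R := (expR (l * lmax N (g ^~ z.2) z.1))%:E.
have mK : measurable_fun setT K.
  apply: measurable_expRM; apply: measurable_bigmax => i.
  apply: measurableT_comp => //; apply: measurable_sum => k.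
  apply: measurable_funM; first exact: (measurableT_comp (mg k) measurable_snd).
  exact: (measurableT_comp (measurable_dual_vector (G_ k) (z_ i)) measurable_fst).
have K0 z : (0 <= K z)%E by rewrite lee_fin expR_ge0.
have mK1 w : measurable_fun setT (fun w' => K (w, w')).
  exact: (measurableT_comp mK (pair1_measurable w)).
apply: (@le_trans _ _ (\int[P]_w \int[P]_w' K (w, w'))%E).
  apply: ge0_le_integral => //.
  - apply: measurable_expRM; apply: measurable_running_max => i.
    apply: measurable_funM => //; apply: measurable_sum => k.
    by apply: measurable_funX; exact: measurable_dual_vector.
  - exact: (@measurable_fun_fubini_tonelli_F _ _ _ _ _ P _ mK).
  move=> w _.
  rewrite /running_max.
  have [[i ->]|->] := bigmax0_attained (fun i : 'I_N => sample_sqr i w).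
  - have := is_gaussian_expR 1 (gsum (fun k => l * z_ i (G_ k w))).
    rewrite expr1n mul1r => gE.
    have -> : n%:R / (64 * s0) * sample_sqr i w = sumsq (fun k => l * z_ i (G_ k w)) / 2.
      rewrite /sumsq; under eq_bigr do rewrite exprMn.
      rewrite -mulr_sumr l2 /sample_sqr; field.
      by rewrite !gt_eqF.
    rewrite -gE; apply: ge0_le_integral => //.
    - apply: measurable_expRM; apply: measurable_sum => k.
      by apply: measurable_funM.
    - move=> w' _; rewrite /K lee_fin ler_expR mul1r /=.
      apply: (@le_trans _ _ (l * `|\sum_k g k w' * z_ i (G_ k w)|)).
        rewrite (_ : \sum_k g k w' * (l * _) = l * \sum_k g k w' * z_ i (G_ k w)); last first.
          by rewrite mulr_sumr; apply: eq_bigr => k _; rewrite mulrCA.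
        by rewrite ler_wpM2l// ler_norm.
      rewrite ler_wpM2l//.
      exact: (@le_bigmax _ _ _ _ (fun i : 'I_N => `|\sum_k g k w' * z_ i (G_ k w)|)).
  - rewrite mulr0 expR0 -(integral_prob_cst P 1).
    apply: ge0_le_integral => // w' _; rewrite /K lee_fin -[leLHS]expR0 ler_expR mulr_ge0//.
    exact: bigmax_ge_id.
rewrite (integral_prod_swap P mK K0).
(* the moment of the first sample is at most exp(l r m1 + r^2 / 8) with r^2 the sum
   of the g_k^2, and l r m1 <= r^2 / 8 + 2 l^2 m1^2, which leaves the exponential of
   r^2 / 4, of expectation sqrt 2 for each k *)
have mphi : measurable_fun setT (fun x : borel E => (4 * v0)^-1 * u0 x ^+ 2).
  by apply: measurable_funM => //; apply: measurable_funX; exact: measurable_dual.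
apply: (@le_trans _ _ ((expR (m1 ^+ 2 / (16 * s0)))%:E *
   \int[P]_w' (expR (\sum_k (4 * v0)^-1 * u0 (G_ k w') ^+ 2))%:E)%E).
  have mS : measurable_fun setT (fun w' => (expR (\sum_k (4 * v0)^-1 * u0 (G_ k w') ^+ 2))%:E).
    apply/measurable_EFinP; apply: measurableT_comp => //; apply: measurable_sum => k.
    by apply: measurable_funM => //; apply: measurable_funX; exact: measurable_dual_vector.
  rewrite -ge0_integralZl//.
  apply: ge0_le_integral => //.
  - by move=> w' _; exact: integral_ge0.
  - exact: (@measurable_fun_fubini_tonelli_G _ _ _ _ _ P _ mK).
  - exact: measurable_funeM.
  - move=> w' _; apply: (le_trans (lmax_law N (g ^~ w') l0)).
    rewrite -EFinM -expRD lee_fin ler_expR.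
    have -> : \sum_k (4 * v0)^-1 * u0 (G_ k w') ^+ 2 = sumsq (g ^~ w') / 4.
      rewrite /sumsq mulr_suml; apply: eq_bigr => k _.
      by rewrite /g -sd2; field; rewrite gt_eqF.
    set r := Num.sqrt _.
    have r2 : r ^+ 2 = sumsq (g ^~ w') by rewrite sqr_sqrtr.
    rewrite -r2 exprMn l2.
    have -> : 4 * ((32 * s0)^-1 * r ^+ 2) * s0 = r ^+ 2 / 8 by field; rewrite gt_eqF.
    have -> : m1 ^+ 2 / (16 * s0) = 2 * (l * m1) ^+ 2 by rewrite exprMn l2; field; rewrite gt_eqF.
    have := sqr_ge0 (r - 4 * (l * m1)); rewrite mulrAC; nra.
rewrite (iid_expR_sum iidG (phi := fun _ x => (4 * v0)^-1 * u0 x ^+ 2))//.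
have bound (k : 'I_n) : (\int[P]_w (expR ((4 * v0)^-1 * u0 (G_ k w) ^+ 2))%:E <= 2%:E)%E.
  have h : 2 * (4 * v0)^-1 * v0 = 2^-1 by field; rewrite gt_eqF.
  rewrite (is_gaussian_expR_sqr (copy_is_gaussian iidG k gu0)); last by rewrite h; lra.
  rewrite h lee_fin -[leLHS]mul1r ler_pdivrMr ?sqrtr_gt0; last by lra.
  have two : (2 : R) = Num.sqrt (2 ^+ 2) by rewrite sqrtr_sqr ger0_norm.
  rewrite [X in _ <= X * _]two.
  rewrite -sqrtrM ?sqr_ge0// (_ : 2 ^+ 2 * (1 - 2^-1) = 2 :> R); last by field.
  by rewrite -{1}(sqrtr1 R) ler_sqrt// ler1n.
apply: (@le_trans _ _ ((expR (m1 ^+ 2 / (16 * s0)))%:E * \prod_(k < n) 2%:E)%E).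
  apply: lee_wpmul2l; first by rewrite lee_fin expR_ge0.
  elim: (index_enum _) => [|k r IH]; first by rewrite !big_nil.
  rewrite !big_cons; apply: lee_pmul => //.
  - by apply: integral_ge0 => w _; rewrite lee_fin expR_ge0.
  - by apply: prode_ge0 => j _; apply: integral_ge0 => w _; rewrite lee_fin expR_ge0.
have -> : (\prod_(k < n) 2%:E = (2 ^+ n : R)%:E)%E.
  by rewrite prodEFin prodr_const card_ord.
rewrite -EFinM lee_fin addrC expRD ler_wpM2l ?expR_ge0//.
rewrite -[n%:R]mulr1 expRM_natl.
by rewrite lerXn2r// ?nnegrE ?expR_ge0// (le_trans _ (expR_ge1Dx 1)).
Qed.

End sample_moment.

(** * Exponential moments of the deviation *)

Lemma sum_triple (V : nmodType) (A B C : finType) (f : A * B * C -> V) :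
  \sum_i f i = \sum_a \sum_b \sum_c f (a, b, c).
Proof.
rewrite pair_bigA/= pair_bigA/=; apply: eq_bigr => -[[a b] c] _ //.
Qed.

Section quadratic_expandable.
Context d (Omega : measurableType d) (R : realType) (P : probability Omega R).
Context (J : finType) (n : nat) (X : J * bool * 'I_n -> Omega -> R) (S : (J * bool * 'I_n -> R) -> R).
Hypothesis n0 : (1 <= n)%N.
Variables (j : J) (a : R).
Hypothesis a1 : `|a| = 1.

(** The derivative at [x] of the bilinear form in the pairs of coordinates
    [(j, true, k)] and [(j, false, k)]. *)
Let lin (x : J * bool * 'I_n -> R) (i : J * bool * 'I_n) : R :=
  if i.1.1 == j then a * n%:R^-1 * x (j, ~~ i.1.2, i.2) else 0.

Lemma sum_lin (x y : J * bool * 'I_n -> R) :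
  \sum_i lin x i * y i =
  a * n%:R^-1 * \sum_k (x (j, true, k) * y (j, false, k) + x (j, false, k) * y (j, true, k)).
Proof.
rewrite sum_triple (bigD1 j)//= [X in _ + X]big1 ?addr0; last first.
  move=> i /negPf ij; rewrite big1// => b _; rewrite big1// => k _.
  by rewrite /lin/= ij mul0r.
rewrite big_bool/= -big_split/= mulr_sumr; apply: eq_bigr => k _.
by rewrite /lin/= eqxx; ring.
Qed.

(** The form is [a/n] times the sum over [k] of the product of two coordinates;
    rotating by [dl] produces the bilinear term and quadratic remainders. *)
Lemma expandable_quadratic (s : R) :
  (forall x v, is_gaussian P (fun w => \sum_i lin x i * X i w) v -> v <= S x) ->
  expandable P X S 1 (fun x => a * (n%:R^-1 * (\sum_k x (j, true, k) * x (j, false, k)) - s)).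
Proof.
move=> hS x; exists (lin x); split; first exact: hS.
move=> y dl dl01; rewrite sum_lin mul1r.
have [/andP[c0 c1] /andP[sn0 sn1]] := cos_onem_le dl01.
set c := cos dl in c0 c1 *; set sn := sin dl in c1 sn0 sn1 *.
have cs : c ^+ 2 + sn ^+ 2 = 1 by exact: cos2Dsin2.
have nR0 : 0 < n%:R :> R by rewrite ltr0n.
have inv1 : n%:R^-1 <= 1 :> R by rewrite invf_le1// ler1n.
have inv0 : 0 <= n%:R^-1 :> R by rewrite invr_ge0.
rewrite (_ : _ - _ = a * n%:R^-1 * (\sum_k (x (j, true, k) * x (j, false, k) -
   (c * x (j, true, k) - sn * y (j, true, k)) * (c * x (j, false, k) - sn * y (j, false, k))))); last first.
  by rewrite sumrB; ring.
have sqle (z : J * bool * 'I_n -> R) :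
    \sum_k (z (j, true, k) ^+ 2 + z (j, false, k) ^+ 2) <= \sum_i z i ^+ 2.
  rewrite sum_triple (bigD1 j)//= big_bool/= -big_split/= lerDl sumr_ge0// => i _.
  by rewrite sumr_ge0// => b _; rewrite sumr_ge0// => k _; exact: sqr_ge0.
rewrite -lerBlDl.
have -> : a * n%:R^-1 * (\sum_k (x (j, true, k) * x (j, false, k) -
   (c * x (j, true, k) - sn * y (j, true, k)) * (c * x (j, false, k) - sn * y (j, false, k)))) -
   sn * (a * n%:R^-1 * (\sum_k (x (j, true, k) * y (j, false, k) + x (j, false, k) * y (j, true, k)))) =
   n%:R^-1 * \sum_k (a * (sn ^+ 2 * (x (j, true, k) * x (j, false, k) - y (j, true, k) * y (j, false, k))
    - sn * (1 - c) * (x (j, true, k) * y (j, false, k) + x (j, false, k) * y (j, true, k)))).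
  rewrite mulrCA -mulrBr -mulrA mulrCA; congr (_ * _).
  rewrite [X in _ - X]mulr_sumr -sumrB mulr_sumr; apply: eq_bigr => k _; congr (_ * _).
  by rewrite -[x (j, true, k) * x (j, false, k) in LHS]mul1r -{1}cs; ring.
apply: (@le_trans _ _ (n%:R^-1 * \sum_k (sn ^+ 2 *
   ((x (j, true, k) ^+ 2 + x (j, false, k) ^+ 2) + (y (j, true, k) ^+ 2 + y (j, false, k) ^+ 2))))).
  rewrite ler_wpM2l//; apply: ler_sum => k _.
  move: (x (j, true, k)) (x (j, false, k)) (y (j, true, k)) (y (j, false, k)) => x1 x0 y1 y0.
  rewrite (le_trans (ler_norm _))// normrM a1 mul1r.
  have s2 : sn * (1 - c) <= sn ^+ 2.
    by rewrite (le_trans (ler_wpM2r c0 sn1))// mul1r.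
  have s20 : 0 <= sn * (1 - c) by rewrite mulr_ge0.
  apply: (le_trans (ler_normB _ _)).
  rewrite !normrM (ger0_norm sn0) (ger0_norm c0) -expr2.
  have h1 : `|x1 * x0 - y1 * y0| <= (x1 ^+ 2 + x0 ^+ 2 + (y1 ^+ 2 + y0 ^+ 2)) / 2.
    have := sqr_ge0 (x1 - x0); have := sqr_ge0 (x1 + x0).
    have := sqr_ge0 (y1 - y0); have := sqr_ge0 (y1 + y0).
    by rewrite ler_norml => *; apply/andP; split; nra.
  have h2 : `|x1 * y0 + x0 * y1| <= (x1 ^+ 2 + x0 ^+ 2 + (y1 ^+ 2 + y0 ^+ 2)) / 2.
    have := sqr_ge0 (x1 - y0); have := sqr_ge0 (x1 + y0).
    have := sqr_ge0 (x0 - y1); have := sqr_ge0 (x0 + y1).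
    by rewrite ler_norml => *; apply/andP; split; nra.
  have h3 : sn * (1 - c) * `|x1 * y0 + x0 * y1| <= sn ^+ 2 * ((x1 ^+ 2 + x0 ^+ 2 + (y1 ^+ 2 + y0 ^+ 2)) / 2).
    exact: ler_pM.
  have h4 : sn ^+ 2 * `|x1 * x0 - y1 * y0| <= sn ^+ 2 * ((x1 ^+ 2 + x0 ^+ 2 + (y1 ^+ 2 + y0 ^+ 2)) / 2).
    by rewrite ler_wpM2l// sqr_ge0.
  by rewrite mulrA in h3; lra.
rewrite -mulr_sumr big_split/= mulrCA ler_wpM2l ?sqr_ge0//.
have hx := sqle x; have hy := sqle y.
have x0 : 0 <= \sum_k (x (j, true, k) ^+ 2 + x (j, false, k) ^+ 2).
  by rewrite sumr_ge0// => k _; rewrite addr_ge0// sqr_ge0.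
have y0 : 0 <= \sum_k (y (j, true, k) ^+ 2 + y (j, false, k) ^+ 2).
  by rewrite sumr_ge0// => k _; rewrite addr_ge0// sqr_ge0.
apply: (@le_trans _ _ (1 * (\sum_i x i ^+ 2 + \sum_i y i ^+ 2))); last by lra.
by apply: ler_pM => //; [exact: addr_ge0|exact: lerD].
Qed.

End quadratic_expandable.

Lemma sqrD_le (R : realDomainType) (a b : R) : (a + b) ^+ 2 <= 2 * (a ^+ 2 + b ^+ 2).
Proof. by have := sqr_ge0 (a - b); nra. Qed.

Section deviation_moment.
Context d (Omega : measurableType d) (R : realType) (P : probability Omega R).
Context (E : completeNormedModType R) (G : {RV P >-> borel E}).
Hypothesis sepE : separable E.
Hypothesis gG : centered_gaussian_vector G.
Local Notation Sigma := (covariance_op P G).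
Variables (n : nat) (G_ : 'I_n -> {RV P >-> borel E}).
Hypothesis n0 : (1 <= n)%N.
Hypothesis iidG : iid_copies G_ G.

Let s0 := opnorm Sigma.
Let s0_ge0 : 0 <= s0. Proof. exact: opnorm_covariance_ge0. Qed.

Definition deviation (w : Omega) : R :=
  opnorm (sample_covariance_op (fun k => G_ k w : E) \- Sigma).

Variable u_ : nat -> dual E.
Hypothesis u_le : forall i, contraction (u_ i).
Hypothesis u_norming : forall x c, (forall i, `|u_ i x| <= c) -> `|x| <= c.

Let pr (m : nat) : nat * nat := odflt (0, 0)%N (unpickle m).

(** A single index enumerates the pairs of functionals, so that the deviation is
    the supremum of a sequence. *)
Let f_ (m : nat) (b : bool) : dual E := u_ (if b then (pr m).1 else (pr m).2).

Let nu m w := `|n%:R^-1 * (\sum_(k < n) f_ m true (G_ k w) * f_ m false (G_ k w)) -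
  cov G (f_ m true) (f_ m false)|.

Let nR0 : 0 < n%:R :> R. Proof. by rewrite ltr0n. Qed.

Let f_le m b : contraction (f_ m b). Proof. exact: u_le. Qed.

Let mnu m : measurable_fun setT (nu m).
Proof.
apply: measurableT_comp => //; apply: measurable_funB => //.
apply: measurable_funM => //; apply: measurable_sum => k.
by apply: measurable_funM; exact: measurable_dual_vector.
Qed.

Let nu_le m w : nu m w <= deviation w.
Proof. exact: (deviation_ge sepE gG (fun k => G_ k w) (f_le m true) (f_le m false)). Qed.

Let nu_dev w c : (forall m, nu m w <= c) -> deviation w <= c.
Proof.
move=> h; apply: (deviation_le sepE gG u_le u_norming) => i j.
by have := h (pickle (i, j)); rewrite /nu /f_ /pr pickleK.
Qed.

Let dev0 w : 0 <= deviation w.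
Proof. by apply: le_trans (nu_le 0 w); exact: normr_ge0. Qed.

Lemma measurable_deviation : measurable_fun setT deviation.
Proof. exact: (measurable_countable_supremum mnu nu_le nu_dev dev0). Qed.

Let variance_le_scaled (u : dual E) r v : 0 <= r -> (forall x, `|u x| <= r * `|x|) ->
  is_gaussian P (fun w => u (G w)) v -> v <= r ^+ 2 * s0.
Proof.
move=> r0 ur gu; have [r00|rn0] := eqVneq r 0.
  have u0 x : u x = 0 * u x.
    by rewrite mul0r; apply/eqP; rewrite -normr_le0 (le_trans (ur x))// r00 mul0r.
  by rewrite -(cov_variance gu) (covZl gG _ u0) mul0r mulr_ge0// sqr_ge0.
have {rn0}r0 : 0 < r by rewrite lt_neqAle eq_sym rn0.
have [u' hu' gu'] := scaled_gaussian gG r^-1 gu.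
have cu' : contraction u'.
  by move=> x; rewrite hu' normrM normfV (gtr0_norm r0) mulrC ler_pdivrMr// mulrC.
have := variance_le_opnorm sepE gG cu' gu'; rewrite -/s0 exprVn mulrC.
by rewrite ler_pdivrMr ?exprn_gt0// mulrC.
Qed.

Let X M (i : 'I_M * bool * 'I_n) w := f_ i.1.1 i.1.2 (G_ i.2 w).

Let gX M : gaussian_family P (@X M).
Proof.
split=> [i|xi]; first exact: measurable_dual_vector.
have /choice[u hu] : forall k, exists u : dual E, forall x,
    u x = \sum_(p : 'I_M * bool) xi (p, k) * f_ p.1 p.2 x.
  by move=> k; exact: (dual_lincomb (fun p : 'I_M * bool => xi (p, k)) (fun p => f_ p.1 p.2)).
have /choice[v hv] := fun k => dual_is_gaussian gG (u k).
exists (\sum_k v k).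
rewrite (_ : (fun w => _) = (fun w => \sum_k u k (G_ k w))); first exact: (iid_dual_sum iidG hv).
apply/funext => w; under [RHS]eq_bigr do rewrite hu.
rewrite exchange_big/= pair_bigA/=; apply: eq_bigr => -[[j b] k] _ //.
Qed.

Let S M (x : 'I_M * bool * 'I_n -> R) : R := \big[Num.max/0]_(j < M)
  (2 / n%:R ^+ 2 * s0 * \sum_k (x (j, true, k) ^+ 2 + x (j, false, k) ^+ 2)).

(** The linear form attached to a pair of functionals is a sum of independent
    Gaussians, one for each copy, whose variances are bounded through the norm
    of [Sigma]. *)
Let variance_lin M (j : 'I_M) (a : R) x v : `|a| = 1 ->
  is_gaussian P (fun w => a * n%:R^-1 * \sum_k (x (j, true, k) * f_ j false (G_ k w) +
     x (j, false, k) * f_ j true (G_ k w))) v -> v <= @S M x.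
Proof.
move=> a1 gv.
have /choice[u hu] : forall k, exists u : dual E, forall z,
    u z = a * n%:R^-1 * (x (j, true, k) * f_ j false z + x (j, false, k) * f_ j true z).
  move=> k; have [u hu] := dual_lincomb
    (fun b : bool => a * n%:R^-1 * x (j, ~~ b, k)) (fun b => f_ j b).
  by exists u => z; rewrite hu big_bool/=; ring.
have /choice[vk hvk] := fun k => dual_is_gaussian gG (u k).
have -> : v = \sum_k vk k.
  apply: (is_gaussian_uniq gv); have := iid_dual_sum iidG hvk.
  rewrite (_ : (fun w => \sum_k u k (G_ k w)) = (fun w => a * n%:R^-1 *
    \sum_k (x (j, true, k) * f_ j false (G_ k w) + x (j, false, k) * f_ j true (G_ k w))))//.
  by apply/funext => w; rewrite mulr_sumr; apply: eq_bigr => k _; rewrite hu.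
apply: (le_trans _ (le_bigmax _ _ j)).
rewrite mulr_sumr; apply: ler_sum => k _.
pose r := n%:R^-1 * (`|x (j, true, k)| + `|x (j, false, k)|).
have r0 : 0 <= r by rewrite mulr_ge0 ?invr_ge0// addr_ge0.
apply: (le_trans (variance_le_scaled r0 _ (hvk k))).
  move=> z; rewrite hu !normrM a1 mul1r normfV (gtr0_norm nR0) /r -mulrA ler_wpM2l ?invr_ge0//.
  rewrite (le_trans (ler_normD _ _))// mulrDl !normrM.
  by apply: lerD; rewrite ler_wpM2l//; exact: f_le.
have -> : 2 / n%:R ^+ 2 * s0 * (x (j, true, k) ^+ 2 + x (j, false, k) ^+ 2) =
    n%:R^-1 ^+ 2 * (2 * (x (j, true, k) ^+ 2 + x (j, false, k) ^+ 2)) * s0.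
  by field; rewrite gt_eqF.
rewrite ler_wpM2r// /r exprMn ler_wpM2l ?sqr_ge0//.
rewrite -(real_normK (num_real (x (j, true, k)))) -(real_normK (num_real (x (j, false, k)))).
exact: sqrD_le.
Qed.

(** The sample second moment of a contraction exceeds its variance by at most the
    deviation. This is what makes the deviation self-bounding. *)
Let S_le M w : @S M ((@X M) ^~ w) <= 4 / n%:R * s0 * (s0 + deviation w).
Proof.
have sd : 0 <= s0 + deviation w by rewrite addr_ge0.
have H b (j : 'I_M) : n%:R^-1 * \sum_k f_ j b (G_ k w) ^+ 2 <= s0 + deviation w.
  have := deviation_ge sepE gG (fun k => G_ k w) (f_le j b) (f_le j b).
  have [v gv] := dual_is_gaussian gG (f_ j b).
  have := variance_le_opnorm sepE gG (@f_le j b) gv.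
  rewrite -/s0 -(cov_variance gv) -/(deviation w) ler_norml => vs /andP[_].
  under [in X in X -> _]eq_bigr do rewrite -expr2.
  by lra.
apply: bigmax_le => [|j _]; first by rewrite !mulr_ge0// divr_ge0.
rewrite big_split/= /X/=.
have h1 := H true j; have h2 := H false j.
have -> : 2 / n%:R ^+ 2 * s0 * (\sum_k f_ j true (G_ k w) ^+ 2 + \sum_k f_ j false (G_ k w) ^+ 2) =
   2 / n%:R * s0 * (n%:R^-1 * \sum_k f_ j true (G_ k w) ^+ 2 +
     n%:R^-1 * \sum_k f_ j false (G_ k w) ^+ 2) by field; rewrite gt_eqF.
have -> : 4 / n%:R * s0 * (s0 + deviation w) = 2 / n%:R * s0 * (2 * (s0 + deviation w)) by ring.
by rewrite ler_wpM2l ?mulr_ge0 ?divr_ge0//; lra.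
Qed.

Let dev_running M l : 0 <= l ->
  ((\int[P]_w (expR (l * running_max nu M w))%:E *
    \int[P]_w (expR (- l * running_max nu M w))%:E) *
   (\int[P]_w (expR (l * running_max nu M w))%:E *
    \int[P]_w (expR (- l * running_max nu M w))%:E) <=
   \int[P]_w (expR (32 * l ^+ 2 / n%:R * s0 * (s0 + deviation w)))%:E)%E.
Proof.
move=> l0.
pose Q (j : 'I_M) (x : 'I_M * bool * 'I_n -> R) :=
  n%:R^-1 * (\sum_k x (j, true, k) * x (j, false, k)) - cov G (f_ j true) (f_ j false).
pose F (x : 'I_M * bool * 'I_n -> R) := \big[Num.max/0]_j `|Q j x|.
have mF : measurable_fun setT (F : vec R ('I_M * bool * 'I_n)%type -> R).
  apply: measurable_bigmax => j; apply: measurableT_comp => //.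
  apply: measurable_funB => //; apply: measurable_funM => //.
  by apply: measurable_sum => k; apply: measurable_funM; exact: measurable_vec_coord.
have mS : measurable_fun setT (@S M : vec R ('I_M * bool * 'I_n)%type -> R).
  apply: measurable_bigmax => j; apply: measurable_funM => //.
  apply: measurable_sum => k; apply: measurable_funD; apply: measurable_funX;
    exact: measurable_vec_coord.
have eQ j a : `|a| = 1 -> expandable P (@X M) (@S M) 1 (fun x => a * Q j x).
  move=> a1; apply: (expandable_quadratic n0 a1) => x v gv.
  apply: (@variance_lin M j a x v a1).
  move: gv; rewrite (_ : (fun w => _) = (fun w => a * n%:R^-1 *
     \sum_k (x (j, true, k) * f_ j false (G_ k w) + x (j, false, k) * f_ j true (G_ k w))))//.
  by apply/funext => w; rewrite (sum_lin j a x ((@X M) ^~ w)).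
have eF : expandable P (@X M) (@S M) 1 F.
  apply: (expandable_bigmax (F := fun j x => `|Q j x|)) => //.
    by move=> x; exact: bigmax_ge_id.
  move=> j; apply: (expandable_norm (F := Q j)).
    have := eQ j 1 (normr1 _).
    by rewrite (_ : (fun x => 1 * Q j x) = Q j)//; apply/funext => x; rewrite mul1r.
  have := eQ j (-1); rewrite normrN1 => /(_ erefl).
  by rewrite (_ : (fun x => -1 * Q j x) = (fun x => - Q j x))//; apply/funext => x; rewrite mulN1r.
have := rotation_concentration (gX M) mF mS ler01 eF l0.
move=> /le_trans; apply.
apply: ge0_le_integral => //.
- apply: measurable_expRM.
  by apply: (measurableT_comp mS); apply: measurable_vec => i; exact: measurable_dual_vector.
- apply: measurable_expRM; apply: measurable_funD => //.
  exact: measurable_deviation.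
- move=> w _; rewrite lee_fin ler_expR.
  have -> : 32 * l ^+ 2 / n%:R * s0 * (s0 + deviation w) =
    8 * l ^+ 2 * (4 / n%:R * s0 * (s0 + deviation w)) by ring.
  by rewrite ler_wpM2l ?S_le// mulr_ge0// sqr_ge0.
Qed.

(** The bound on the gradient involves the deviation itself, with a coefficient of
    order [l ^+ 2] that is smaller than [l] for small [l]. *)
Lemma deviation_self_bound l b r : 0 <= l -> 0 < b -> 0 <= r ->
  (b%:E <= \int[P]_w (expR (- l * deviation w))%:E)%E ->
  (\int[P]_w (expR (32 * l ^+ 2 / n%:R * s0 * (s0 + deviation w)))%:E <= (r ^+ 2)%:E)%E ->
  (\int[P]_w (expR (l * deviation w))%:E <= (r / b)%:E)%E.
Proof.
move=> l0 b0 r0 hb hr.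
apply: (expR_running_max_le mnu nu_le nu_dev dev0 l0) => M.
apply: (ereal_sqr_cancel _ b0 r0 _ (le_trans (dev_running M l0) hr)).
  by apply: integral_ge0 => w _; rewrite lee_fin expR_ge0.
apply: (le_trans hb); apply: ge0_le_integral => //.
- by apply: measurable_expRM; exact: measurable_deviation.
- by apply: measurable_expRM; exact: measurable_running_max.
- move=> w _; rewrite lee_fin ler_expR !mulNr lerN2 ler_wpM2l//.
  exact: (running_max_le nu_le dev0).
Qed.

Let H w := sup (range (fun i => sample_sqr G_ u_ i w)).

Let sample_ub w : has_ubound (range (fun i => sample_sqr G_ u_ i w)).
Proof.
exists (n%:R^-1 * \sum_(k < n) `|(G_ k w : E)| ^+ 2) => _ [i _ <-].
rewrite /sample_sqr ler_wpM2l ?invr_ge0//; apply: ler_sum => k _.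
rewrite -(real_normK (num_real (u_ i _))) lerXn2r ?nnegrE//; exact: u_le.
Qed.

(** The deviation is at most [s0] plus the supremum of the sample second moments. *)
Lemma deviation_expR_lty : Sigma <> (fun=> 0) ->
  (\int[P]_w (expR (n%:R / (64 * s0) * deviation w))%:E <=
   (expR (2 * n%:R +
     fine (\int[P]_w (`|(G w : E)|)%:E) ^+ 2 / (16 * s0)))%:E)%E.
Proof.
move=> Sigma0; set m1 := fine _.
have s0_gt0 : 0 < s0 by exact: opnorm_covariance_gt0.
have l0 : 0 <= n%:R / (64 * s0) by rewrite divr_ge0// mulr_ge0.
have msq i : measurable_fun setT (sample_sqr G_ u_ i).
  apply: measurable_funM => //; apply: measurable_sum => k.
  by apply: measurable_funX; exact: measurable_dual_vector.
have sqH i w : sample_sqr G_ u_ i w <= H w.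
  by apply: ub_le_sup => //; exists i.
have Hsq w c : (forall i, sample_sqr G_ u_ i w <= c) -> H w <= c.
  by move=> h; apply: ge_sup => [|_ [i _ <-]//]; exists (sample_sqr G_ u_ 0 w), 0%N.
have H0 w : 0 <= H w.
  apply: le_trans (sqH 0%N w); rewrite mulr_ge0 ?invr_ge0// sumr_ge0// => k _.
  exact: sqr_ge0.
have mH : measurable_fun setT H by exact: (measurable_countable_supremum msq sqH Hsq H0).
have HE := expR_running_max_le msq sqH Hsq H0 l0
  (sample_sqr_expR sepE gG Sigma0 n0 iidG u_le).
have devH w : deviation w <= H w + s0.
  apply: (deviation_le sepE gG u_le u_norming) => i j.
  have [vi gi] := dual_is_gaussian gG (u_ i); have [vj gj] := dual_is_gaussian gG (u_ j).
  apply: (le_trans (ler_normB _ _)); apply: lerD; last first.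
    apply: (le_trans (cov_le gG gi gj)).
    have := variance_le_opnorm sepE gG (u_le i) gi.
    by have := variance_le_opnorm sepE gG (u_le j) gj; rewrite -/s0; lra.
  have hi := sqH i w; have hj := sqH j w.
  apply: (@le_trans _ _ ((sample_sqr G_ u_ i w + sample_sqr G_ u_ j w) / 2)); last by lra.
  rewrite normrM normfV (gtr0_norm nR0) /sample_sqr -mulrDr -mulrA ler_wpM2l ?invr_ge0//.
  rewrite -big_split/= mulr_suml (le_trans (ler_norm_sum _ _ _))//; apply: ler_sum => k _.
  have := sqr_ge0 (u_ i (G_ k w) - u_ j (G_ k w)).
  have := sqr_ge0 (u_ i (G_ k w) + u_ j (G_ k w)).
  by rewrite ler_norml => *; apply/andP; split; nra.
have mHE : measurable_fun setT (fun w => (expR (n%:R / (64 * s0) * H w))%:E).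
  exact: measurable_expRM.
apply: (@le_trans _ _ ((expR n%:R)%:E * \int[P]_w (expR (n%:R / (64 * s0) * H w))%:E)%E).
  rewrite -ge0_integralZl//; apply: ge0_le_integral => //.
  - by apply: measurable_expRM; exact: measurable_deviation.
  - exact: measurable_funeM.
  - move=> w _; rewrite -EFinM -expRD lee_fin ler_expR.
    apply: (le_trans (ler_wpM2l l0 (devH w))).
    rewrite mulrDr addrC lerD2r (_ : n%:R / (64 * s0) * s0 = n%:R / 64); last by field; rewrite gt_eqF.
    by have := nR0; rewrite ler_pdivrMr//; lra.
apply: (le_trans (lee_wpmul2l _ HE)); first by rewrite lee_fin expR_ge0.
by rewrite -EFinM -expRD lee_fin ler_expR addrA -mulr2n -[_ *+ 2]mulr_natl.
Qed.

End deviation_moment.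

(** * Concentration of a self-bounding variable *)

Section self_bounded.
Context d (Omega : measurableType d) (R : realType) (P : probability Omega R).
Variables (Y : Omega -> R) (q s K : R).
Hypothesis mY : measurable_fun setT Y.
Hypothesis Y0 : forall w, 0 <= Y w.
Hypothesis q0 : 0 < q.
Hypothesis Y_self : forall l b r : R, 0 <= l -> 0 < b -> 0 <= r ->
  (b%:E <= \int[P]_w (expR (- l * Y w))%:E)%E ->
  (\int[P]_w (expR (q * l ^+ 2 * (s + Y w)))%:E <= (r ^+ 2)%:E)%E ->
  (\int[P]_w (expR (l * Y w))%:E <= (r / b)%:E)%E.
Hypothesis Y_expR : (\int[P]_w (expR ((2 * q)^-1 * Y w))%:E <= (expR K)%:E)%E.

Local Notation m := (fine (\int[P]_w (Y w)%:E)%E).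

Let q2 : 0 < (2 * q)^-1. Proof. by rewrite invr_gt0 mulr_gt0. Qed.

Let mE c : measurable_fun setT (fun w => (expR (c * Y w))%:E).
Proof.
exact: measurable_expRM.
Qed.

Let meanE : (\int[P]_w (Y w)%:E = m%:E)%E.
Proof.
have mYE : measurable_fun setT (fun w => (Y w)%:E) by exact/measurable_EFinP.
have I0 : (0 <= \int[P]_w (Y w)%:E)%E.
  by apply: integral_ge0 => w _; rewrite lee_fin.
rewrite fineK// fin_numE; apply/andP; split; first by rewrite gt_eqF// (lt_le_trans _ I0).
rewrite lt_eqF//.
apply: (@le_lt_trans _ _ ((2 * q)%:E * \int[P]_w (expR ((2 * q)^-1 * Y w))%:E)%E).
  rewrite -ge0_integralZl//; last by rewrite lee_fin mulr_ge0// ltW.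
  apply: ge0_le_integral => //.
  - by move=> w _; rewrite lee_fin.
  - exact: measurable_funeM.
  - move=> w _; rewrite -EFinM lee_fin -ler_pdivrMl ?mulr_gt0//.
    by have := expR_ge1Dx ((2 * q)^-1 * Y w); lra.
have q2' : (0 <= (2 * q)%:E)%E by rewrite lee_fin mulr_ge0// ltW.
by apply: (le_lt_trans (lee_wpmul2l q2' Y_expR)); rewrite -EFinM ltry.
Qed.

Lemma self_bounded_mean_le : m <= 2 * q * K.
Proof.
have := le_trans (expR_jensen mY Y0 meanE (2 * q)^-1) Y_expR.
by rewrite lee_fin ler_expR ler_pdivrMl ?mulr_gt0.
Qed.

Let m0 : 0 <= m.
Proof. by apply: fine_ge0; apply: integral_ge0 => w _; rewrite lee_fin. Qed.

Let expR_fin (l : R) : 0 <= l <= (2 * q)^-1 ->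
  (\int[P]_w (expR (l * Y w))%:E = (fine (\int[P]_w (expR (l * Y w))%:E))%:E)%E.
Proof.
move=> /andP[l0 lq]; rewrite fineK// ge0_fin_numE; last first.
  by apply: integral_ge0 => w _; rewrite lee_fin expR_ge0.
apply: le_lt_trans (ltry (expR K)); apply: le_trans Y_expR.
apply: ge0_le_integral => // w _.
by rewrite lee_fin ler_expR ler_wpM2r.
Qed.

Let expRN_fin (l : R) : 0 <= l ->
  (\int[P]_w (expR (- l * Y w))%:E = (fine (\int[P]_w (expR (- l * Y w))%:E))%:E)%E.
Proof.
move=> l0; rewrite fineK// ge0_fin_numE; last first.
  by apply: integral_ge0 => w _; rewrite lee_fin expR_ge0.
apply: le_lt_trans (ltry 1); rewrite -(integral_prob_cst P 1).
apply: ge0_le_integral => // w _.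
by rewrite lee_fin -expR0 ler_expR mulNr oppr_le0 mulr_ge0.
Qed.

(** Writing [a] and [b] for the exponential moments of [l (Y - m)] and
    [- l (Y - m)], both at least 1 by Jensen, convexity of the exponential
    bounds the moment in the self-bounding hypothesis by
    [expR (q l ^+ 2 (s + m)) * a] as long as [q * l <= 1], so that the
    hypothesis reads [(a * b) ^+ 2 <= expR (q l ^+ 2 (s + m)) * a] and one
    factor [a] cancels. *)
Lemma self_bounded_expR (l : R) : 0 <= l <= (2 * q)^-1 ->
  (\int[P]_w (expR (l * Y w))%:E <= (expR (l * m + q * l ^+ 2 * (s + m)))%:E)%E /\
  (\int[P]_w (expR (- l * Y w))%:E <= (expR (- l * m + q * l ^+ 2 * (s + m)))%:E)%E.
Proof.
move=> /[dup] lq /andP[l0 lq2].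
have AE := expR_fin lq; have BE := expRN_fin l0.
set A := fine _ in AE; set B := fine _ in BE.
have A1 : expR (l * m) <= A.
  by rewrite -lee_fin -AE; exact: (expR_jensen mY Y0 meanE l).
have B1 : expR (- l * m) <= B.
  by rewrite -lee_fin -BE; exact: (expR_jensen mY Y0 meanE (- l)).
have A0 : 0 < A by apply: lt_le_trans A1; exact: expR_gt0.
have B0 : 0 < B by apply: lt_le_trans B1; exact: expR_gt0.
pose a := A * expR (- l * m); pose b := B * expR (l * m).
have ee : expR (l * m) * expR (- l * m) = 1 by rewrite -expRD mulNr subrr expR0.
have a1 : 1 <= a by rewrite -ee /a ler_wpM2r// expR_ge0.
have b1 : 1 <= b by rewrite -ee /b mulrC ler_wpM2r// expR_ge0.
have AEa : A = a * expR (l * m) by rewrite /a -mulrA [_ * expR (l * m)]mulrC ee mulr1.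
have BEb : B = b * expR (- l * m) by rewrite /b -mulrA ee mulr1.
pose th := q * l.
have th01 : 0 <= th <= 1.
  rewrite /th mulr_ge0//= ?(ltW q0)//.
  apply: (@le_trans _ _ (q * (2 * q)^-1)); first by rewrite ler_wpM2l// ltW.
  by rewrite ler_pdivrMr ?mulr_gt0//; have := q0; lra.
pose e := expR (q * l ^+ 2 * (s + m)); have e0 : 0 < e := expR_gt0 _.
have self : (\int[P]_w (expR (q * l ^+ 2 * (s + Y w)))%:E <= (e * a)%:E)%E.
  have /andP[th0 th1] := th01.
  apply: (@le_trans _ _ (\int[P]_w ((e * (1 - th))%:E +
      (e * th * expR (- l * m))%:E * (expR (l * Y w))%:E))%E).
    apply: ge0_le_integral => //.
    - by apply: measurable_expRM; exact: measurable_funD.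
    - apply: emeasurable_funD; first exact: measurable_cst.
      exact: measurable_funeM.
    - move=> w _; rewrite -EFinM -EFinD lee_fin.
      have -> : q * l ^+ 2 * (s + Y w) = q * l ^+ 2 * (s + m) + th * (l * Y w - l * m).
        by rewrite /th; ring.
      rewrite expRD -/e -(mulrA (e * th)) -expRD mulNr addrC [- _ + _]addrC -mulrA -mulrDr.
      by rewrite ler_wpM2l ?(ltW e0)// addrC; exact: expR_convex0.
  have c0 : 0 <= e * th * expR (- l * m) by rewrite mulr_ge0 ?expR_ge0// mulr_ge0// ltW.
  have c1 : 0 <= e * (1 - th) by rewrite mulr_ge0 ?subr_ge0// ltW.
  rewrite ge0_integralD//; last 2 first.
  - by move=> w _; rewrite -EFinM lee_fin mulr_ge0// expR_ge0.
  - exact: measurable_funeM.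
  rewrite integral_prob_cst ge0_integralZl// AE -EFinM -EFinD lee_fin.
  have -> : e * th * expR (- l * m) * A = e * (th * a) by rewrite /a; ring.
  by rewrite -mulrDr ler_wpM2l ?(ltW e0)//; nra.
have r0 : 0 <= Num.sqrt (e * a) := sqrtr_ge0 _.
have ea0 : 0 <= e * a by rewrite mulr_ge0 ?(ltW e0)// (le_trans _ a1).
have h : (\int[P]_w (expR (l * Y w))%:E <= (Num.sqrt (e * a) / B)%:E)%E.
  by apply: (Y_self l0 B0 r0); rewrite ?BE// sqr_sqrtr.
have {h} ab : a * b ^+ 2 <= e.
  move: h; rewrite AE lee_fin ler_pdivlMr// => h.
  have ABE : A * B = a * b by rewrite /a /b mulrACA [expR (- _ * _) * _]mulrC ee mulr1.
  have : (a * b) ^+ 2 <= e * a.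
    rewrite -ABE -[leRHS](sqr_sqrtr ea0) ler_pXn2r// nnegrE.
    exact: mulr_ge0 (ltW A0) (ltW B0).
  rewrite exprMn (_ : a ^+ 2 * b ^+ 2 = a * b ^+ 2 * a); last by ring.
  by rewrite ler_pM2r// (lt_le_trans _ a1).
have b21 : 1 <= b ^+ 2 by rewrite exprn_ege1.
have a0 : 0 <= a by rewrite (le_trans _ a1).
have b0 : 0 <= b by rewrite (le_trans _ b1).
rewrite AE BE !lee_fin !expRD -/e AEa BEb ![expR _ * e]mulrC.
split; rewrite ler_wpM2r ?expR_ge0//.
  by apply: le_trans ab; rewrite ler_peMr.
apply: le_trans ab; apply: (@le_trans _ _ (b ^+ 2)); last by rewrite ler_peMl ?sqr_ge0.
by rewrite expr2 ler_peMr.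
Qed.

Lemma self_bounded_tail (l x : R) : 0 <= l <= (2 * q)^-1 ->
  (P [set w | (x <= `|Y w - m|)%R] <=
   (2 * expR (- (l * x) + q * l ^+ 2 * (s + m)))%:E)%E.
Proof.
move=> lq; have [hA hB] := self_bounded_expR lq.
have /andP[l0 _] := lq.
set e := expR (- (l * x)); have e0 : 0 <= e := expR_ge0 _.
have mS : measurable [set w | (x <= `|Y w - m|)%R].
  have mf : measurable_fun setT (fun w => `|Y w - m|).
    by apply: measurableT_comp => //; exact: measurable_funB.
  have := mf measurableT `[x, +oo[%classic (measurable_itv _); rewrite setTI.
  by congr measurable; apply/seteqP; split=> w /=; rewrite in_itv/= andbT.
apply: (@le_trans _ _ (\int[P]_w ((e * expR (- l * m))%:E * (expR (l * Y w))%:E +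
    (e * expR (l * m))%:E * (expR (- l * Y w))%:E))%E).
  rewrite -[X in P X]setIT -integral_indic//.
  apply: ge0_le_integral => //.
  - exact/measurable_EFinP/measurable_indic.
  - by apply: emeasurable_funD; apply: emeasurable_funM => //; exact: measurable_cst.
  - move=> w _; rewrite -!EFinM -EFinD lee_fin indicE.
    have -> : e * expR (- l * m) * expR (l * Y w) = expR (- (l * x) + - l * m + l * Y w).
      by rewrite !expRD.
    have -> : e * expR (l * m) * expR (- l * Y w) = expR (- (l * x) + l * m + - l * Y w).
      by rewrite !expRD.
    have [|_] := boolP (w \in _); last by rewrite addr_ge0 ?expR_ge0.
    rewrite inE/= => hx.
    have h0 y z : 0 <= y -> 1 <= expR y + expR z.
      move=> y0; apply: (@le_trans _ _ (expR y)); last by rewrite lerDl expR_ge0.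
      by rewrite -expR0 ler_expR.
    have [ym|ym] := leP 0 (Y w - m).
      apply: h0; move: hx; rewrite ger0_norm// => hx.
      have := ler_wpM2l l0 hx; lra.
    rewrite addrC; apply: h0; move: hx; rewrite ltr0_norm// => hx.
    have := ler_wpM2l l0 hx; lra.
rewrite ge0_integralD//; last 4 first.
- by move=> w _; rewrite -EFinM lee_fin !mulr_ge0 ?expR_ge0.
- exact: measurable_funeM.
- by move=> w _; rewrite -EFinM lee_fin !mulr_ge0 ?expR_ge0.
- exact: measurable_funeM.
rewrite !ge0_integralZl ?lee_fin ?mulr_ge0 ?expR_ge0//.
have cA : (0 <= (e * expR (- l * m))%:E)%E by rewrite lee_fin mulr_ge0 ?expR_ge0.
have cB : (0 <= (e * expR (l * m))%:E)%E by rewrite lee_fin mulr_ge0 ?expR_ge0.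
apply: (le_trans (leeD (lee_wpmul2l cA hA) (lee_wpmul2l cB hB))).
rewrite -!EFinM -EFinD lee_fin /e -!expRD; apply: eqW.
by rewrite mulr_natl mulr2n; congr (expR _ + expR _); ring.
Qed.

End self_bounded.

(** * The concentration inequality *)

(** The choice of the exponent. With [a = 1 + sqrt rho] and [tau = sqrt (t / n)],
    the bound on [m] gives [s + m <= 129 s a^2], and
    [l = n / (64 s) * min (tau / a) 1] makes the quadratic term at most
    [129 / 128 * t] while [l x] is at least [256 / 64 * t]; the constant 256 is
    there to make the difference exceed [2 t]. *)
Lemma deviation_exponent_le (R : realType) (s m n rho t : R) :
  0 < s -> 0 < n -> 0 <= rho -> 1 <= t -> m <= s * (128 + 4 * rho) ->
  let q := 32 * s / n in
  let x := 256 * s * ((1 + Num.sqrt rho) * Num.sqrt (t / n) + t / n) in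
  exists2 l, 0 <= l <= (2 * q)^-1 & - (l * x) + q * l ^+ 2 * (s + m) <= - (2 * t).
Proof.
move=> s0 n0 rho0 t1 hm q x.
have t0 : 0 < t by apply: lt_le_trans t1.
set a := 1 + Num.sqrt rho; set tau := Num.sqrt (t / n).
have sr0 : 0 <= Num.sqrt rho := sqrtr_ge0 _.
have tau2 : t = n * tau ^+ 2.
  by rewrite sqr_sqrtr ?divr_ge0 ?(ltW t0) ?(ltW n0)//; field; rewrite gt_eqF.
have tau0 : 0 <= tau := sqrtr_ge0 _.
have a0 : 0 < a by rewrite ltr_wpDr.
have sm : s + m <= 129 * (s * a ^+ 2).
  apply: (@le_trans _ _ (s * (129 + 4 * rho))); first by lra.
  rewrite mulrCA ler_wpM2l ?(ltW s0)// /a.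
  by have := sqr_sqrtr rho0; nra.
have qi : (2 * q)^-1 = n / (64 * s).
  by rewrite /q; field; rewrite !gt_eqF.
have tn : t / n = tau ^+ 2 by rewrite tau2; field; rewrite gt_eqF.
pose c := Num.min (tau / a) 1.
have c0 : 0 <= c by rewrite le_min ler01 divr_ge0// ltW.
have c1 : c <= 1 by rewrite ge_min lexx orbT.
have ca : c * a <= tau by rewrite -ler_pdivlMr// ge_min lexx.
have cx : tau ^+ 2 <= c * (a * tau + tau ^+ 2).
  have [h|h] := leP (tau / a) 1; rewrite /c.
    rewrite min_l// mulrDr (_ : tau / a * (a * tau) = tau ^+ 2).
      by rewrite lerDl mulr_ge0 ?divr_ge0 ?sqr_ge0 ?(ltW a0).
    by field; rewrite gt_eqF.
  by rewrite min_r ?(ltW h)// mul1r lerDr mulr_ge0// ltW.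
exists (n / (64 * s) * c).
  rewrite qi mulr_ge0//= ?divr_ge0 ?mulr_ge0 ?(ltW s0) ?(ltW n0)//.
  by rewrite ler_piMr// divr_ge0 ?mulr_ge0 ?(ltW s0) ?(ltW n0).
have h1 : n / (64 * s) * c * x = 4 * n * (c * (a * tau + tau ^+ 2)).
  by rewrite /x -/a -/tau tn; field; rewrite gt_eqF.
have h2 : q * (n / (64 * s) * c) ^+ 2 * (129 * (s * a ^+ 2)) =
    129 / 128 * n * (c * a) ^+ 2.
  by rewrite /q; field; rewrite !gt_eqF.
have h3 : q * (n / (64 * s) * c) ^+ 2 * (s + m) <= 129 / 128 * t.
  apply: (@le_trans _ _ (129 / 128 * n * (c * a) ^+ 2)).
    by rewrite -h2 ler_wpM2l// mulr_ge0 ?sqr_ge0// divr_ge0 ?mulr_ge0 ?(ltW s0) ?(ltW n0).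
  rewrite tau2 [leRHS]mulrA ler_wpM2l ?mulr_ge0 ?(ltW n0)//.
  by rewrite lerXn2r ?nnegrE// mulr_ge0// ltW.
have h4 : 4 * t <= n / (64 * s) * c * x.
  by rewrite h1 tau2 [leLHS]mulrA ler_wpM2l// mulr_ge0 ?(ltW n0).
by lra.
Qed.

Theorem theorem4p1 (R : realType) :
  exists2 C : R, 0 < C &
  forall (d : measure_display) (Omega : measurableType d)
    (P : probability Omega R) (E : completeNormedModType R),
  separable E ->
  forall G : {RV P >-> borel E},
  centered_gaussian_vector G ->
  let Sigma : dual E -> E := covariance_op P G in
  Sigma <> (fun=> 0) ->
  forall (n : nat) (G_ : 'I_n -> {RV P >-> borel E}),
  (1 <= n)%N ->
  iid_copies G_ G ->
  let hSigma : Omega -> dual E -> E :=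
    fun w => sample_covariance_op (fun k => G_ k w) in
  let dev : Omega -> R := fun w => opnorm (hSigma w \- Sigma) in
  let r : R := effective_rank P G in
  forall t : R, 1 <= t ->
  (P [set w | (C * opnorm Sigma *
               ((1 + Num.sqrt (r / n%:R)) * Num.sqrt (t / n%:R) + t / n%:R)
               <= `|dev w - fine 'E_P[dev]|)%R]
   <= (expR (- t))%:E)%E.
Proof.
exists 256; first by [].
move=> d Omega P E sepE G gG Sigma Sigma0 n G_ n0 iidG hSigma dev r t t1.
have [u_ [u_le u_norming]] := norming_sequence sepE.
have s0 : 0 < opnorm Sigma by exact: opnorm_covariance_gt0.
have nR0 : 0 < n%:R :> R by rewrite ltr0n.
have q0 : 0 < 32 * opnorm Sigma / n%:R by rewrite divr_gt0// mulr_gt0.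
have mdev : measurable_fun setT dev by exact: (measurable_deviation sepE gG G_ u_le u_norming).
have dev0 w : 0 <= dev w.
  apply: le_trans (deviation_ge sepE gG (fun k => G_ k w) (u_le 0%N) (u_le 0%N)).
  exact: normr_ge0.
have self (l b x : R) : 0 <= l -> 0 < b -> 0 <= x ->
    (b%:E <= \int[P]_w (expR (- l * dev w))%:E)%E ->
    (\int[P]_w (expR (32 * opnorm Sigma / n%:R * l ^+ 2 * (opnorm Sigma + dev w)))%:E
      <= (x ^+ 2)%:E)%E ->
    (\int[P]_w (expR (l * dev w))%:E <= (x / b)%:E)%E.
  move=> l0 b0 x0 hb hx.
  apply: (deviation_self_bound sepE gG n0 iidG u_le u_norming l0 b0 x0 hb).
  apply: le_trans hx; apply: eqW.
  apply: eq_integral => w _; congr (expR _)%:E; rewrite (_ : deviation _ _ w = dev w)//.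
  by rewrite /Sigma; ring.
have bound := deviation_expR_lty sepE gG n0 iidG u_le u_norming Sigma0.
have qi : n%:R / (64 * opnorm Sigma) = (2 * (32 * opnorm Sigma / n%:R))^-1.
  by field; rewrite !gt_eqF.
rewrite qi in bound.
have m_le := self_bounded_mean_le mdev dev0 q0 bound.
have r0 : 0 <= r by rewrite divr_ge0 ?sqr_ge0// ltW.
have rE : r = fine (\int[P]_w (`|(G w : E)|)%:E)%E ^+ 2 / opnorm Sigma.
  by rewrite /r /effective_rank expectation.unlock.
have [|l lq hl] := deviation_exponent_le (rho := r / n%:R)
  (m := fine (\int[P]_w (dev w)%:E)%E) s0 nR0 (divr_ge0 r0 (ltW nR0)) t1.
  apply: (le_trans m_le); apply: eqW.
  by rewrite rE; field; rewrite !gt_eqF.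
rewrite expectation.unlock.

apply: (le_trans (self_bounded_tail mdev dev0 q0 self bound _ lq)).
rewrite lee_fin.
(* the factor 2 of the two tails is absorbed by exp(t) *)
apply: (@le_trans _ _ (expR t * expR (- (2 * t)))).
  apply: ler_pM; rewrite ?expR_ge0//; last by rewrite ler_expR.
  by apply: le_trans (expR_ge1Dx t); lra.
by rewrite -expRD ler_expR; lra.
Qed.
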